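(* Let $s\in(0,1)$ and $r>d/(2s)$. Let $a:\Omega\times\mathbb R\to\mathbb R$ be a Carathéodory function that is monotonically increasing in its second variable with $a(\cdot,0)\in L^r(\Omega)$, and let $L:\Omega\times\mathbb R\to\mathbb R$ be a Carathéodory function. Assume that for every $\mathfrak m>0$ there exist $\varphi_{\mathfrak m}\in L^r(\Omega)$ and $\sigma_{\mathfrak m}\in L^1(\Omega)$ such that $$|a(x,u)|\le\varphi_{\mathfrak m}(x),\qquad |L(x,u)|\le\sigma_{\mathfrak m}(x)\qquad\text{for a.e. }x\in\Omega,\ u\in[-\mathfrak m,\mathfrak m].$$ Then the problem of minimizing $J(u,q)$ over $(u,q)\in\tilde H^s(\Omega)\times\mathbb Q_{ad}$ subject to $$\mathcal A(u,v)+\int_\Omega a(x,u)v\,\mathrm dx=\int_\Omega qv\,\mathrm dx\qquad\forall v\in\tilde H^s(\Omega)$$ admits at least one solution $(\bar u,\bar q)\in(\tilde H^s(\Omega)\cap L^\infty(\Omega))\times\mathbb Q_{ad}$.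
   Context: Let $d\ge2$ be an integer and $\Omega\subset\mathbb R^d$ an open bounded domain with Lipschitz boundary. $\tilde H^s(\Omega)$ is the closure of $C_0^\infty(\Omega)$ in $H^s(\mathbb R^d)$, equivalently $\{v\in H^s(\mathbb R^d):\operatorname{supp}v\subset\overline\Omega\}$. The bilinear form is $$\mathcal A(u,v)=\frac{C(d,s)}2\int_{\mathbb R^d}\int_{\mathbb R^d}\frac{(u(x)-u(y))(v(x)-v(y))}{|x-y|^{d+2s}}\,\mathrm dx\,\mathrm dy,\qquad C(d,s)=\frac{2^{2s}s\Gamma(s+\frac d2)}{\pi^{d/2}\Gamma(1-s)}.$$ Fix $\lambda>0$, $\mu>0$ and real numbers $\alpha<0<\beta$. The cost functional is $J(u,q)=\int_\Omega L(x,u)\,\mathrm dx+\frac\lambda2\|q\|_{L^2(\Omega)}^2+\mu\|q\|_{L^1(\Omega)}$ and the admissible set is $\mathbb Q_{ad}=\{v\in L^2(\Omega):\alpha\le v(x)\le\beta\text{ for a.e. }x\in\Omega\}$. In addition, as a standing assumption on the state equation, for every $\mathfrak m>0$ there is $\tilde\varphi_{\mathfrak m}\in L^{2d/(d+2s)}(\Omega)$ with $|a(x,u)|\le\tilde\varphi_{\mathfrak m}(x)$ for a.e. $x\in\Omega$, $u\in[-\mathfrak m,\mathfrak m]$. Under the assumptions on $a$, the state equation has, for every $q\in L^r(\Omega)$, a unique solution $u\in\tilde H^s(\Omega)\cap L^\infty(\Omega)$. *)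

(* Defs.v *)
From HB Require Import structures.
From mathcomp Require Import all_boot all_order all_algebra.
From mathcomp Require Import all_classical all_reals all_analysis.

Set Implicit Arguments.
Unset Strict Implicit.
Unset Printing Implicit Defensive.
Import Order.TTheory GRing.Theory Num.Theory.
Import numFieldNormedType.Exports.

Local Open Scope classical_set_scope.
Local Open Scope ring_scope.

Definition rV_display : measure_display -> measure_display.
Proof. exact. Qed.

Section borel_rV.
Context {d} {T : measurableType d} (n : nat).

Let coord : 'I_n -> 'rV[T]_n -> T := fun i x => x ord0 i.

Let borel_set0 : g_sigma_preimage coord set0.
Proof. exact: sigma_algebra0. Qed.

Let borel_setC A : g_sigma_preimage coord A -> g_sigma_preimage coord (~` A).
Proof. exact: sigma_algebraC. Qed.

Let borel_bigcup (F : _^nat) : (forall i, g_sigma_preimage coord (F i)) ->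
  g_sigma_preimage coord (\bigcup_i (F i)).
Proof. exact: sigma_algebra_bigcup. Qed.

(* The product sigma-algebra; for [T := R] these are the Borel sets of R^n. *)
HB.instance Definition _ := @isMeasurable.Build (rV_display d)
  'rV[T]_n (g_sigma_preimage coord) borel_set0 borel_setC borel_bigcup.

Lemma measurable_rV_coord (i : 'I_n) :
  measurable_fun [set: 'rV[T]_n] (fun x : 'rV[T]_n => x ord0 i).
Proof.
move=> _ Y mY; rewrite setTI; apply: sub_sigma_algebra => /=.
rewrite -bigcup_seq/=; exists i => /=; first by rewrite mem_index_enum.
by exists Y => //; rewrite setTI.
Qed.

End borel_rV.

Lemma measurable_fun_rVP d1 d2 (T1 : measurableType d1)
    (T2 : measurableType d2) n (f : T1 -> 'rV[T2]_n) :
  measurable_fun [set: T1] f <->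
  forall i, measurable_fun [set: T1] (fun x => f x ord0 i).
Proof.
pose c := fun (i : 'I_n) (x : 'rV[T2]_n) => x ord0 i.
apply: (@iff_trans _ (g_sigma_preimage (fun i => c i \o f) `<=` measurable)).
  rewrite g_sigma_preimage_comp; split=> [mf A [/= C preC <-]|prefS].
    exact: mf.
  by move=> _ A mA; apply: prefS; exists A.
split=> [cfS i|mf].
- move=> _ A mA.
  apply: cfS; apply: sub_sigma_algebra.
  rewrite -bigcup_seq/=; exists i => /=; first by rewrite mem_index_enum.
  by exists A.
- apply: smallest_sub; first exact: sigma_algebra_measurable.
  rewrite -bigcup_seq/=; apply: bigcup_sub => i Ii.
  by move=> A [B mB <-]; exact: mf.
Qed.

Section lebesgue_rV.
Context {R : realType}.

Definition cons_rV n (p : measurableTypeR R * 'rV[R]_n) : 'rV[R]_n.+1 :=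
  row_mx (p.1 : R)%:M p.2.

Lemma cons_rV0 n p : @cons_rV n p ord0 ord0 = p.1.
Proof.
rewrite /cons_rV (_ : ord0 = lshift n (ord0 : 'I_1)); last exact/val_inj.
by rewrite (row_mxEl (p.1 : R)%:M) mxE eqxx mulr1n.
Qed.

Lemma cons_rVS n p (i : 'I_n) : cons_rV p ord0 (lift ord0 i) = p.2 ord0 i.
Proof.
rewrite /cons_rV (_ : lift ord0 i = rshift 1 i); last exact/val_inj.
by rewrite (row_mxEr (p.1 : R)%:M).
Qed.

Lemma measurable_cons_rV n : measurable_fun setT (@cons_rV n).
Proof.
apply/(@measurable_fun_rVP _ _ _ R) => i.
have [j ->|->] := unliftP ord0 i.
- under eq_fun do rewrite cons_rVS.
  exact: (measurableT_comp (measurable_rV_coord j) measurable_snd).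
- under eq_fun do rewrite cons_rV0.
  exact: measurable_fst.
Qed.

Definition uncons_rV n (x : 'rV[R]_n.+1) : measurableTypeR R * 'rV[R]_n :=
  (x ord0 ord0, \row_i x ord0 (lift ord0 i)).

Lemma uncons_rVK n : cancel (@uncons_rV n) (@cons_rV n).
Proof.
move=> x; apply/rowP => i; have [j ->|->] := unliftP ord0 i.
- by rewrite cons_rVS mxE.
- by rewrite cons_rV0.
Qed.

Lemma cons_rVK n : cancel (@cons_rV n) (@uncons_rV n).
Proof.
move=> [a x]; congr pair; first exact: (cons_rV0 (a, x)).
by apply/rowP => i; rewrite mxE cons_rVS.
Qed.

Lemma measurable_uncons_rV n : measurable_fun setT (@uncons_rV n).
Proof.
apply/measurable_fun_pairP; split.
  exact: (@measurable_rV_coord _ R n.+1 ord0).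
apply/(@measurable_fun_rVP _ _ _ R) => i /=.
under eq_fun do rewrite mxE.
exact: (@measurable_rV_coord _ R n.+1 (lift ord0 i)).
Qed.


Section borel_lebesgue_step.
Variables (n : nat) (m : {sigma_finite_measure set 'rV[R]_n -> \bar R}).

Definition borel_lebesgue_step : set 'rV[R]_n.+1 -> \bar R :=
  pushforward (@lebesgue_measure R \x m)%E (@cons_rV n).

Let mcons : measurable_fun setT (@cons_rV n) := @measurable_cons_rV n.

Let step0 : borel_lebesgue_step set0 = 0%E.
Proof. by rewrite /borel_lebesgue_step /pushforward preimage_set0 measure0. Qed.

Let step_ge0 A : (0 <= borel_lebesgue_step A)%E.
Proof. exact: measure_ge0. Qed.

Let step_sigma_additive : semi_sigma_additive borel_lebesgue_step.
Proof.
move=> F mF tF mUF; rewrite /borel_lebesgue_step /pushforward preimage_bigcup.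
apply: measure_semi_sigma_additive.
- by move=> k; rewrite -[X in measurable X]setTI; exact: mcons.
- apply/trivIsetP => /= i j _ _ ij; rewrite -preimage_setI.
  by move/trivIsetP : tF => /(_ _ _ _ _ ij) ->//; rewrite preimage_set0.
- by rewrite -preimage_bigcup -[X in measurable X]setTI; exact: mcons.
Qed.

HB.instance Definition _ := isMeasure.Build _ _ _ borel_lebesgue_step
  step0 step_ge0 step_sigma_additive.

Let sigma_finite_step : sigma_finite setT borel_lebesgue_step.
Proof.
have /sigma_finiteP[F [TF ndF Foo]] := sigma_finiteT (@lebesgue_measure R).
have /sigma_finiteP[G [TG ndG Goo]] := sigma_finiteT m.
exists (fun k => @uncons_rV n @^-1` (F k `*` G k)).
  rewrite -preimage_bigcup (_ : \bigcup_i _ = setT) ?preimage_setT//.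
  apply/seteqP; split => // -[x y] _.
  have [k _ Fkx] : (\bigcup_k F k) x by rewrite -TF.
  have [l _ Gly] : (\bigcup_k G k) y by rewrite -TG.
  exists (maxn k l) => //; split.
  - by move: x Fkx; exact/subsetPset/ndF/leq_maxl.
  - by move: y Gly; exact/subsetPset/ndG/leq_maxr.
move=> k; have [mF Fk] := Foo k; have [mG Gk] := Goo k; split.
  rewrite -[X in measurable X]setTI; apply: measurable_uncons_rV => //.
  exact: measurableX.
rewrite /borel_lebesgue_step /pushforward -comp_preimage.
rewrite (_ : _ \o _ = id); last by apply/funext => x; exact: cons_rVK.
by rewrite preimage_id product_measure1E// lte_mul_pinfty// ge0_fin_numE.
Qed.

HB.instance Definition _ := Measure_isSigmaFinite.Build _ _ _
  borel_lebesgue_step sigma_finite_step.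

End borel_lebesgue_step.

(* The n-fold product of the Lebesgue measure of R, on the Borel sets. *)
Fixpoint borel_lebesgue n : {sigma_finite_measure set 'rV[R]_n -> \bar R} :=
  match n with
  | 0 => \d_(0 : 'rV[R]_0)
  | n'.+1 => borel_lebesgue_step (borel_lebesgue n')
  end.

Lemma borel_lebesgue_box n (A : 'I_n -> set R) :
  (forall i, measurable (A i)) ->
  borel_lebesgue n [set x | forall i, A i (x ord0 i)] =
  (\prod_(i < n) lebesgue_measure (A i))%E.
Proof.
elim: n A => [|n IH] A mA.
  by rewrite big_ord0 /= diracE mem_set// => -[].
rewrite big_ord_recl -IH => [|i]; last exact: mA.
have mB : measurable [set x : 'rV[R]_n | forall i, A (lift ord0 i) (x ord0 i)].
  rewrite (_ : mkset _ = \bigcap_(i in [set: 'I_n])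
      ((fun x : 'rV[R]_n => x ord0 i) @^-1` A (lift ord0 i))).
    apply: fin_bigcap_measurable => // i _; rewrite -[X in measurable X]setTI.
    exact: (@measurable_rV_coord _ R n i).
  by apply/seteqP; split => [x Ax i _|x Ax i]; [exact: Ax|exact: (Ax i)].
rewrite /= -product_measure1E//; last exact: mA.
rewrite /borel_lebesgue_step /pushforward.
congr (_ _); apply/seteqP; split => [[a x] /= Ax|[a x] /= [Aa Ax] i].
  split=> [|i]; first by have := Ax ord0; rewrite cons_rV0.
  by have := Ax (lift ord0 i); rewrite cons_rVS.
have [j ->|->] := unliftP ord0 i; last by rewrite cons_rV0.
by rewrite cons_rVS.
Qed.

End lebesgue_rV.

Section completed_lebesgue_rV.
Context {R : realType}.
Variable n : nat.

(* R^n with the sigma-algebra of Lebesgue-measurable sets: [lebesgue_rV] is a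
   complete measure, so "measurable" below is not restricted to Borel maps. *)
Definition lebesgueType := caratheodory_type ((@borel_lebesgue R n)^*)%mu.

HB.instance Definition _ := Measurable.on lebesgueType.

Definition lebesgue_rV : set lebesgueType -> \bar R :=
  @completed_measure_extension _ _ _ (@borel_lebesgue R n).

HB.instance Definition _ := Measure.on lebesgue_rV.

Let sigma_finite_lebesgue_rV : sigma_finite setT lebesgue_rV.
Proof. exact/completed_measure_extension_sigma_finite/sigma_finiteT. Qed.

HB.instance Definition _ := Measure_isSigmaFinite.Build _ _ _
  lebesgue_rV sigma_finite_lebesgue_rV.

Lemma lebesgue_rV_box (A : 'I_n -> set R) : (forall i, measurable (A i)) ->
  lebesgue_rV [set x : 'rV[R]_n | forall i, A i (x ord0 i)] =
  (\prod_(i < n) lebesgue_measure (A i))%E.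
Proof.
move=> mA; rewrite -borel_lebesgue_box//.
rewrite /lebesgue_rV /completed_measure_extension measurable_mu_extE//.
rewrite (_ : mkset _ = \bigcap_(i in [set: 'I_n])
    ((fun x : 'rV[R]_n => x ord0 i) @^-1` A i)).
  apply: fin_bigcap_measurable => // i _; rewrite -[X in measurable X]setTI.
  exact: (@measurable_rV_coord _ R n i).
by apply/seteqP; split => [x Ax i _|x Ax i]; [exact: Ax|exact: (Ax i)].
Qed.

End completed_lebesgue_rV.
Arguments lebesgueType : clear implicits.
Arguments lebesgue_rV {R n}.

Section domains.
Context {R : realType} {d : nat}.
Implicit Types (x y : 'rV[R]_d) (Omega : set 'rV[R]_d).

(* The library norm on ['rV[R]_d] is the sup norm. *)
Definition enorm x : R := Num.sqrt (\sum_(i < d) x ord0 i ^+ 2).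

Definition is_domain Omega :=
  [/\ Omega !=set0, open Omega & connected Omega].

(* Near each boundary point and after an orthogonal change of axes [Q], Omega
   is the part of a ball lying strictly on one side of the graph of a Lipschitz
   function of the coordinates other than the [i]-th. *)
Definition lipschitz_boundary Omega :=
  forall x0, (closure Omega `\` Omega°) x0 ->
  exists (rho : R) (Q : 'M[R]_d) (i : 'I_d) (g : 'rV[R]_d.-1 -> R),
    [/\ 0 < rho, Q *m Q^T = 1%:M, [lipschitz g z | z in setT] &
      forall x, enorm (x - x0) < rho ->
        (Omega x <-> g (col' i (x *m Q)) < (x *m Q) ord0 i)].

(* Iterated partial derivative, one for each list of directions. *)
Definition partials (l : seq 'I_d) (f : 'rV[R]_d -> R) : 'rV[R]_d -> R :=
  foldr (fun i g => 'D_(delta_mx ord0 i) g) f l.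

Definition smooth (f : 'rV[R]_d -> R) :=
  forall (l : seq 'I_d) x, differentiable (partials l f) x.

Definition test_function Omega (f : 'rV[R]_d -> R) :=
  let supp := closure [set x | f x != 0] in
  [/\ smooth f, compact supp & supp `<=` Omega].

End domains.

(* Elements of the spaces below are functions on the whole of R^d, standing for
   their a.e. equivalence classes. *)

Section spaces.
Context {R : realType} {d : nat}.
Notation Rd := 'rV[R]_d.
Notation leb := (@lebesgue_rV R d).
Implicit Types (Omega : set Rd) (f u v q : Rd -> R) (s : R).

(* Extension by 0: only the values of [f] on Omega matter. *)
Definition restr Omega f : lebesgueType R d -> R := f \_ Omega.

Definition Lp Omega (p : \bar R) f := restr Omega f \in Lfun leb p.

Definition Lp_norm Omega (p : \bar R) f : \bar R :=
  'N[leb]_p[EFin \o restr Omega f]%E.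

Definition kernel_dist s (x y : Rd) : R := enorm (x - y) `^ (d%:R + 2 * s).

Definition gagliardo2 s v : \bar R :=
  (\int[leb]_y \int[leb]_x ((v x - v y) ^+ 2 / kernel_dist s x y)%:E)%E.

Definition Hs s v := Lp setT 2%:E v /\ (gagliardo2 s v < +oo)%E.

Definition Hs_norm s v : \bar R :=
  ((Lp_norm setT 2%:E v `^ 2 + gagliardo2 s v) `^ 2^-1)%E.

Definition Hs_tilde s Omega v := Hs s v /\
  forall e : R, 0 < e -> exists phi,
    test_function Omega phi /\ (Hs_norm s (v \- phi)%R < e%:E)%E.

Definition Gamma_function (z : R) : R :=
  \int[lebesgue_measure]_(t in `]0, +oo[) (t `^ (z - 1) * expR (- t)).

Definition frac_const s : R :=
  2 `^ (2 * s) * s * Gamma_function (s + d%:R / 2) /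
  (pi `^ (d%:R / 2) * Gamma_function (1 - s)).

Definition frac_form s u v : R :=
  frac_const s / 2 *
  \int[leb]_y \int[leb]_x ((u x - u y) * (v x - v y) / kernel_dist s x y).

Definition Caratheodory Omega (a : Rd -> R -> R) :=
  (forall t, measurable_fun (Omega : set (lebesgueType R d)) (a ^~ t)) /\
  {ae leb, forall x, Omega x -> continuous (a x)}.

(* The integrability clause says that the integral of a(x,u) v makes sense;
   it is not automatic, as a(x,u) is not assumed to have limited growth. *)
Definition state_equation s Omega (a : Rd -> R -> R) u q :=
  forall v, Hs_tilde s Omega v ->
    leb.-integrable Omega (fun x => (a x (u x) * v x)%:E) /\
    frac_form s u v + \int[leb]_(x in Omega) (a x (u x) * v x) =
      \int[leb]_(x in Omega) (q x * v x).

Definition cost Omega (L : Rd -> R -> R) (lambda mu : R) u q : \bar R :=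
  (\int[leb]_(x in Omega) (L x (u x))%:E +
   (lambda / 2)%:E * Lp_norm Omega 2%:E q `^ 2 + mu%:E * Lp_norm Omega 1%:E q)%E.

Definition Qad Omega (alpha beta : R) q :=
  Lp Omega 2%:E q /\ {ae leb, forall x, Omega x -> alpha <= q x <= beta}.

Definition feasible s Omega a alpha beta u q :=
  [/\ Hs_tilde s Omega u, Qad Omega alpha beta q &
      state_equation s Omega a u q].

End spaces.

(* Main.v *)
Require Import Defs.
From mathcomp Require Import all_boot all_order all_algebra.
From mathcomp Require Import all_classical all_reals all_analysis.
From mathcomp Require Import measurable_realfun.
From mathcomp Require Import ring lra.
Set Implicit Arguments.
Unset Strict Implicit.
Unset Printing Implicit Defensive.
Import Order.TTheory GRing.Theory Num.Theory.
Import numFieldNormedType.Exports.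
Local Open Scope classical_set_scope.
Local Open Scope ring_scope.

(* A state equation with monotone nonlinearity is the Euler-Lagrange equation of a
   strictly convex functional, once the nonlinearity has been truncated; the
   truncation is removed by Stampacchia's L^oo bound, which rests on the fractional
   Sobolev inequality and on De Giorgi's iteration and is uniform over the admissible
   controls.  For a minimising sequence (u_n, q_n), some subsequence of the controls
   converges weakly to an admissible q whose control cost is at most the limit of the
   control costs.  If u is the state of q, then monotonicity gives
   A(u_n - u, u_n - u) <= int (q_n - q) (u_n - u), and the right-hand side tends to 0
   because the u_n - u are bounded in the energy norm, hence well approximated in L^2
   by functions constant on the cells of a fine mesh of cubes (Rellich), against which
   q_n - q tends to 0.  So u_n -> u strongly and almost everywhere along a
   subsequence, and dominated convergence passes to the limit in int L(x, u_n). *)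

(** One principle supplies all the compactness: near-minimisers of a functional with a modulus of
    convexity form a Cauchy sequence. It yields the minimiser of the energy, the weak limit of the
    controls and the weak closedness of the energy space. The last is needed because Stampacchia's
    method tests with the positive part of [v - k]: its smooth approximations are bounded in the
    energy norm and converge in L^2, but their norm convergence is not at hand.

    The growth of [a] in its second variable is not restricted, so the natural energy may be
    infinite and truncation is forced. Its level can be fixed beforehand: by monotonicity
    [q - a(x,u)] is compared with [q - a(x,0)], which does not see the truncation.

    The Poincare, Sobolev and Rellich estimates all rest on one property of the kernel: on a cube of
    side [h] it is at least a constant times the power [-(d + 2s)] of [h]. Averaging over cubes of a
    suitable size does the rest, so the analysis is carried out on an abstract measure space with a
    weight [w]. *)

Lemma harmonic_small {R : realType} (e : R) : 0 < e ->
  exists N, forall k, (N <= k)%N -> k.+1%:R^-1 <= e.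
Proof.
move=> e0; have [N _ HN] : \forall k \near \oo, k.+1%:R^-1 <= e :> R.
  have := @cvg_harmonic R; move/cvgrPdist_le/(_ _ e0); apply: filterS => k.
  by rewrite sub0r normrN; apply: le_trans; exact: ler_norm.
by exists N => k /HN.
Qed.

(** * Compactness by convexity *)

Section convex_selection.
Context {R : realType}.

(* [D] is a modulus of convexity of [f].  The family [K] is constant when an energy
   is minimised, and consists of the hulls of the tails of a sequence when a weak
   limit is extracted. *)
Lemma minimizing_cauchy (V : Type) (mid : V -> V -> V) (D : V -> V -> R)
    (f : V -> R) (K : nat -> set V) (lb ub : R) :
  (forall n, K n.+1 `<=` K n) ->
  (forall n u v, K n u -> K n v -> K n (mid u v)) ->
  (forall u, K 0%N u -> lb <= f u) ->
  (forall n, exists2 u, K n u & f u <= ub) ->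
  (forall u v, K 0%N u -> K 0%N v -> f (mid u v) + D u v <= (f u + f v) / 2) ->
  exists p : nat -> V,
    [/\ forall n, K n (p n),
        forall n u, K n u -> f (p n) <= f u + n.+1%:R^-1 &
        forall e : R, 0 < e -> exists N, forall m n, (N <= m)%N -> (m <= n)%N ->
          D (p m) (p n) <= e].
Proof.
move=> Kd Km flb fub fmid.
have Kle m n : (m <= n)%N -> K n `<=` K m.
  move=> /subnKC <-; elim: (n - m)%N => [|k ih]; first by rewrite addn0.
  by rewrite addnS => x /Kd /ih.
have K0 n : K n `<=` K 0%N by exact: Kle.
pose I n := inf (f @` K n).
have lbI n : has_inf (f @` K n).
  split; first by have [u Ku _] := fub n; exists (f u), u.
  by exists lb => _ [u Ku <-]; apply: flb; exact: (K0 n).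
have Ile n u : K n u -> I n <= f u.
  by move=> Ku; apply: ge_inf; [exact: (lbI n).2|exists u].
have Iub n : I n <= ub by have [u Ku fu] := fub n; exact: le_trans (Ile _ _ Ku) fu.
have ndI : nondecreasing_seq I.
  move=> m n mn; apply: lb_le_inf; first exact: (lbI n).1.
  by move=> _ [u Ku <-]; apply: Ile; exact: Kle Ku.
have cI : cvgn I.
  by apply: nondecreasing_is_cvgn => //; exists ub => _ [n _ <-]; exact: Iub.
have /choice[p pP] n : exists p, K n p /\ f p <= I n + n.+1%:R^-1.
  have e0 : 0 < n.+1%:R^-1 :> R by rewrite invr_gt0.
  have [_ [u Ku <-] fu] := inf_adherent e0 (lbI n).
  by exists u; split => //; exact: ltW.
exists p; split=> [n|n u Ku|e e0]; first exact: (pP n).1.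
  by apply: le_trans (pP n).2 _; rewrite lerD2r; exact: Ile.
have [N1 _ HN1] : \forall n \near \oo, limn I - I n <= e / 2.
  have /cvgrPdist_le/(_ (e / 2)) := cI.
  have e2 : 0 < e / 2 by rewrite divr_gt0.
  move=> /(_ e2); apply: filterS => n; apply: le_trans; exact: ler_norm.
have [N2 HN2] := @harmonic_small R (e / 2) (divr_gt0 e0 (ltr0Sn R 1)).
exists (maxn N1 N2) => m n Nm mn.
have m1 : (N1 <= m)%N by rewrite (leq_trans _ Nm)// leq_maxl.
have m2 : (N2 <= m)%N by rewrite (leq_trans _ Nm)// leq_maxr.
have [Km' fm] := pP m; have [Kn' fn] := pP n.
have := fmid _ _ (K0 _ _ Km') (K0 _ _ Kn').
(* The midpoint still lies in [K m], so its value is at least [I m]. The infima increase to a finite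
   limit, so [I n - I m] is small, and this leaves little room for [D]. *)
have : I m <= f (mid (p m) (p n)).
  by apply: Ile; apply: Km => //; exact: (Kle _ _ mn).
have := HN1 _ m1; have := HN2 _ m2.
have : I n <= limn I by exact: nondecreasing_cvgn_le.
have := HN2 _ (leq_trans m2 mn : (N2 <= n)%N).
have : I m <= I n by exact: ndI.
move: fm fn; rewrite /=.
move: (f (p m)) (f (p n)) (f (mid _ _)) (D _ _) (I m) (I n) (limn I) => ? ? ? ? ? ? ?.
by move: (_.+1%:R^-1) (_.+1%:R^-1) => ? ?; lra.
Qed.

(** Iterated midpoints serve as a convex hull without coefficients: a property stable under
    midpoints passes to the hull by induction, and the modulus of convexity only ever involves
    midpoints. *)
Inductive midhull (V : Type) (mid : V -> V -> V) (S : set V) : set V :=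
| midhull_in u : S u -> midhull mid S u
| midhull_mid u v : midhull mid S u -> midhull mid S v -> midhull mid S (mid u v).

Lemma midhullS (V : Type) (mid : V -> V -> V) (S T : set V) :
  S `<=` T -> midhull mid S `<=` midhull mid T.
Proof.
move=> ST u; elim=> {u} [u /ST|u v _ ih _ ih']; first exact: midhull_in.
exact: midhull_mid.
Qed.

Lemma midhull_ind_prop (V : Type) (mid : V -> V -> V) (S P : set V) :
  S `<=` P -> (forall u v, P u -> P v -> P (mid u v)) -> midhull mid S `<=` P.
Proof. by move=> SP Pm u; elim=> {u} [u /SP//|u v _ ih _ ih']; exact: Pm. Qed.

(** An ultrafilter finer than the eventual one converges along every bounded coordinate at once,
    which replaces a diagonal extraction. Finitely many closeness conditions cut out a set of the
    filter, and such a set is not empty. *)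
Lemma cluster_values (x : nat -> nat -> R) :
  (forall i, exists B : R, forall n, `|x n i| <= B) ->
  exists c : nat -> R, forall (k : nat) (e : R), 0 < e ->
    exists2 n, (k <= n)%N & forall i, (i < k)%N -> `|x n i - c i| < e.
Proof.
move=> xB.
have [G [GU GF]] := ultraFilterLemma (@eventually_filter).
have GP : ProperFilter G by exact: ultra_proper.
have cl i : exists c : R, x ^~ i @ G --> c.
  have [B xBi] := xB i.
  pose H := fmap (x ^~ i) G.
  have cK : compact (`[- B, B]%classic : set R) by exact: segment_compact.
  have HK : H (`[- B, B]%classic : set R).
    rewrite /H /fmap/= (_ : _ @^-1` _ = setT); first exact: filterT.
    by apply/seteqP; split => // n _ /=; rewrite in_itv/= -ler_norml.
  have [c [_ cc]] := cK H _ HK.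
  exists c => /= A nA.
  have [//|nAc] := @in_ultra_setVsetC _ G (x ^~ i @^-1` A) GU.
  have := cc (~` A) A nAc nA.
  by case=> z [].
have [c cP] := choice cl.
exists c => k e e0.
have H : G [set n | (k <= n)%N /\ forall i, (i < k)%N -> `|x n i - c i| < e].
  apply: filterI; first by apply: GF; exists k.
  elim: k => [|k ih]; first by apply: filterS (@filterT _ G _) => n _ i.
  have := cP k => /cvgrPdist_lt/(_ _ e0) Hk.
  apply: filterS (filterI ih Hk) => n [Hn /= Hnk] i.
  by rewrite ltnS leq_eqVlt => /orP[/eqP->|/Hn//]; rewrite distrC.
by have [n [? ?]] := filter_ex H; exists n.
Qed.

End convex_selection.

(** * De Giorgi's iteration lemma *)

Section de_giorgi.
Context {R : realType}.

(** Along the levels [M * (1 - 2^-n)] the gaps halve, and the superlinear power [b] beats this loss: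
    [phi] decays geometrically and vanishes at the limit level [M]. That [M] is chosen before [phi]
    is the source of all later uniformity. *)
Lemma de_giorgi (C a b P : R) : 0 < C -> 0 < a -> 1 < b -> 0 < P ->
  exists2 M : R, 0 < M & forall phi : R -> R,
    (forall k, 0 <= phi k) ->
    (forall k h, k <= h -> phi h <= phi k) ->
    (forall k h, 0 <= k -> k < h -> (h - k) `^ a * phi h <= C * phi k `^ b) ->
    phi 0 <= P -> phi M = 0.
Proof.
move=> C0 a0 b1 P0.
have b0 : 0 < b by lra.
(* The decay ratio solves [mu ^ (b - 1) = 2 ^ (- a)]: the gain of the power [b] over one step equals
   the loss from halving the gap. *)
pose mu : R := 2 `^ (- (a / (b - 1))).
have mu0 : 0 < mu by rewrite powR_gt0.
have mu1 : mu < 1.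
  rewrite /mu powRN invf_lt1 ?powR_gt0//.
  have {1}<- : 1 `^ (a / (b - 1)) = 1 :> R by rewrite powR1.
  by rewrite gt0_ltr_powR ?nnegrE// ?ltr1n// divr_gt0// subr_gt0.
(* This is [M ^ a], tuned so that the constants in the induction step of [claim] cancel exactly. *)
pose M0 := C * P `^ (b - 1) * 2 `^ a / mu.
have M00 : 0 < M0 by rewrite divr_gt0// !mulr_gt0// powR_gt0.
pose M := M0 `^ a^-1.
have Mp : 0 < M by rewrite powR_gt0.
exists M => // phi phi0 nphi hphi P1.
have Ma : M `^ a = M0 by rewrite -powRrM mulVf ?gt_eqF// powRr1// ltW.
pose k n : R := M * (1 - 2^-1 ^+ n).
have mub : mu `^ b = mu * (2 `^ a)^-1.
  have -> : mu `^ b = mu * mu `^ (b - 1).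
    by rewrite mulr_powRB1// ltW.
  congr (_ * _); rewrite /mu -powRrM mulNr divfK ?powRN// gt_eqF// subr_gt0//.
have claim n : phi (k n) <= P * mu ^+ n.
  elim: n => [|n ih]; first by rewrite /k !expr0 subrr mulr0 mulr1.
  have kn0 : 0 <= k n.
    by rewrite /k mulr_ge0 ?(ltW Mp)// subr_ge0 exprn_ile1// invf_le1// ler1n.
  have dk : k n.+1 - k n = M * 2^-1 ^+ n.+1 by rewrite /k exprS; field.
  have dk0 : 0 < k n.+1 - k n by rewrite dk mulr_gt0// exprn_gt0.
  have := hphi (k n) (k n.+1) kn0; rewrite -subr_gt0 => /(_ dk0).
  rewrite dk powRM ?(ltW Mp)// ?exprn_ge0// Ma => h.
  have X0 : 0 < (2^-1 ^+ n.+1 : R) `^ a by rewrite powR_gt0// exprn_gt0.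
  rewrite -(ler_pM2l (mulr_gt0 M00 X0)); apply: (le_trans h).
  apply: (@le_trans _ _ (C * (P * mu ^+ n) `^ b)).
    rewrite ler_wpM2l ?(ltW C0)//; apply: ge0_ler_powR => //;
      rewrite ?nnegrE ?(ltW b0)//.
    by rewrite mulr_ge0// ?ltW// exprn_gt0.
  rewrite powRM ?exprn_ge0 ?(ltW P0) ?(ltW mu0)//.
  have XX m (x : R) (c : R) : 0 <= x -> (x ^+ m) `^ c = (x `^ c) ^+ m.
    move=> x0; elim: m => [|m ihm]; first by rewrite !expr0 powR1.
    by rewrite !exprS powRM ?exprn_ge0// ihm.
  rewrite !XX ?(ltW mu0)// mub -{1}(mulr_powRB1 (ltW P0) b0).
  have -> : (2^-1 : R) `^ a = (2 `^ a)^-1.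
    by rewrite -(@powR_inv1 _ 2)// -powRrM mulN1r powRN.
  rewrite /M0 !exprMn !exprS.
  have A0 : 2 `^ a != 0 :> R by rewrite gt_eqF// powR_gt0.
  have m0 : mu != 0 by rewrite gt_eqF.
  move: (2 `^ a) (P `^ (b - 1)) A0 => A B A0.
  rewrite !exprVn le_eqVlt; apply/orP; left; apply/eqP; field.
  by rewrite m0 A0 expf_neq0.
apply/eqP; rewrite eq_le phi0 andbT.
apply/ler_addgt0Pr => e e0; rewrite add0r.
have : P * mu ^+ n @[n --> \oo] --> P * 0.
  by apply: cvgM; [exact: cvg_cst|apply: cvg_expr; rewrite ger0_norm// ltW].
rewrite mulr0 => /cvgrPdist_le/(_ _ e0)[N _ /(_ N (leqnn N))].
rewrite sub0r normrN => /(le_trans (ler_norm _)); apply: le_trans.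
apply: le_trans (claim N); apply: nphi.
by rewrite /k ler_piMr ?(ltW Mp)// lerBlDr lerDl exprn_ge0.
Qed.

End de_giorgi.

(** * Squared L^2 norms and almost everywhere convergence *)

Section sq2.
Context d (T : measurableType d) (R : realType).
Variable mu : {measure set T -> \bar R}.
Implicit Types f g : T -> R.

Definition sq2 f : \bar R := (\int[mu]_x (f x ^+ 2)%:E)%E.

Lemma sq2_ge0 f : (0 <= sq2 f)%E.
Proof. by apply: integral_ge0 => x _; rewrite lee_fin sqr_ge0. Qed.

Let msq f : measurable_fun setT f -> measurable_fun setT ((fun x => (f x ^+ 2)%:E) : T
  -> \bar R).
Proof. by move=> mf; apply/measurable_EFinP; exact: measurable_funX. Qed.

Lemma le_sq2 f g : measurable_fun setT f -> measurable_fun setT g ->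
  (forall x, `|f x| <= `|g x|) -> (sq2 f <= sq2 g)%E.
Proof.
move=> mf mg fg; apply: ge0_le_integral => //.
- by move=> x _; rewrite lee_fin sqr_ge0.
- exact: msq.
- exact: msq.
- by move=> x _; rewrite lee_fin -(real_normK (num_real (f x))) -[leRHS]real_normK
  ?num_real// lerXn2r// nnegrE.
Qed.

Lemma sq2_parallelogram f g : measurable_fun setT f -> measurable_fun setT g ->
  (sq2 (f \+ g)%R + sq2 (f \- g)%R = 2%:E * sq2 f + 2%:E * sq2 g)%E.
Proof.
move=> mf mg.
have mfg : measurable_fun setT (f \+ g) by exact: measurable_funD.
have mfg' : measurable_fun setT (f \- g) by exact: measurable_funB.
rewrite /sq2 -!ge0_integralZl_EFin//; try exact: msq; try by move=> x _;
  rewrite lee_fin sqr_ge0.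
rewrite -!ge0_integralD//; last first.
- exact: msq.
- by move=> x _; rewrite lee_fin sqr_ge0.
- exact: msq.
- by move=> x _; rewrite lee_fin sqr_ge0.
- by apply: measurable_funeM; exact: msq.
- by move=> x _; rewrite -EFinM lee_fin mulr_ge0// sqr_ge0.
- by apply: measurable_funeM; exact: msq.
- by move=> x _; rewrite -EFinM lee_fin mulr_ge0// sqr_ge0.
by apply: eq_integral => x _; rewrite -!EFinM -!EFinD/=; congr EFin; ring.
Qed.

Lemma sq2Z (k : R) f : measurable_fun setT f ->
  sq2 (fun x => k * f x) = ((k ^+ 2)%:E * sq2 f)%E.
Proof.
move=> mf; rewrite /sq2 -ge0_integralZl_EFin//.
- by apply: eq_integral => x _; rewrite exprMn EFinM.
- by move=> x _; rewrite lee_fin sqr_ge0.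
- exact: msq.
- exact: sqr_ge0.
Qed.

Lemma sq2D_le f g : measurable_fun setT f -> measurable_fun setT g ->
  (sq2 (f \+ g)%R <= 2%:E * sq2 f + 2%:E * sq2 g)%E.
Proof.
by move=> mf mg; rewrite -sq2_parallelogram// leeDl// sq2_ge0.
Qed.

Lemma sq2B_le f g : measurable_fun setT f -> measurable_fun setT g ->
  (sq2 (f \- g)%R <= 2%:E * sq2 f + 2%:E * sq2 g)%E.
Proof.
by move=> mf mg; rewrite -sq2_parallelogram// leeDr// sq2_ge0.
Qed.

Lemma sq2D_lty f g : measurable_fun setT f -> measurable_fun setT g ->
  (sq2 f < +oo -> sq2 g < +oo -> sq2 (f \+ g)%R < +oo)%E.
Proof.
move=> mf mg f2 g2; apply: le_lt_trans (sq2D_le mf mg) _.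
by rewrite lte_add_pinfty// lte_mul_pinfty// ?sq2_ge0// ge0_fin_numE// sq2_ge0.
Qed.

Lemma sq2B_lty f g : measurable_fun setT f -> measurable_fun setT g ->
  (sq2 f < +oo -> sq2 g < +oo -> sq2 (f \- g)%R < +oo)%E.
Proof.
move=> mf mg f2 g2; apply: le_lt_trans (sq2B_le mf mg) _.
by rewrite lte_add_pinfty// lte_mul_pinfty// ?sq2_ge0// ge0_fin_numE// sq2_ge0.
Qed.

Lemma sq2_mul_integrable f g : measurable_fun setT f -> measurable_fun setT g ->
  (sq2 f < +oo -> sq2 g < +oo -> mu.-integrable setT (fun x => (f x * g x)%:E))%E.
Proof.
move=> mf mg f2 g2.
have h : mu.-integrable setT (fun x => (f x ^+ 2 + g x ^+ 2)%:E).
  under eq_fun do rewrite EFinD.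
  have i2 k : measurable_fun setT k -> (sq2 k < +oo)%E ->
      mu.-integrable setT (fun x => (k x ^+ 2)%:E).
    move=> mk k2; apply/integrableP; split; first exact: msq.
    by under eq_integral do rewrite gee0_abs ?lee_fin ?sqr_ge0//.
  by apply: integrableD => //; exact: i2.
apply: le_integrable h => //.
  by apply/measurable_EFinP; exact: measurable_funM.
move=> x _; rewrite !abse_EFin lee_fin [leRHS]ger0_norm ?addr_ge0 ?sqr_ge0//.
rewrite ler_norml; have := sqr_ge0 (f x + g x); have := sqr_ge0 (f x - g x).
have := sqr_ge0 (f x); have := sqr_ge0 (g x).
by move: (f x) (g x) => a b; nra.
Qed.

Lemma sq2_fatou (f : nat -> T -> R) g (B : \bar R) :
  (forall n, measurable_fun setT (f n)) ->
  (forall x, f ^~ x @ \oo --> g x) ->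
  (\forall n \near \oo, (sq2 (f n) <= B)%E) -> (sq2 g <= B)%E.
Proof.
move=> mf fg [N _ fB].
pose F n (x : T) : \bar R := ((f (n + N)%N x) ^+ 2)%:E.
have <- : (\int[mu]_x limn_einf (F ^~ x) = sq2 g)%E.
  apply: eq_integral => x _.
  have : F ^~ x @ \oo --> (g x ^+ 2)%:E.
    apply: cvg_EFin; first exact: nearW.
    rewrite /F /comp/=; rewrite expr2; under eq_fun do rewrite expr2.
    by apply: cvgM; rewrite (cvg_shiftn N (fun n => f n x)).
  by move=> h; rewrite is_cvg_limn_einfE; [exact/cvg_lim|apply/cvg_ex; eexists;
    exact: h].
apply: le_trans (fatou _ _ _ _) _ => //.
- by move=> n; exact: msq.
- by move=> n x _; rewrite lee_fin sqr_ge0.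
rewrite limn_einf_lim; apply: lime_le; first exact: is_cvg_einfs.
apply: nearW => n; apply: le_trans (_ : (\int[mu]_x F n x <= B)%E).
  by apply: ereal_inf_lbound; exists n => //=.
by apply: fB => /=; rewrite leq_addl.
Qed.

(** The series of the [4 ^ n * g n] has integral at most the sum of the [2 ^ -n], so it is finite
    almost everywhere, and its sum bounds each term. The rate 8 leaves 4 pointwise, hence 2 after a
    square root, which is still summable. *)
Lemma fast_ae (g : nat -> T -> R) :
  (forall n, measurable_fun setT (g n)) -> (forall n x, 0 <= g n x) ->
  (forall n, \int[mu]_x (g n x)%:E <= (8^-1 ^+ n)%:E)%E ->
  {ae mu, forall x, exists C : R, forall n, g n x <= C * 4^-1 ^+ n}.
Proof.
move=> mg g0 gi.
pose h n (x : T) : \bar R := (4 ^+ n * g n x)%:E.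
have h0 n x : (0 <= h n x)%E by rewrite lee_fin mulr_ge0// exprn_ge0.
have mh n : measurable_fun setT (h n).
  by apply/measurable_EFinP; apply: measurable_funM.
have mS : measurable_fun setT (fun x => \sum_(n <oo) h n x)%E.
  apply: ge0_emeasurable_sum => //.
have hS : (\int[mu]_x (\sum_(n <oo) h n x) < +oo)%E.
  rewrite integral_nneseries//.
  apply: (@le_lt_trans _ _ (\sum_(n <oo) ((2^-1 ^+ n)%:E : \bar R))%E).
    apply: lee_nneseries => [n _ _|n _]; first by apply: integral_ge0 => x _; exact: h0.
    rewrite /h; under eq_integral do rewrite EFinM.
    rewrite ge0_integralZl_EFin//; last exact/measurable_EFinP.
      apply: le_trans (lee_wpmul2l _ (gi n)) _; first by rewrite lee_fin exprn_ge0.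
      by rewrite -EFinM lee_fin -exprMn; rewrite (_ : 4 * 8^-1 = 2^-1)//; field.
    by move=> x _; rewrite lee_fin.
  have -> : (\sum_(n <oo) ((2^-1 ^+ n)%:E : \bar R) = 2%:E)%E.
    have := @cvg_geometric_series R 1 2^-1.
    rewrite (_ : `|2^-1| < 1 = true); last by rewrite ger0_norm// invf_lt1// ltr1n.
    move=> /(_ isT) h2; apply/cvg_lim => //.
    under eq_fun do rewrite sumEFin.
    apply: cvg_EFin; first exact: nearW.
    have e2 : 1 * (1 - 2^-1)^-1 = 2 :> R by field.
    rewrite e2 in h2; apply: cvg_trans h2; apply: near_eq_cvg; apply: nearW => n /=.
    by rewrite /series/=; apply: eq_bigr => i _; rewrite mul1r.
  exact: ltry.
have : mu.-integrable setT (fun x => \sum_(n <oo) h n x)%E.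
  apply/integrableP; split => //.
  by under eq_integral do rewrite gee0_abs ?nneseries_ge0//.
move=> /integrable_ae => /(_ measurableT).
apply: filterS => x /(_ I) fx.
exists (fine (\sum_(n <oo) h n x)%E) => n.
have le1 : (h n x <= \sum_(n <oo) h n x)%E.
  apply: le_trans (nneseries_lim_ge n.+1 _); last by move=> *; exact: h0.
  by rewrite big_nat_recr//= leeDr// sume_ge0.
rewrite -(fineK fx) lee_fin in le1.
have -> : g n x = 4^-1 ^+ n * (4 ^+ n * g n x).
  by rewrite mulrA -exprMn mulVf// expr1n mul1r.
by rewrite mulrC ler_wpM2r// exprn_ge0.
Qed.

Lemma sq2_fast_cvg0 (f : nat -> T -> R) :
  (forall n, measurable_fun setT (f n)) ->
  (forall n, sq2 (f n) <= (8^-1 ^+ n)%:E)%E ->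
  {ae mu, forall x, f ^~ x @ \oo --> 0}.
Proof.
move=> mf fi.
have := @fast_ae (fun n x => f n x ^+ 2).
move=> /(_ (fun n => measurable_funX 2 (mf n)) (fun n x => sqr_ge0 _) fi).
apply: filterS => x [C HC].
have C0 : 0 <= C by have := HC 0%N; rewrite expr0 mulr1; apply: le_trans;
  exact: sqr_ge0.
have HD n : `|f n x| <= Num.sqrt C * 2^-1 ^+ n.
  rewrite -(@ler_pXn2r _ 2)// ?nnegrE ?mulr_ge0 ?sqrtr_ge0 ?exprn_ge0// exprMn
    sqr_sqrtr//.
  rewrite real_normK ?num_real//; apply: le_trans (HC n) _.
  by rewrite exprAC (_ : (2^-1) ^+ 2 = 4^-1 :> R)//; field.
have c0 : Num.sqrt C * 2^-1 ^+ n @[n --> \oo] --> (0 : R).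
  rewrite -[X in _ --> X](mulr0 (Num.sqrt C)); apply: cvgM; first exact: cvg_cst.
  by apply: cvg_expr; rewrite ger0_norm// invf_lt1// ltr1n.
apply/norm_cvg0P; apply: (squeeze_cvgr _ (cvg_cst 0) c0).
by apply: nearW => n; rewrite normr_ge0 HD.
Qed.

Lemma sq2_fast_cauchy (f : nat -> T -> R) :
  (forall n, measurable_fun setT (f n)) ->
  (forall n, sq2 (f n.+1 \- f n)%R <= (8^-1 ^+ n)%:E)%E ->
  {ae mu, forall x, cvgn (f ^~ x)}.
Proof.
move=> mf fi.
have := @fast_ae (fun n x => (f n.+1 x - f n x) ^+ 2).
move=> /(_ (fun n => measurable_funX 2 (measurable_funB (mf n.+1) (mf n)))).
move=> /(_ (fun n x => sqr_ge0 _) fi).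
apply: filterS => x [C HC].
have C0 : 0 <= C by have := HC 0%N; rewrite expr0 mulr1; apply: le_trans;
  exact: sqr_ge0.
pose D n := f n.+1 x - f n x.
have HD n : `|D n| <= Num.sqrt C * 2^-1 ^+ n.
  rewrite -(@ler_pXn2r _ 2)// ?nnegrE ?mulr_ge0 ?sqrtr_ge0 ?exprn_ge0// exprMn
    sqr_sqrtr//.
  rewrite real_normK ?num_real//; apply: le_trans (HC n) _.
  by rewrite exprAC (_ : (2^-1) ^+ 2 = 4^-1 :> R)//; field.
have cD : cvgn (series D).
  apply: normed_cvg; apply: (@series_le_cvg _ _ (geometric (Num.sqrt C) 2^-1)) => //.
  - by move=> n /=; exact: normr_ge0.
  - by move=> n /=; rewrite mulr_ge0 ?sqrtr_ge0// exprn_ge0.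
  - by apply: is_cvg_geometric_series; rewrite ger0_norm// invf_lt1// ltr1n.
have -> : f ^~ x = (fun n => f 0%N x + series D n).
  apply/funext => n; rewrite /series/= /D telescope_sumr//; lra.
exact: is_cvgD (is_cvg_cst _) cD.
Qed.

Lemma sq2_cauchy_subseq (f : nat -> T -> R) :
  (forall n, measurable_fun setT (f n)) ->
  (forall e, 0 < e -> exists N, forall m n, (N <= m)%N -> (m <= n)%N ->
    (sq2 (f n \- f m)%R <= e%:E)%E) ->
  exists s : nat -> nat, [/\ forall k, (k <= s k)%N, {homo s : m n / (m <= n)%N} &
    {ae mu, forall x, cvgn (fun k => f (s k) x)}].
Proof.
move=> mf cf.
have /choice[N NP] k : exists N, forall m n, (N <= m)%N -> (m <= n)%N ->
    (sq2 (f n \- f m)%R <= (8^-1 ^+ k)%:E)%E.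
  by apply: cf; rewrite exprn_gt0.
(* Summing the thresholds makes [s] monotone and at the same time at least [N k] and at least
   [k]. *)
pose s k := (\sum_(i < k.+1) N i + k)%N.
have sS k : (s k <= s k.+1)%N.
  by rewrite /s [X in (_ <= X + _)%N]big_ord_recr/= -addnA leq_add2l addnS ltnW// ltnS
    leq_addl.
have sm : {homo s : m n / (m <= n)%N}.
  move=> m n /subnKC <-; elim: (n - m)%N => [|k ih]; first by rewrite addn0.
  by rewrite addnS; exact: leq_trans ih (sS _).
have Ns k : (N k <= s k)%N by rewrite /s big_ord_recr/= -addnA addnC -addnA leq_addr.
exists s; split => //; first by move=> k; rewrite leq_addl.
apply: (@sq2_fast_cauchy (fun k => f (s k))) => // k.
exact: NP.
Qed.

Lemma sq2_eq0 f : measurable_fun setT f -> sq2 f = 0%E -> {ae mu, forall x, f x = 0}.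
Proof.
move=> mf f0.
have : (\int[mu]_x `|(f x ^+ 2)%:E| = 0)%E.
  by rewrite -f0; apply: eq_integral => x _; rewrite gee0_abs// lee_fin sqr_ge0.
move=> /ae_eq_integral_abs => /(_ measurableT (msq mf)).
apply: filterS => x /(_ I) [/eqP]; rewrite sqrf_eq0 => /eqP //.
Qed.

Lemma ae_sq2 f g : measurable_fun setT f -> measurable_fun setT g ->
  {ae mu, forall x, f x = g x} -> sq2 f = sq2 g.
Proof.
move=> mf mg fg; apply: ge0_ae_eq_integral => //.
- exact: msq.
- exact: msq.
- by move=> x _; rewrite lee_fin sqr_ge0.
- by move=> x _; rewrite lee_fin sqr_ge0.
- by apply: filterS fg => x -> _.
Qed.

End sq2.

(** * Lebesgue measure on R^d and the normalising constant *)

Section lebesgue_facts.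
Context {R : realType} {d : nat}.
Notation leb := (@lebesgue_rV R d).
Notation lT := (lebesgueType R d).

Lemma rV_lebesgue_measurable (A : set 'rV[R]_d) :
  measurable A -> measurable (A : set lT).
Proof. by move=> mA; apply: (@sub_caratheodory _ _ R (borel_lebesgue d));
  exact: sub_sigma_algebra. Qed.

Lemma rV_lebesgue_measurable_fun d' (U : measurableType d') (f : 'rV[R]_d -> U) :
  measurable_fun setT f -> measurable_fun [set: lT] (f : lT -> U).
Proof.
move=> mf _ B mB; rewrite setTI; apply: rV_lebesgue_measurable.
by rewrite -[X in measurable X]setTI; exact: mf.
Qed.

Lemma measurable_coord (i : 'I_d) :
  measurable_fun [set: lT] (fun x : lT => (x : 'rV[R]_d) ord0 i).
Proof. exact: rV_lebesgue_measurable_fun (measurable_rV_coord i). Qed.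

Lemma measurable_box (A : 'I_d -> set R) : (forall i, measurable (A i)) ->
  measurable [set x : 'rV[R]_d | forall i, A i (x ord0 i)].
Proof.
move=> mA.
rewrite (_ : mkset _ = \bigcap_(i in [set: 'I_d])
    ((fun x : 'rV[R]_d => x ord0 i) @^-1` A i)).
  apply: fin_bigcap_measurable => // i _; rewrite -[X in measurable X]setTI.
  exact: (@measurable_rV_coord _ R d i).
by apply/seteqP; split => [x Ax i _|x Ax i]; [exact: Ax|exact: (Ax i)].
Qed.

(** The sigma-algebra is generated by the coordinates, not by the topology, so an open set has to be
    written as a countable union of boxes with rational centres and radii [1/(k+1)]. *)
Lemma open_measurable_rV (U : set 'rV[R]_d) : open U -> measurable U.
Proof.
move=> oU.
pose B (p : 'rV[rat]_d * nat) : set 'rV[R]_d :=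
  [set x | forall i, ball (ratr (p.1 ord0 i) : R) p.2.+1%:R^-1 (x ord0 i)].
pose P : set ('rV[rat]_d * nat) := [set p | B p `<=` U].
have -> : U = \bigcup_(p in P) B p.
  apply/seteqP; split => [x Ux|x [p Pp]]; last exact: Pp.
  have /nbhs_ballP[e /= e0 eU] : nbhs x U by exact: open_nbhs_nbhs.
  have [k _ Hk] : \forall n \near \oo, n.+1%:R^-1 <= e / 2 :> R.
    have e2 : 0 < e / 2 by rewrite divr_gt0.
    have := @cvg_harmonic R; move/cvgrPdist_le/(_ _ e2); apply: filterS => n.
    by rewrite sub0r normrN; apply: le_trans; exact: ler_norm.
  have k0 : 0 < k.+1%:R^-1 :> R by rewrite invr_gt0.
  have Hke := Hk k (leqnn k).
  have /choice[q Hq] (i : 'I_d) : exists q : rat, ball (x ord0 i) k.+1%:R^-1 (ratr q :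
    R).
    have : x ord0 i - k.+1%:R^-1 < x ord0 i + k.+1%:R^-1.
      by rewrite ltrBlDr -addrA ltrDl addr_gt0.
    move=> /rat_in_itvoo[q]; rewrite in_itv/= => /andP[q1 q2]; exists q.
    rewrite /ball/= ltr_norml; by move: (k.+1%:R^-1) q1 q2 => t q1 q2; apply/andP;
      split; lra.
  exists (\row_i q i, k); last by move=> i /=; rewrite mxE; apply: ball_sym; exact: Hq.
  move=> y By; apply: eU; rewrite /ball/=; split => //= i j.
  rewrite (ord1 i).
  have := By j; have := Hq j; rewrite /= mxE /ball/=.
  move=> h1 h2; rewrite (_ : x ord0 j - y ord0 j = (x ord0 j - ratr (q j)) + (ratr (q
    j) - y ord0 j)); last by ring.
  apply: le_lt_trans (ler_normD _ _) _.
  by rewrite /= in Hke; move: (k.+1%:R^-1) Hke h1 h2 => t Hke h1 h2; lra.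
rewrite (_ : \bigcup_(p in P) B p = \bigcup_n
    (if unpickle n is Some p then (if p \in P then B p else set0) else set0)).
  apply: bigcupT_measurable => n; case: unpickle => [p|]; last exact: measurable0.
  case: ifPn => _; last exact: measurable0.
  apply: (@measurable_box (fun i => ball (ratr (p.1 ord0 i) : R) p.2.+1%:R^-1)) => i.
  exact: measurable_ball.
apply/seteqP; split => [x [p Pp Bp]|x [n _]].
  by exists (pickle p) => //; rewrite pickleK; rewrite (mem_set Pp).
by case: unpickle => [p|//]; case: ifPn => // /set_mem Pp Bp; exists p.
Qed.

Lemma continuous_lebesgue_measurable (f : 'rV[R]_d -> R) :
  continuous f -> measurable_fun [set: lT] (f : lT -> R).
Proof.
move=> /continuousP cf; apply: rV_lebesgue_measurable_fun.
apply: (measurability _ (RGenOInfty.measurableE R)).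
move=> /= _ [_ [a ->]] <-; apply: measurableI => //; apply: open_measurable_rV.
by apply: cf; rewrite set_itvE; exact: open_gt.
Qed.

Lemma lebesgue_rV_complete : measure_is_complete leb.
Proof. exact: measure_is_complete_caratheodory. Qed.

(** Half-open, so that the cells of a mesh are disjoint and leave no gaps; [x] is the lower corner
    and not the centre. *)
Definition cube (x : 'rV[R]_d) (h : R) : set 'rV[R]_d :=
  [set y | forall i, `[x ord0 i, x ord0 i + h[%classic (y ord0 i)].

Lemma measurable_cube x h : measurable (cube x h : set lT).
Proof.
apply: rV_lebesgue_measurable.
by apply: (@measurable_box (fun i => `[x ord0 i, x ord0 i + h[%classic)) => i.
Qed.

Lemma lebesgue_cube x h : 0 <= h -> leb (cube x h) = (h ^+ d)%:E.
Proof.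
move=> h0; rewrite (lebesgue_rV_box (A := fun i => `[x ord0 i, x ord0 i +
  h[%classic))//.
transitivity (\prod_(i < d) (h%:E : \bar R))%E.
  apply: eq_bigr => i _; rewrite lebesgue_measure_itv/= lte_fin.
  rewrite ltrDl; case: ltP => [_|h0']; first by rewrite -EFinD; congr EFin; ring.
  by congr EFin; apply/eqP; rewrite eq_le h0 h0'.
by rewrite prodEFin big_const_ord/= -Monoid.iteropE/=.
Qed.

Lemma enorm_le (x : 'rV[R]_d) h : 0 <= h -> (forall i, `|x ord0 i| <= h) ->
  enorm x <= Num.sqrt d%:R * h.
Proof.
move=> h0 xh; rewrite /enorm -(@ler_pXn2r _ 2)// ?nnegrE ?mulr_ge0 ?sqrtr_ge0//.
rewrite sqr_sqrtr ?sumr_ge0// => [|i _]; last exact: sqr_ge0.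
rewrite exprMn sqr_sqrtr//.
apply: (@le_trans _ _ (\sum_(i < d) h ^+ 2)).
  apply: ler_sum => i _; rewrite -(real_normK (num_real (x ord0 i))).
  by rewrite lerXn2r// nnegrE.
by rewrite sumr_const card_ord mulr_natl.
Qed.

Lemma enorm_ge0 (x : 'rV[R]_d) : 0 <= enorm x.
Proof. exact: sqrtr_ge0. Qed.

Lemma kernel_dist_ge0 s (x y : 'rV[R]_d) : 0 <= kernel_dist s x y.
Proof. exact: powR_ge0. Qed.

Lemma measurable_sqrt d' (U : measurableType d') (f : U -> R) :
  measurable_fun setT f -> measurable_fun setT (fun x => Num.sqrt (f x)).
Proof.
move=> mf; apply: (measurableT_comp (f := @Num.sqrt R)) => //.
by apply: continuous_measurable_fun; exact: sqrt_continuous.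
Qed.

Lemma measurable_kernel_dist s :
  measurable_fun setT (fun p : lT * lT => kernel_dist s p.1 p.2).
Proof.
apply: (measurableT_comp (measurable_powR _)).
apply: measurable_sqrt; apply: measurable_sum => i.
apply: measurable_funX.
rewrite (_ : (fun _ => _) = (fun p : lT * lT => (p.1 : 'rV[R]_d) ord0 i) \- (fun p =>
  (p.2 : 'rV[R]_d) ord0 i)); last first.
  by apply/funext => p /=; rewrite !mxE.
apply: measurable_funB.
- exact: (measurableT_comp (measurable_coord i) measurable_fst).
- exact: (measurableT_comp (measurable_coord i) measurable_snd).
Qed.

End lebesgue_facts.

(** * Positivity of the Gamma function and of the normalising constant *)

Section Gamma.
Context {R : realType}.
Notation mu := (@lebesgue_measure R).

Lemma is_derive_cvg (f : R -> R) (x l : R) : is_derive x 1 f l -> f @ x --> f x.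
Proof.
move=> h; have : {for x, continuous f}; last by [].
apply: differentiable_continuous; apply/derivable1_diffP; exact: ex_derive.
Qed.

Lemma measurable_Gamma_integrand (z : R) :
  measurable_fun setT (fun t : R => t `^ (z - 1) * expR (- t)).
Proof.
apply: measurable_funM; first exact: measurable_powR.
by apply: measurableT_comp => //; exact: oppr_measurable.
Qed.

Lemma integral_powR_lty (z : R) : 0 < z ->
  (\int[mu]_(t in `]0%R, 1%R]) (t `^ (z - 1))%:E < +oo)%E.
Proof.
move=> z0.
(* The power may be singular at 0, hence the exhaustion by compact intervals; [n.+2] keeps the left
   endpoint strictly below 1, as the fundamental theorem of calculus requires. *)
pose F n := `[n.+2%:R^-1, 1 : R]%classic.
have FE : `]0, 1 : R]%classic = \bigcup_n F n.
  apply/seteqP; split => [t /=|t [n _]]; rewrite /F/= !in_itv/= => /andP[t0 t1].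
    have [n _ /(_ n (leqnn n))/= Hn] : \forall n \near \oo, n.+1%:R^-1 <= t :> R.
      have := @cvg_harmonic R; move/cvgrPdist_le/(_ _ t0); apply: filterS => n.
      by rewrite sub0r normrN; apply: le_trans; exact: ler_norm.
    exists n => //=; rewrite /F/= in_itv/= t1 andbT; apply: le_trans Hn.
    by rewrite lef_pV2 ?posrE// ler_nat.
  by rewrite t1 andbT; apply: lt_le_trans t0; rewrite invr_gt0.
have ndF : nondecreasing_seq F.
  move=> m n mn; apply/subsetPset => t; rewrite /F/= !in_itv/= => /andP[t0 t1].
  by rewrite t1 andbT; apply: le_trans t0; rewrite lef_pV2 ?posrE// ler_nat.
have mp : measurable_fun setT (fun t : R => (t `^ (z - 1))%:E).
  by apply/measurable_EFinP; exact: measurable_powR.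
have Fle n : (\int[mu]_(t in F n) (t `^ (z - 1))%:E <= (z^-1)%:E)%E.
  have n1 : n.+2%:R^-1 < 1 :> R by rewrite invf_lt1// ltr1n.
  have n0 : 0 < n.+2%:R^-1 :> R by rewrite invr_gt0.
  have dF (x : R) : 0 < x -> is_derive x 1 (fun t => t `^ z / z) (x `^ (z - 1)).
    move=> x0.
    have h := @is_derive1_powR R z x x0.
    have -> : x `^ (z - 1) = z^-1 *: (z * x `^ (z - 1)).
      by rewrite /GRing.scale/= mulrA mulVf ?mul1r// gt_eqF.
    have -> : (fun t : R => t `^ z / z) = z^-1 *: (fun t => t `^ z).
      by apply/funext => t; rewrite /GRing.scale/= mulrC.
    exact: is_deriveZ.
  rewrite (@continuous_FTC2 R _ (fun t => t `^ z / z))//.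
  - rewrite powR1 div1r -EFinB lee_fin gerBl divr_ge0 ?powR_ge0// ltW//.
  - apply: continuous_in_subspaceT => x; rewrite inE/= in_itv/= => /andP[x1 _].
    have x0 : 0 < x by exact: lt_le_trans n0 x1.
    have h := @is_derive1_powR R (z - 1) x x0.
    exact: is_derive_cvg h.
  - have cont (x : R) : 0 < x -> (fun t : R => t `^ z / z) @ x --> x `^ z / z.
      move=> x0; have h := dF x x0.
      exact: is_derive_cvg h.
    split.
    + move=> x; rewrite in_itv/= => /andP[x1 _].
      have h := dF x (lt_trans n0 x1); exact: ex_derive.
    + by apply: cvg_at_right_filter; exact: cont.
    + by apply: cvg_at_left_filter; exact: cont.
  - move=> x; rewrite in_itv/= => /andP[x1 _].
    by have h := dF x (lt_trans n0 x1); rewrite derive1E derive_val.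
rewrite FE; apply: (@le_lt_trans _ _ (z^-1)%:E); last exact: ltry.
have cv : (\int[mu]_(t in F i) (t `^ (z - 1))%:E)%E @[i --> \oo] -->
    (\int[mu]_(t in \bigcup_n F n) (t `^ (z - 1))%:E)%E.
  apply: ge0_nondecreasing_set_cvg_integral => //.
  - by move=> i; exact: measurable_itv.
  - by move=> i; exact: measurable_funTS.
  - by move=> i t _; rewrite lee_fin powR_ge0.
rewrite -(cvg_lim _ cv)//; apply: lime_le; last exact: nearW.
by apply/cvg_ex; eexists; exact: cv.
Qed.

Lemma integral_Gamma_tail_lty (z : R) :
  (\int[mu]_(t in `]1%R, +oo[) (t `^ (z - 1) * expR (- t))%:E < +oo)%E.
Proof.
pose n := Num.bound `|z - 1|.
have n0 : (0 < n.+1)%N by [].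
(* Raising [1 + y <= expR y] at [y = t / (2 * n.+1)] to the power [n.+1] gives
   [t ^+ n.+1 <= K * expR (t / 2)], so half of the exponential decay absorbs the power. *)
pose K : R := (2 * n.+1%:R) ^+ n.+1.
have bnd (t : R) : 1 < t -> t `^ (z - 1) * expR (- t) <= K * expR (- (t / 2)).
  move=> t1; have t0 : 0 < t by lra.
  have e1 : t `^ (z - 1) <= t ^+ n.+1.
    rewrite -powR_mulrn ?(ltW t0)//; apply: ler_powR; first exact: ltW.
    apply: le_trans (ler_norm _) _; apply/ltW;
      apply: lt_trans (archi_boundP (normr_ge0 _)) _ => //.
    by rewrite ltr_nat /n ltnS.
  have e2 : t ^+ n.+1 <= K * expR (t / 2).
    have -> : expR (t / 2) = expR (t / (2 * n.+1%:R)) ^+ n.+1.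
      rewrite -expRM_natl; congr expR; field.
      by rewrite nat1r pnatr_eq0.
    rewrite -exprMn; apply: lerXn2r; rewrite ?nnegrE ?(ltW t0)// ?mulr_ge0 ?expR_ge0//.
    have := expR_ge1Dx (t / (2 * n.+1%:R)).
    have N0 : 0 < 2 * n.+1%:R :> R by rewrite mulr_gt0.
    move=> /(ler_wpM2l (ltW N0)); apply: le_trans.
    by rewrite mulrDr mulrCA divff ?gt_eqF// !mulr1 lerDr ltW.
  apply: (@le_trans _ _ (K * expR (t / 2) * expR (- t))).
    by rewrite ler_wpM2r ?expR_ge0//; exact: le_trans e1 e2.
  by rewrite -mulrA -expRD; rewrite (_ : t / 2 - t = - (t / 2))//; field.
apply: (@le_lt_trans _ _ (\int[mu]_(t in `[1%R, +oo[) (K * expR (- (t / 2)))%:E)%E).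
  apply: (@le_trans _ _ (\int[mu]_(t in `]1%R, +oo[) (K * expR (- (t / 2)))%:E)%E).
    apply: ge0_le_integral => //.
    - by move=> t _; rewrite lee_fin mulr_ge0 ?powR_ge0// expR_ge0.
    - apply/measurable_EFinP; apply: measurable_funTS;
      exact: measurable_Gamma_integrand.
    - apply/measurable_EFinP; apply: measurable_funTS; apply: measurable_funM => //.
      by apply: measurableT_comp => //; apply: measurableT_comp => //;
        exact: mulrr_measurable.
    - by move=> t; rewrite /= in_itv/= andbT => /bnd; rewrite lee_fin.
  apply: ge0_subset_integral => //.
  - apply/measurable_EFinP; apply: measurable_funTS; apply: measurable_funM => //.
    by apply: measurableT_comp => //; apply: measurableT_comp => //;
      exact: mulrr_measurable.
  - by move=> t _; rewrite lee_fin mulr_ge0 ?exprn_ge0 ?mulr_ge0// expR_ge0.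
  - by move=> t /=; rewrite !in_itv/= !andbT; exact: ltW.
have dF (x : R) : is_derive x 1 (fun t => - (2 * K) * expR (- (t / 2))) (K * expR (- (x
  / 2))).
  by apply: is_derive_eq; rewrite /GRing.scale/=; field.
have hc (x : R) : (fun t : R => K * expR (- (t / 2))) @ x --> K * expR (- (x / 2)).
  have h : is_derive x 1 (fun t : R => K * expR (- (t / 2))) (- (K / 2) * expR (- (x /
    2))).
    by apply: is_derive_eq; rewrite /GRing.scale/=; field.
  exact: is_derive_cvg h.
rewrite (@ge0_continuous_FTC2y R _ (fun t => - (2 * K) * expR (- (t / 2))) 1 0).
- by rewrite -EFinB ltry.
- by move=> x _; rewrite mulr_ge0 ?exprn_ge0 ?mulr_ge0// expR_ge0.
- apply: continuous_subspaceT => x.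
  exact: (hc x).
- rewrite -(mulr0 (- (2 * K))); apply: cvgM; first exact: cvg_cst.
  apply: (@cvg_comp _ _ _ (fun x => x / 2) (fun x => expR (- x)) _ (pinfty_nbhs R));
    last exact: cvgr_expR.
  by apply: gt0_cvgMly => //; exact: cvg_id.
- by move=> x _; exact: ex_derive.
- by apply: cvg_at_right_filter; exact: is_derive_cvg (dF 1).
- by move=> x _; rewrite derive1E derive_val.
Qed.

(** A real-valued integral takes the default value 0 when the extended one is infinite. Positivity
    therefore needs convergence at 0 and at infinity, and only then a lower bound on a bounded
    interval. *)
Lemma Gamma_function_gt0 (z : R) : 0 < z -> 0 < Gamma_function z.
Proof.
move=> z0; rewrite /Gamma_function /Rintegral.
pose g := fun t : R => (t `^ (z - 1) * expR (- t))%:E.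
have mg : measurable_fun setT g.
  by apply/measurable_EFinP; exact: measurable_Gamma_integrand.
have g0 t : (0 <= g t)%E by rewrite lee_fin mulr_ge0 ?powR_ge0// expR_ge0.
have lty : (\int[mu]_(t in `]0%R, +oo[) g t < +oo)%E.
  have -> : `]0 : R, +oo[%classic = `]0, 1] `|` `]1, +oo[.
    by rewrite -itv_bndbnd_setU// bnd_simp.
  rewrite ge0_integral_setU//; last 2 first.
  - exact: measurable_funTS.
  - apply/disj_set2P/seteqP; split => // t []; rewrite /= !in_itv/= => /andP[_ t1].
    by rewrite ltNge t1.
  apply: lte_add_pinfty; last exact: integral_Gamma_tail_lty.
  apply: le_lt_trans (integral_powR_lty z0).
  apply: ge0_le_integral => //.
  - exact: measurable_funTS.
  - by apply/measurable_EFinP; apply: measurable_funTS; exact: measurable_powR.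
  - move=> t; rewrite /= in_itv/= => /andP[t0 _].
    by rewrite lee_fin ler_piMr ?powR_ge0// expR_le1 oppr_le0 ltW.
rewrite -lte_fin fineK ?ge0_fin_numE//; last by apply: integral_ge0 => t _; exact: g0.
(* A lower bound of the integrand on [[1, 2]], where [ln t] lies between 0 and 1 and [expR (- t)] is
   at least [expR (- 2)]. *)
pose c : R := expR (- `|z - 1| - 2).
apply: (@lt_le_trans _ _ (\int[mu]_(t in `[1%R, 2%R]) c%:E)%E).
  rewrite integral_cst//= lebesgue_measure_itv/= lte_fin ltr1n/= -EFinB -EFinM lte_fin.
  by rewrite mulr_gt0 ?expR_gt0// subr_gt0 ltr1n.
apply: (@le_trans _ _ (\int[mu]_(t in `[1%R, 2%R]) g t)%E).
  apply: ge0_le_integral => //.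
  - by move=> t _; rewrite lee_fin expR_ge0.
  - exact: measurable_funTS.
  - move=> t; rewrite /= in_itv/= => /andP[t1 t2]; rewrite lee_fin /powR.
    have t0 : 0 < t by lra.
    rewrite gt_eqF// -expRD ler_expR.
    have l0 : 0 <= ln t by exact: ln_ge0.
    have l1 : ln t <= 1.
      rewrite -ler_expR lnK ?posrE//; have := expR_ge1Dx (1 : R); lra.
    have : - `|z - 1| <= (z - 1) * ln t.
      rewrite lerNl -mulNr; apply: le_trans (ler_norm _) _.
      by rewrite normrM normrN ler_piMr// ger0_norm.
    lra.
apply: ge0_subset_integral => //; first exact: measurable_funTS.
by move=> t /=; rewrite !in_itv/= andbT => /andP[t1 _]; lra.
Qed.

Lemma frac_const_gt0 (d : nat) (s : R) : 0 < s < 1 -> 0 < @frac_const R d s.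
Proof.
move=> /andP[s0 s1]; rewrite /frac_const divr_gt0//.
- rewrite !mulr_gt0// ?powR_gt0//; apply: Gamma_function_gt0.
  by rewrite ltr_wpDr// divr_ge0.
- by rewrite mulr_gt0// ?powR_gt0// ?pi_gt0//; apply: Gamma_function_gt0;
  rewrite subr_gt0.
Qed.

End Gamma.

Lemma ae_measurable_real dd (T : measurableType dd) (R : realType)
    (mu : {measure set T -> \bar R}) (f g : T -> R) : measure_is_complete mu ->
  {ae mu, forall x, f x = g x} -> measurable_fun setT f -> measurable_fun setT g.
Proof.
move=> cmu fg /measurable_EFinP mf; apply/measurable_EFinP.
apply: (@ae_measurable_fun _ _ _ mu cmu _ (EFin \o f)) => //.
by apply: filterS fg => x /= -> _.
Qed.

(** * Nonlocal energies *)

Section nonlocal_energy.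
Context {dd} {T : measurableType dd} {R : realType}.
Context (mu : {sigma_finite_measure set T -> \bar R}) (w : T * T -> R).
Hypotheses (cmu : measure_is_complete mu) (mw : measurable_fun setT w).
Notation mu2 := (mu \x mu)%E.
Notation mf v := (measurable_fun setT (v : T -> R)).
Implicit Types (f u v : T -> R).

(* [w] is the square root of the kernel, so that [energy v] is the Gagliardo seminorm
   squared and the fractional bilinear form is a scalar product of [weighted_diff]s. *)
Definition weighted_diff v (p : T * T) : R := (v p.1 - v p.2) * w p.
Notation gd := weighted_diff.

Definition nonlocal_energy v : \bar R := sq2 mu2 (gd v).
Notation energy := nonlocal_energy.

Definition Hs_sq v : \bar R := (sq2 mu v + energy v)%E.
Notation hs2 := Hs_sq.

Lemma measurable_gd v : mf v -> measurable_fun setT (gd v).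
Proof.
move=> mv; apply: measurable_funM => //.
apply: measurable_funB; first exact: (measurableT_comp mv measurable_fst).
exact: (measurableT_comp mv measurable_snd).
Qed.

Lemma energy_ge0 v : (0 <= energy v)%E.
Proof. exact: sq2_ge0. Qed.

Lemma hs2_ge0 v : (0 <= hs2 v)%E.
Proof. by rewrite adde_ge0 ?sq2_ge0. Qed.

Lemma sq2_le_hs2 v : (sq2 mu v <= hs2 v)%E.
Proof. by rewrite leeDl// sq2_ge0. Qed.

Lemma energy_le_hs2 v : (energy v <= hs2 v)%E.
Proof. by rewrite leeDr// sq2_ge0. Qed.

Lemma energy_lty v : (hs2 v < +oo)%E -> (energy v < +oo)%E.
Proof. by apply: le_lt_trans; exact: energy_le_hs2. Qed.

Lemma energyE v : mf v ->
  energy v = (\int[mu]_x \int[mu]_y (gd v (x, y) ^+ 2)%:E)%E.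
Proof.
move=> mv; rewrite /energy /sq2 fubini_tonelli1//.
- by apply/measurable_EFinP; apply: measurable_funX; exact: measurable_gd.
- by move=> p; rewrite lee_fin sqr_ge0.
Qed.

Lemma gdD u v : gd (u \+ v)%R = (gd u \+ gd v)%R.
Proof. by apply/funext => p; rewrite /gd/=; ring. Qed.

Lemma gdB u v : gd (u \- v)%R = (gd u \- gd v)%R.
Proof. by apply/funext => p; rewrite /gd/=; ring. Qed.

Lemma gdZ k u : gd (fun x => k * u x) = (fun p => k * gd u p).
Proof. by apply/funext => p; rewrite /gd/= mulrA mulrBr. Qed.

Lemma hs2_parallelogram u v : mf u -> mf v ->
  (hs2 (u \+ v)%R + hs2 (u \- v)%R = 2%:E * hs2 u + 2%:E * hs2 v)%E.
Proof.
move=> mmu mv; rewrite /hs2 /energy.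
rewrite gdD gdB addeACA.
rewrite sq2_parallelogram// sq2_parallelogram//; try exact: measurable_gd.
by rewrite !(ge0_muleDr _ (sq2_ge0 _ _) (sq2_ge0 _ _)) addeACA.
Qed.

Lemma hs2Z k v : mf v -> hs2 (fun x => k * v x) = ((k ^+ 2)%:E * hs2 v)%E.
Proof.
move=> mv; rewrite /hs2 /energy.
rewrite gdZ !sq2Z//; last exact: measurable_gd.
by rewrite (ge0_muleDr _ (sq2_ge0 _ _) (sq2_ge0 _ _)).
Qed.

Lemma hs2D_le u v : mf u -> mf v ->
  (hs2 (u \+ v)%R <= 2%:E * hs2 u + 2%:E * hs2 v)%E.
Proof. by move=> mmu mv; rewrite -hs2_parallelogram// leeDl// hs2_ge0. Qed.

Lemma hs2B_le u v : mf u -> mf v ->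
  (hs2 (u \- v)%R <= 2%:E * hs2 u + 2%:E * hs2 v)%E.
Proof. by move=> mmu mv; rewrite -hs2_parallelogram// leeDr// hs2_ge0. Qed.

Lemma ae_mu2 (P : T -> Prop) : {ae mu, forall x, P x} ->
  {ae mu2, forall p, P p.1 /\ P p.2}.
Proof.
move=> [N [mN N0 PN]].
have N0' : mu N = 0%E by [].
have n1 : mu2.-negligible (N `*` setT).
  exists (N `*` setT); split => //; first exact: measurableX.
  by transitivity (mu N * mu setT)%E; [exact: product_measure1E|rewrite N0' mul0e].
have n2 : mu2.-negligible (setT `*` N).
  exists (setT `*` N); split => //; first exact: measurableX.
  by transitivity (mu setT * mu N)%E; [exact: product_measure1E|rewrite N0' mule0].
apply: negligibleS (negligibleU n1 n2).
move=> [x y] /= /not_andP[nP|nP]; [left|right]; split => //; exact: PN.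
Qed.

Lemma ae_energy u v : mf u -> mf v -> {ae mu, forall x, u x = v x} ->
  energy u = energy v.
Proof.
move=> mmu mv uv; apply: ae_sq2; try exact: measurable_gd.
by apply: filterS (ae_mu2 uv) => p [h1 h2]; rewrite /gd h1 h2.
Qed.

Lemma ae_hs2 u v : mf u -> mf v -> {ae mu, forall x, u x = v x} -> hs2 u = hs2 v.
Proof.
by move=> mmu mv uv; rewrite /hs2 (ae_energy mmu mv uv) (ae_sq2 mmu mv uv).
Qed.

Lemma energy_fatou (f : nat -> T -> R) g (B : \bar R) :
  (forall n, mf (f n)) -> mf g -> (forall x, f ^~ x @ \oo --> g x) ->
  (\forall n \near \oo, (energy (f n) <= B)%E) -> (energy g <= B)%E.
Proof.
move=> mf mg fg fB; apply: (@sq2_fatou _ _ _ _ (fun n => gd (f n))).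
- by move=> n; exact: measurable_gd.
- by move=> p; apply: cvgM; [apply: cvgB; exact: fg|exact: cvg_cst].
- by [].
Qed.

(** Fatou is applied to the L^2 part and to the energy separately, each being at most [B]; this is
    where the factor 2 comes from, and it does no harm. *)
Lemma hs2_fatou (f : nat -> T -> R) g (B : R) :
  (forall n, mf (f n)) -> mf g -> (forall x, f ^~ x @ \oo --> g x) ->
  (\forall n \near \oo, (hs2 (f n) <= B%:E)%E) -> (hs2 g <= (2 * B)%:E)%E.
Proof.
move=> mf mg fg fB; rewrite mulr_natl mulr2n EFinD; apply: leeD.
  apply: (@sq2_fatou _ _ _ mu f) => //.
  by apply: filterS fB => n; apply: le_trans; exact: sq2_le_hs2.
apply: (@energy_fatou f) => //.
by apply: filterS fB => n; apply: le_trans; exact: energy_le_hs2.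
Qed.

Context (test : set (T -> R)).
Hypotheses (mtest : forall phi, test phi -> mf phi).

(** The abstract H^~s: [test] stands for the test functions of the domain, and the closure is
    expressed with the squared norm, for which the parallelogram law holds without side
    conditions. *)
Definition energy_closure v := [/\ mf v, (hs2 v < +oo)%E &
  forall e : R, 0 < e -> exists2 phi, test phi & (hs2 (v \- phi)%R < e%:E)%E].

Notation Htilde := energy_closure.

Lemma Htilde_measurable v : Htilde v -> mf v.
Proof. by case. Qed.

Lemma Htilde_lty v : Htilde v -> (hs2 v < +oo)%E.
Proof. by case. Qed.

Lemma Htilde_ae u v : {ae mu, forall x, u x = v x} ->
  Htilde u -> Htilde v.
Proof.
move=> uv [mmu u2 app].
have mv : mf v by exact: ae_measurable_real cmu uv mmu.
split => //; first by rewrite -(ae_hs2 mmu mv uv).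
move=> e e0; have [phi tphi h] := app e e0; exists phi => //.
have mphi := mtest tphi.
rewrite -(@ae_hs2 (u \- phi)%R)//; try exact: measurable_funB.
by apply: filterS uv => x /= ->.
Qed.

(** As in Riesz-Fischer: a subsequence converges almost everywhere, Fatou in the second index turns
    the Cauchy estimate into convergence of the whole sequence, and the limit inherits test
    approximants from a far term. *)
Lemma Htilde_complete (u : nat -> T -> R) :
  (forall n, Htilde (u n)) ->
  (forall e : R, 0 < e -> exists N, forall m n, (N <= m)%N -> (m <= n)%N ->
    (hs2 (u n \- u m)%R <= e%:E)%E) ->
  exists2 v, Htilde v & forall e : R, 0 < e -> exists N, forall n,
    (N <= n)%N -> (hs2 (u n \- v)%R <= e%:E)%E.
Proof.
move=> hu cu.
have mmu n := Htilde_measurable (hu n).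
have [sg [sgk sgm sgc]] := @sq2_cauchy_subseq _ _ _ mu u mmu (fun e e0 =>
  let: ex_intro N H := cu e e0 in
  ex_intro _ N (fun m n Nm mn => le_trans (sq2_le_hs2 _) (H m n Nm mn))).
pose C := [set x | cvgn (fun k => u (sg k) x)].
(* Setting the functions to 0 off the convergence set gives convergence at every point, which the
   measurability of the limit and Fatou ask for. *)
pose w' k := fun x => if x \in C then u (sg k) x else 0.
pose v := fun x => if x \in C then limn (fun k => u (sg k) x) else 0.
have uw k : {ae mu, forall x, u (sg k) x = w' k x}.
  by apply: filterS sgc => x cx; rewrite /w' mem_set.
have mw' k : mf (w' k) by exact: ae_measurable_real cmu (uw k) (mmu _).
have wv x : w' ^~ x @ \oo --> v x.
  rewrite /w' /v; case: ifPn => [/set_mem//|_]; exact: cvg_cst.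
have mv : mf v by exact: (measurable_fun_cvg mw' (fun x _ => wv x)).
have key (e : R) : 0 < e -> exists N, forall n, (N <= n)%N -> (hs2 (u n \- v)%R <=
  e%:E)%E.
  move=> e0; have e2 : 0 < e / 2 by rewrite divr_gt0.
  have [N HN] := cu _ e2; exists N => n Nn.
  have -> : e = 2 * (e / 2) by field.
  apply: (@hs2_fatou (fun k => (u n \- w' k)%R)).
  - by move=> k; exact: measurable_funB.
  - exact: measurable_funB.
  - by move=> x; apply: cvgB; [exact: cvg_cst|exact: wv].
  exists n => // k /= nk.
  have le : (n <= sg k)%N by exact: leq_trans nk (sgk k).
  rewrite (@ae_hs2 _ (u n \- u (sg k))%R); last 3 first.
  - exact: measurable_funB.
  - exact: measurable_funB.
  - by apply: filterS (uw k) => x /= ->.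
  rewrite (_ : (u n \- _)%R = (fun x => (-1) * (u (sg k) \- u n) x)%R); last first.
    by apply/funext => x /=; ring.
  rewrite hs2Z; last exact: measurable_funB.
  by rewrite sqrrN expr1n mul1e; exact: HN.
exists v => //.
have [N HN] := key _ ltr01.
have vE n : v = (u n \- (u n \- v))%R by apply/funext => x /=; ring.
split => //.
  rewrite (vE N); apply: le_lt_trans (hs2B_le _ _) _ => //;
    first exact: measurable_funB.
  apply: lte_add_pinfty; apply: lte_mul_pinfty => //.
  - exact: Htilde_lty (hu N).
  - by apply: le_lt_trans (HN N (leqnn N)) _; rewrite ltry.
move=> e e0; have e8 : 0 < e / 8 by rewrite divr_gt0.
have [N1 HN1] := key _ e8.
have [_ _ /(_ _ e8)[phi tphi hphi]] := hu N1.
have mphi := mtest tphi.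
exists phi => //.
rewrite (_ : (v \- phi)%R = ((u N1 \- phi) \- (u N1 \- v))%R); last first.
  by apply/funext => x /=; ring.
apply: le_lt_trans (hs2B_le _ _) _; try exact: measurable_funB.
apply: (@le_lt_trans _ _ (2%:E * (e / 8)%:E + 2%:E * (e / 8)%:E)%E).
  apply: leeD; apply: lee_wpmul2l => //; [exact: ltW|exact: HN1].
rewrite -!EFinM -EFinD lte_fin; lra.
Qed.

Hypotheses (testD : forall phi psi, test phi -> test psi -> test (phi \+ psi)%R).
Hypotheses (testZ : forall k phi, test phi -> test (fun x => k * phi x)).

Lemma HtildeD u v : Htilde u -> Htilde v -> Htilde (u \+ v)%R.
Proof.
move=> [mmu u2 au] [mv v2 av]; split; first exact: measurable_funD.
  apply: le_lt_trans (hs2D_le mmu mv) _.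
  by rewrite lte_add_pinfty// lte_mul_pinfty.
move=> e e0; have e8 : 0 < e / 8 by rewrite divr_gt0.
have [phi tphi hphi] := au _ e8; have [psi tpsi hpsi] := av _ e8.
exists (phi \+ psi)%R; first exact: testD.
rewrite (_ : (_ \- _)%R = ((u \- phi) \+ (v \- psi))%R); last first.
  by apply/funext => x /=; ring.
have mphi := mtest tphi; have mpsi := mtest tpsi.
apply: le_lt_trans (hs2D_le _ _) _; try exact: measurable_funB.
apply: (@le_lt_trans _ _ (2%:E * (e / 8)%:E + 2%:E * (e / 8)%:E)%E).
  by apply: leeD; apply: lee_wpmul2l => //; exact: ltW.
by rewrite -!EFinM -EFinD lte_fin; lra.
Qed.

Lemma HtildeZ k v : Htilde v -> Htilde (fun x => k * v x).
Proof.
move=> [mv v2 av]; split; first exact: measurable_funM.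
  by rewrite hs2Z// lte_mul_pinfty// ?lee_fin ?sqr_ge0// hs2_ge0.
move=> e e0; have k0 : 0 < k ^+ 2 + 1 by rewrite ltr_wpDl// sqr_ge0.
have ek : 0 < e / (k ^+ 2 + 1) by rewrite divr_gt0.
have [phi tphi hphi] := av _ ek; have mphi := mtest tphi.
exists (fun x => k * phi x); first exact: testZ.
rewrite (_ : (_ \- _)%R = (fun x => k * (v \- phi) x)%R); last first.
  by apply/funext => x /=; ring.
rewrite hs2Z; last exact: measurable_funB.
apply: (@le_lt_trans _ _ ((k ^+ 2)%:E * (e / (k ^+ 2 + 1))%:E)%E).
  by apply: lee_wpmul2l; [rewrite lee_fin sqr_ge0|exact: ltW].
by rewrite -EFinM lte_fin mulrA ltr_pdivrMr// mulrDr mulr1 mulrC ltrDl.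
Qed.

Lemma HtildeB u v : Htilde u -> Htilde v -> Htilde (u \- v)%R.
Proof.
move=> hu hv; rewrite (_ : (u \- v)%R = (u \+ (fun x => -1 * v x))%R).
  by apply: HtildeD => //; exact: HtildeZ.
by apply/funext => x /=; ring.
Qed.

Definition midpt u v : T -> R := fun x => 2^-1 * (u x + v x).

Lemma Htilde_mid u v : Htilde u -> Htilde v -> Htilde (midpt u v).
Proof. by move=> hu hv; apply: HtildeZ (HtildeD hu hv). Qed.

Lemma hs2_midpt u v : mf u -> mf v ->
  (hs2 (midpt u v) + (4^-1)%:E * hs2 (u \- v)%R =
   (2^-1)%:E * hs2 u + (2^-1)%:E * hs2 v)%E.
Proof.
move=> mmu mv; rewrite /midpt (hs2Z 2^-1); last exact: measurable_funD.
have -> : ((2^-1 ^+ 2)%:E = (4^-1)%:E :> \bar R)%E by congr EFin; field.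
rewrite -ge0_muleDr ?hs2_ge0// hs2_parallelogram//.
rewrite ge0_muleDr ?mule_ge0 ?hs2_ge0// !muleA.
by rewrite -EFinM (_ : 4^-1 * 2 = 2^-1 :> R)//; field.
Qed.

(** Mazur's argument: minimising the norm over the midpoint hulls of the tails produces a sequence
    that is Cauchy in the full norm. Its limit can only be [v], because elements of far hulls stay
    close to [v] in L^2. *)
Lemma Htilde_weak_closed (u : nat -> T -> R) v (B : R) :
  (forall n, Htilde (u n)) -> (forall n, hs2 (u n) <= B%:E)%E -> mf v ->
  (forall e : R, 0 < e -> exists N, forall n, (N <= n)%N ->
    (sq2 mu (u n \- v)%R <= e%:E)%E) ->
  Htilde v.
Proof.
move=> hu uB mv uv.
pose K n := midhull midpt [set u k | k in [set k | (n <= k)%N]].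
have KH n f : K n f -> Htilde f.
  by apply: midhull_ind_prop => [_ [k _ <-]//|]; exact: Htilde_mid.
have fin f : Htilde f -> hs2 f \is a fin_num.
  by move=> hf; rewrite ge0_fin_numE ?hs2_ge0//; exact: Htilde_lty hf.
have [] := @minimizing_cauchy R (T -> R) midpt
  (fun u v => fine (hs2 (u \- v)%R) / 4) (fun u => fine (hs2 u)) K 0 B.
- by move=> n; apply: midhullS => _ [k /= nk <-]; exists k => //=; exact: ltnW.
- by move=> n f g; exact: midhull_mid.
- by move=> f _; rewrite fine_ge0// hs2_ge0.
- move=> n; exists (u n); first by apply: midhull_in; exists n => /=.
  by rewrite -lee_fin fineK ?fin.
- move=> f g /KH hf /KH hg; have := hs2_midpt (Htilde_measurable hf) (Htilde_measurable
  hg).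
  have /fineK <- := fin _ hf; have /fineK <- := fin _ hg.
  have /fineK <- := fin _ (Htilde_mid hf hg); have /fineK <- := fin _ (HtildeB hf hg).
  by rewrite -!EFinM -!EFinD => -[] /=; lra.
move=> p [pK _ pC].
have hp n := KH n _ (pK n).
have [v' hv' pv'] : exists2 v', Htilde v' & forall e : R, 0 < e -> exists N,
    forall n, (N <= n)%N -> (hs2 (p n \- v')%R <= e%:E)%E.
  apply: Htilde_complete => // e e0.
  have e4 : 0 < e / 4 by rewrite divr_gt0.
  have [N HN] := pC _ e4; exists N => m n Nm mn.
  rewrite (_ : (p n \- p m)%R = (fun x => -1 * (p m \- p n)%R x)); last first.
    by apply/funext => x /=; ring.
  rewrite hs2Z ?sqrrN ?expr1n ?mul1e;
    last by exact: Htilde_measurable (HtildeB (hp m) (hp n)).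
  have := HN m n Nm mn; have /fineK <- := fin _ (HtildeB (hp m) (hp n)).
  by rewrite lee_fin /=; lra.
have mv' := Htilde_measurable hv'.
apply: Htilde_ae hv'.
suff : sq2 mu (v' \- v)%R = 0%E.
  move=> /sq2_eq0 h; have := h (measurable_funB mv' mv).
  by apply: filterS => x /= /eqP; rewrite subr_eq0 => /eqP.
apply/eqP; rewrite eq_le sq2_ge0 andbT.
apply/lee_addgt0Pr => e e0; rewrite add0e.
have e4 : 0 < e / 4 by rewrite divr_gt0.
have [N1 HN1] := pv' _ e4; have [N2 HN2] := uv _ e4.
pose n := maxn N1 N2.
have mp : mf (p n) by exact: Htilde_measurable (hp n).
(* An L^2 ball around [v] is stable under midpoints, so the bound extends from the tail to its
   hull. *)
have pv : (sq2 mu (p n \- v)%R <= (e / 4)%:E)%E.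
  suff : K n `<=` [set f | mf f /\ (sq2 mu (f \- v)%R <= (e / 4)%:E)%E].
    by move=> /(_ _ (pK n)) [].
  apply: midhull_ind_prop => [_ [k /= nk <-]|f g [mf' hf] [mg hg]].
    by split; [exact: Htilde_measurable|apply: HN2;
      rewrite (leq_trans _ nk)// leq_maxr].
  split; first by apply: measurable_funM => //; exact: measurable_funD.
  rewrite (_ : (_ \- _)%R = (fun x => 2^-1 * ((f \- v) \+ (g \- v)) x)%R); last first.
    by apply/funext => x; rewrite /midpt /=; field.
  have mfv := measurable_funB mf' mv; have mgv := measurable_funB mg mv.
  rewrite sq2Z; last exact: measurable_funD.
  apply: (@le_trans _ _ ((2^-1 ^+ 2)%:E * (2%:E * (e / 4)%:E + 2%:E * (e / 4)%:E))%E).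
    apply: lee_wpmul2l; first by rewrite lee_fin sqr_ge0.
    apply: le_trans (sq2D_le _ mfv mgv) _.
    by apply: leeD; apply: lee_wpmul2l.
  have -> : (2%:E * (e / 4)%:E = (e / 2)%:E :> \bar R)%E by rewrite -EFinM; congr EFin;
    field.
  by rewrite -EFinD -EFinM lee_fin; lra.
rewrite (_ : (v' \- v)%R = ((p n \- v) \- (p n \- v'))%R);
  last by apply/funext => x /=; ring.
apply: le_trans (sq2B_le _ (measurable_funB mp mv) (measurable_funB mp mv')) _.
apply: (@le_trans _ _ (2%:E * (e / 4)%:E + 2%:E * (e / 4)%:E)%E).
  apply: leeD; apply: lee_wpmul2l => //.
  by apply: le_trans (sq2_le_hs2 _) _; apply: HN1; exact: leq_maxl.
by rewrite -!EFinM -EFinD lee_fin; lra.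
Qed.

End nonlocal_energy.

Section clamp.
Context {R : realType}.

Definition clamp (m t : R) : R := Num.max (- m) (Num.min m t).

Lemma clamp_le (m t : R) : 0 <= m -> `|clamp m t| <= m.
Proof. by move=> m0; rewrite /clamp ler_norml le_max lexx/= ge_max ge_min lexx andbT;
  lra. Qed.

Lemma clamp_id m t : `|t| <= m -> clamp m t = t.
Proof.
rewrite ler_norml => /andP[t1 t2]; rewrite /clamp.
by rewrite min_r// max_r.
Qed.

Lemma clamp_nd m t u : t <= u -> clamp m t <= clamp m u.
Proof. by move=> tu; rewrite /clamp le_max2// le_min2. Qed.

Lemma clamp_sub_le m t u : u <= t -> clamp m t - clamp m u <= t - u.
Proof. by rewrite /clamp /Num.max /Num.min; repeat case: ifPn; rewrite -?leNgt;
  lra. Qed.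

Lemma clamp_dist m t u : `|clamp m t - clamp m u| <= `|t - u|.
Proof.
wlog tu : t u / u <= t => [hw|].
  by have [|/ltW] := leP u t; [exact: hw|rewrite (distrC (clamp m t)) (distrC t);
    exact: hw].
by rewrite !ger0_norm ?subr_ge0 ?clamp_nd// clamp_sub_le.
Qed.

Lemma clamp_norm_le m t : 0 <= m -> `|clamp m t| <= `|t|.
Proof.
move=> m0; have := clamp_dist m t 0.
by rewrite subr0 (@clamp_id m 0) ?normr0// subr0.
Qed.

Lemma measurable_clamp m : measurable_fun setT (clamp m).
Proof.
apply: measurable_maxr; first exact: measurable_cst.
by apply: measurable_minr; [exact: measurable_cst|exact: measurable_id].
Qed.

End clamp.

Lemma powRDx {R : realType} (x a b : R) : 0 < x -> x `^ (a + b) = x `^ a * x `^ b.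
Proof. by move=> x0; rewrite powRD//; apply/implyP => _; rewrite gt_eqF. Qed.

(** * Poincare and Sobolev inequalities by averaging over cubes *)

Section energy_inequalities.
Context {dd} {T : measurableType dd} {R : realType}.
Context (mu : {sigma_finite_measure set T -> \bar R}) (w : T * T -> R).
Hypotheses (mw : measurable_fun setT w).
Context (n : nat) (s c : R) (cube : T -> R -> set T).
Hypotheses (n_gt0 : (0 < n)%N) (c_gt0 : 0 < c).
Hypotheses (mcube : forall x h, measurable (cube x h)).
Hypotheses (cubeE : forall x (h : R), 0 <= h -> mu (cube x h) = (h ^+ n)%:E).
Hypotheses (cubew : forall x y (h : R), 0 < h -> cube x h y -> x <> y ->
  1 <= c * h `^ (n%:R + 2 * s) * w (x, y) ^+ 2).
Notation mf v := (measurable_fun setT (v : T -> R)).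
Notation energy := (nonlocal_energy mu w).
Notation gd := (weighted_diff w).
Implicit Types (f u v : T -> R).

Lemma measurable_gd2 v : mf v ->
  measurable_fun setT ((fun p => (gd v p ^+ 2)%:E) : T * T -> \bar R).
Proof.
by move=> mv; apply/measurable_EFinP; apply: measurable_funX; exact: measurable_gd.
Qed.

Lemma measurable_gd2_slice v x : mf v ->
  measurable_fun setT ((fun y => (gd v (x, y) ^+ 2)%:E) : T -> \bar R).
Proof.
move=> mv; apply: (measurableT_comp (measurable_gd2 mv)).
exact: pair1_measurable.
Qed.

Lemma measurable_slice_energy v : mf v ->
  measurable_fun setT (fun x => \int[mu]_y (gd v (x, y) ^+ 2)%:E)%E.
Proof.
move=> mv; apply: (@measurable_fun_fubini_tonelli_F _ _ _ _ _ mu (fun p => (gd v p ^+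
  2)%:E)).
  exact: measurable_gd2.
by move=> p; rewrite lee_fin sqr_ge0.
Qed.

(** At least half of the cube at [x] lies off [S]; there the difference is at least [t] and the
    kernel at least [1 / (c * h ^ (n + 2s))]. Multiplying by the volume [h ^ n / 2] gives the
    bound. *)
Lemma slice_energy_ge v x (h : R) S (t : R) : mf v -> 0 < h -> measurable S ->
  (mu S <= (h ^+ n / 2)%:E)%E -> 0 < t ->
  (forall y, cube x h y -> ~ S y -> t <= `|v x - v y|) ->
  ((t ^+ 2 * h `^ (- (2 * s)) / (2 * c))%:E <= \int[mu]_y (gd v (x, y) ^+ 2)%:E)%E.
Proof.
move=> mv h0 mS muS t0 tv.
pose D := cube x h `\` S.
have mD : measurable D by exact: measurableD.
pose K := c * h `^ (n%:R + 2 * s).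
have K0 : 0 < K by rewrite mulr_gt0// powR_gt0.
apply: (@le_trans _ _ (\int[mu]_(y in D) (gd v (x, y) ^+ 2)%:E)%E); last first.
  apply: ge0_subset_integral => //; first exact: measurable_gd2_slice.
  by move=> y _; rewrite lee_fin sqr_ge0.
apply: (@le_trans _ _ (\int[mu]_(y in D) (t ^+ 2 / K)%:E)%E); last first.
  apply: ge0_le_integral => //.
  - by move=> y _; rewrite lee_fin divr_ge0 ?sqr_ge0// ltW.
  - by apply: measurable_funTS; exact: measurable_gd2_slice.
  - move=> y [Qy Sy]; rewrite lee_fin ler_pdivrMr//.
    have tvy := tv y Qy Sy.
    (* The lower bound on the weight is only available off the diagonal; a positive [t] keeps [y]
       away from it. *)
    have xy : x <> y by move=> xy; move: tvy; rewrite xy subrr normr0; lra.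
    have := cubew h0 Qy xy; rewrite -/K => Kw.
    rewrite /gd/= exprMn -mulrA [_ * K]mulrC.
    rewrite -[leLHS]mulr1; apply: ler_pM => //; first exact: sqr_ge0.
    rewrite -[leRHS]real_normK ?num_real//.
    by apply: lerXn2r => //; rewrite nnegrE// ltW.
rewrite integral_cst//.
have muD : ((h ^+ n / 2)%:E <= mu D)%E.
  have : (mu (cube x h) <= mu D + mu S)%E.
    apply: le_trans (measureU2 _ _ _) => //; apply: le_measure; rewrite ?inE//.
      exact: measurableU.
    by move=> y Qy; have [Sy|Sy] := pselect (S y); [right|left; split].
  rewrite cubeE ?(ltW h0)// => le1.
  rewrite -(@leeD2rE _ (h ^+ n / 2)%:E)// -EFinD -splitr.
  by apply: le_trans le1 _; rewrite leeD2l.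
apply: (@le_trans _ _ ((t ^+ 2 / K)%:E * (h ^+ n / 2)%:E)%E); last first.
  by apply: lee_wpmul2l muD; rewrite lee_fin divr_ge0 ?sqr_ge0// ltW.
rewrite -EFinM lee_fin le_eqVlt; apply/orP; left; apply/eqP.
rewrite /K powRDx// powRN powR_mulrn ?(ltW h0)//.
have hn : h ^+ n != 0 by rewrite expf_neq0// gt_eqF.
have hs : h `^ (2 * s) != 0 by rewrite gt_eqF// powR_gt0.
have c0 : c != 0 by rewrite gt_eqF.
by field; rewrite hn hs c0.
Qed.

(** With [h ^ n = 2 * A] the set [S] fills at most half of any cube of side [h]. On the remaining
    half [v] vanishes, so [slice_energy_ge] applies with [t] equal to the absolute value of
    [v x]. *)
Lemma poincare (A : R) : 0 < A -> exists2 C : R, 0 < C & forall v S, mf v -> measurable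
  S ->
  (mu S <= A%:E)%E -> (forall x, ~ S x -> v x = 0) ->
  (sq2 mu v <= C%:E * energy v)%E.
Proof.
move=> A0; pose h := (2 * A) `^ n%:R^-1.
have h0 : 0 < h by rewrite powR_gt0// mulr_gt0.
have nR : n%:R != 0 :> R by rewrite pnatr_eq0 -lt0n.
have hn : h ^+ n = 2 * A.
  by rewrite -powR_mulrn ?(ltW h0)// -powRrM mulVf// powRr1// mulr_ge0// ltW.
pose k := h `^ (- (2 * s)) / (2 * c).
have k0 : 0 < k by rewrite divr_gt0 ?mulr_gt0// powR_gt0.
exists k^-1; first by rewrite invr_gt0.
move=> v S mv mS muS v0.
rewrite (energyE mu mw mv) -[leLHS]mul1e.
have -> : 1%E = ((k^-1)%:E * k%:E)%E :> \bar R by rewrite -EFinM mulVf// gt_eqF.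
rewrite -muleA; apply: lee_wpmul2l; first by rewrite lee_fin invr_ge0 ltW.
rewrite /sq2 -ge0_integralZl_EFin//; last 3 first.
- by move=> x _; rewrite lee_fin sqr_ge0.
- by apply/measurable_EFinP; exact: measurable_funX.
- exact: ltW.
apply: ge0_le_integral => //.
- by move=> x _; rewrite -EFinM lee_fin mulr_ge0 ?sqr_ge0// ltW.
- by apply: measurable_funeM; apply/measurable_EFinP; exact: measurable_funX.
- exact: measurable_slice_energy.
move=> x _; have [->|vx] := eqVneq (v x) 0.
  by rewrite expr0n/= mule0; apply: integral_ge0 => y _; rewrite lee_fin sqr_ge0.
have t0 : 0 < `|v x| by rewrite normr_gt0.
apply: le_trans (@slice_energy_ge v x h S `|v x| mv h0 mS _ t0 _).
- by rewrite -EFinM lee_fin real_normK ?num_real// /k mulrC mulrA.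
- by rewrite hn mulrC mulKf.
- by move=> y _ /v0 ->; rewrite subr0.
Qed.

Lemma energy_clamp_le m v : mf v -> (energy (clamp m \o v) <= energy v)%E.
Proof.
move=> mv; apply: le_sq2.
- apply: measurable_gd => //; exact: (measurableT_comp (measurable_clamp m)).
- exact: measurable_gd.
- by move=> p; rewrite /gd !normrM ler_wpM2r// clamp_dist.
Qed.

Hypotheses (s_gt0 : 0 < s) (s_lt : 2 * s < n%:R).
Let p := 2 * n%:R / (n%:R - 2 * s).

Let nR0 : 0 < n%:R :> R. Proof. by rewrite ltr0n. Qed.

Lemma sobolev_exp_gt2 : 2 < p.
Proof. by rewrite /p ltr_pdivlMr ?subr_gt0// mulrBr ltrBlDr ltrDl !mulr_gt0. Qed.

(* If [t = `|v x|] and [P] is the integral of [`|v| ^ p], then by Chebyshev's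
   inequality [`|v| <= t / 2] on at least half of a cube at [x] of volume
   [2 * (2 / t) ^ p * P]; integrating the resulting lower bound for the inner
   integral of the energy gives the inequality. *)
Lemma sobolev_bounded : exists2 C : R, 0 < C & forall v, mf v ->
  (\int[mu]_x (`|v x| `^ p)%:E < +oo)%E -> (energy v < +oo)%E ->
  fine (\int[mu]_x (`|v x| `^ p)%:E)%E <= (C * fine (energy v)) `^ (p / 2).
Proof.
have p2 := sobolev_exp_gt2; have p0 : 0 < p by lra.
have n2s : 0 < n%:R - 2 * s by rewrite subr_gt0.
(* The factors come in turn from [h ^ (- 2s)] for the side [h] of the cube, from [(t / 2) ^ 2], and
   from the denominator [2 * c] in [slice_energy_ge]. *)
pose b := (2 `^ (1 + p)) `^ (- (2 * s / n%:R)) / 4 / (2 * c).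
have b0 : 0 < b by rewrite !divr_gt0 ?mulr_gt0 ?powR_gt0.
exists b^-1; first by rewrite invr_gt0.
move=> v mv Poo Eoo; set PE := (\int[mu]_x _)%E in Poo *.
have mvp : measurable_fun setT (fun x => (`|v x| `^ p)%:E).
  apply/measurable_EFinP; apply: (measurableT_comp (measurable_powR _)).
  exact: measurableT_comp.
have PE0 : (0 <= PE)%E by apply: integral_ge0 => x _; rewrite lee_fin powR_ge0.
have Efin : energy v \is a fin_num by rewrite ge0_fin_numE// energy_ge0.
have Pfin : PE \is a fin_num by rewrite ge0_fin_numE.
set P := fine PE.
have E0 : 0 <= fine (energy v) by rewrite fine_ge0// energy_ge0.
have : 0 <= P by rewrite fine_ge0.
rewrite le_eqVlt => /orP[/eqP <-|P0]; first exact: powR_ge0.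
have key x : ((b * P `^ (- (2 * s / n%:R)))%:E * (`|v x| `^ p)%:E <=
    \int[mu]_y (gd v (x, y) ^+ 2)%:E)%E.
  have [->|vx] := eqVneq (v x) 0.
    rewrite normr0 powR0 ?gt_eqF// mule0.
    by apply: integral_ge0 => y _; rewrite lee_fin sqr_ge0.
  set t : R := `|v x|; have t0 : 0 < t by rewrite normr_gt0.
  have t2 : 0 < t / 2 by rewrite divr_gt0.
  pose S := [set y | t / 2 < `|v y|].
  have mS : measurable S.
    have mnv : measurable_fun setT (fun y => `|v y|) by exact: measurableT_comp.
    rewrite (_ : S = (fun y => `|v y|) @^-1` `]t / 2, +oo[); last first.
      by apply/seteqP; split=> y /=; rewrite in_itv/= andbT.
    by rewrite -[X in measurable X]setTI; exact: mnv.
  pose h := (2 `^ (1 + p) * P * t `^ (- p)) `^ n%:R^-1.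
  have X0 : 0 < 2 `^ (1 + p) * P * t `^ (- p) by rewrite !mulr_gt0 ?powR_gt0.
  have h0 : 0 < h by rewrite powR_gt0.
  have hn : h ^+ n = 2 `^ (1 + p) * P * t `^ (- p).
    by rewrite -powR_mulrn ?(ltW h0)// -powRrM mulVf ?gt_eqF// powRr1// ltW.
  have muS : (mu S <= (h ^+ n / 2)%:E)%E.
    have tp : 0 < (t / 2) `^ p by rewrite powR_gt0.
    have : (((t / 2) `^ p)%:E * mu S <= PE)%E.
      rewrite -integral_cst//.
      apply: (@le_trans _ _ (\int[mu]_(y in S) (`|v y| `^ p)%:E)%E); last first.
        by apply: ge0_subset_integral => // y _; rewrite lee_fin powR_ge0.
      apply: ge0_le_integral => //.
      - by move=> y _; rewrite lee_fin powR_ge0.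
      - exact: measurable_funTS.
      - move=> y /= Sy; rewrite lee_fin; apply: ge0_ler_powR;
        rewrite ?nnegrE ?(ltW p0) ?(ltW t2)//.
        exact: ltW.
    rewrite -(fineK Pfin) -/P muleC -lee_pdivlMr// -EFinM => le1.
    apply: le_trans le1 _; rewrite lee_fin hn le_eqVlt; apply/orP; left; apply/eqP.
    rewrite powRM ?(ltW t0)// powRDx// powRr1// powRN.
    have -> : (2^-1 : R) `^ p = (2 `^ p)^-1.
      by rewrite -(@powR_inv1 _ 2)// -powRrM mulN1r powRN.
    have a0 : 2 `^ p != 0 :> R by rewrite gt_eqF// powR_gt0.
    have a1 : t `^ p != 0 by rewrite gt_eqF// powR_gt0.
    by field; rewrite a0 a1.
  apply: le_trans (@slice_energy_ge v x h S (t / 2) mv h0 mS muS t2 _).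
  - rewrite -EFinM lee_fin le_eqVlt; apply/orP; left; apply/eqP.
    rewrite /h -powRrM !powRM ?powR_ge0 ?(ltW P0) ?mulr_ge0 ?powR_ge0 ?(ltW P0)//.
    have -> : n%:R^-1 * - (2 * s) = - (2 * s / n%:R) by rewrite mulrN mulrC.
    (* This is [2 + 2 * s * p / n = p], the relation that determines the Sobolev exponent. *)
    have -> : (t `^ (- p)) `^ (- (2 * s / n%:R)) = t `^ p / t ^+ 2.
      rewrite -powRrM -(@powR_mulrn _ _ 2) ?(ltW t0)// -powRN -powRDx//.
      congr (_ `^ _); rewrite /p; field.
      by rewrite !gt_eqF.
    rewrite /b; have t00 : t != 0 by rewrite gt_eqF.
    have c0 : c != 0 by rewrite gt_eqF.
    by field; rewrite t00 c0.
  - move=> y _ /negP; rewrite -leNgt => Sy.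
    have := ler_normD (v x - v y) (v y); rewrite subrK -/t.
    lra.
have le1 : b * P `^ (- (2 * s / n%:R)) * P <= fine (energy v).
  rewrite -lee_fin fineK// EFinM /P fineK// (energyE mu mw mv).
  rewrite -ge0_integralZl_EFin//; last by rewrite mulr_ge0 ?powR_ge0// ltW.
  rewrite -/P; apply: ge0_le_integral => //.
  - by move=> x _; apply: mule_ge0;
    rewrite lee_fin ?powR_ge0// mulr_ge0 ?powR_ge0// ltW.
  - exact: measurable_funeM.
  - exact: measurable_slice_energy.
have e1 : P `^ (2 / p) <= b^-1 * fine (energy v).
  rewrite ler_pdivlMl//; apply: le_trans le1; rewrite -mulrA ler_wpM2l ?(ltW b0)//.
  rewrite -{3}(powRr1 (ltW P0)) -powRDx//.
  rewrite le_eqVlt; apply/orP; left; apply/eqP; congr (_ `^ _); rewrite /p; field.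
  by rewrite !gt_eqF.
have -> : P = (P `^ (2 / p)) `^ (p / 2).
  rewrite -powRrM (_ : 2 / p * (p / 2) = 1) ?powRr1 ?(ltW P0)//.
  by field; rewrite gt_eqF.
apply: ge0_ler_powR; rewrite ?nnegrE ?powR_ge0// ?mulr_ge0 ?invr_ge0 ?(ltW b0)//.
exact: ltW.
Qed.

(** [sobolev_bounded] cancels a power of the integral of the [p]-th power, which must therefore be
    known to be finite. Clamping at height [k] ensures it, since then
    [t ^ p <= k ^ (p - 2) * t ^ 2]; clamping does not increase the energy, and Fatou removes it. *)
Lemma sobolev : exists2 C : R, 0 < C & forall v, mf v ->
  (sq2 mu v < +oo)%E -> (energy v < +oo)%E ->
  (\int[mu]_x (`|v x| `^ p)%:E <= ((C * fine (energy v)) `^ (p / 2))%:E)%E.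
Proof.
have p2 := sobolev_exp_gt2; have p0 : 0 < p by lra.
have [C C0 HC] := sobolev_bounded; exists C => // v mv v2 Ev.
pose f k x := `|clamp k%:R (v x)| `^ (p / 2).
have mT k : mf (clamp k%:R \o v) by exact: (measurableT_comp (measurable_clamp _)).
have fE (g : T -> R) : (\int[mu]_x (`|g x| `^ p)%:E = sq2 mu (fun x => `|g x| `^ (p /
  2))%R)%E.
  apply: eq_integral => x _; congr EFin.
  by rewrite -powR_mulrn ?powR_ge0// -powRrM divfK.
rewrite fE; apply: (@sq2_fatou _ _ _ mu f).
- move=> k; apply: (measurableT_comp (measurable_powR _)).
  by apply: measurableT_comp => //; exact: mT.
- move=> x; apply: cvg_near_cst; exists (Num.bound `|v x|) => // k /= kx.
  rewrite /f clamp_id//; apply/ltW; apply: lt_le_trans (archi_boundP (normr_ge0 _)) _.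
  by rewrite ler_nat.
apply: nearW => k; rewrite -(fE (clamp k%:R \o v)).
have Ek : (energy (clamp k%:R \o v) <= energy v)%E by exact: energy_clamp_le.
have Ekoo : (energy (clamp k%:R \o v) < +oo)%E by exact: le_lt_trans Ek Ev.
have Poo : (\int[mu]_x (`|clamp k%:R (v x)| `^ p)%:E < +oo)%E.
  apply: (@le_lt_trans _ _ ((k%:R `^ (p - 2))%:E * sq2 mu v)%E); last first.
    by rewrite lte_mul_pinfty ?lee_fin ?powR_ge0.
  rewrite /sq2 -ge0_integralZl_EFin//; last 2 first.
  - by move=> x _; rewrite lee_fin sqr_ge0.
  - by apply/measurable_EFinP; exact: measurable_funX.
  apply: ge0_le_integral => //.
  - apply/measurable_EFinP; apply: (measurableT_comp (measurable_powR _)).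
    by apply: measurableT_comp => //; exact: mT.
  - by apply: measurable_funeM; apply/measurable_EFinP; exact: measurable_funX.
  - move=> x _; rewrite -EFinM lee_fin.
    set t := `|clamp _ _|.
    have tk : t <= k%:R by exact: clamp_le.
    have tv : t <= `|v x| by exact: clamp_norm_le.
    have t0 : 0 <= t by exact: normr_ge0.
    have [->|tn0] := eqVneq t 0.
      by rewrite powR0 ?gt_eqF// mulr_ge0 ?powR_ge0// sqr_ge0.
    have -> : t `^ p = t `^ (p - 2) * t ^+ 2.
      by rewrite -(@powR_mulrn _ _ 2)// -powRDx ?subrK// lt_def tn0.
    apply: ler_pM; rewrite ?powR_ge0 ?sqr_ge0//.
      by apply: ge0_ler_powR; rewrite ?nnegrE//; lra.
    by rewrite -[leRHS]real_normK ?num_real// lerXn2r ?nnegrE.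
rewrite -(fineK (_ : (\int[mu]_x (`|clamp k%:R (v x)| `^ p)%:E)%E \is a fin_num));
  last first.
  by rewrite ge0_fin_numE//; apply: integral_ge0 => x _; rewrite lee_fin powR_ge0.
rewrite lee_fin; apply: le_trans (HC _ (mT k) Poo Ekoo) _.
have En0 : 0 <= fine (energy (clamp k%:R \o v)) by rewrite fine_ge0// energy_ge0.
have En1 : fine (energy (clamp k%:R \o v)) <= fine (energy v).
  by apply: fine_le => //; rewrite ge0_fin_numE ?energy_ge0.
apply: ge0_ler_powR; rewrite ?nnegrE ?divr_ge0 ?(ltW p0)//.
- by rewrite subr_ge0 ltW.
- by rewrite mulr_ge0// ltW.
- by rewrite mulr_ge0 ?(ltW C0)// (le_trans En0).
- by rewrite ler_wpM2l// ltW.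
Qed.

End energy_inequalities.

Section Rintegral_facts.
Context {dd} {T : measurableType dd} {R : realType}.
Context (mu : {measure set T -> \bar R}).
Implicit Types (f g : T -> R).

Lemma Rintegral_sum (I : Type) (r : seq I) (F : I -> T -> R) :
  (forall i, mu.-integrable setT (EFin \o F i)) ->
  \int[mu]_x (\sum_(i <- r) F i x) = \sum_(i <- r) \int[mu]_x F i x.
Proof.
move=> iF; elim: r => [|i r ih].
  rewrite big_nil; under eq_Rintegral do rewrite big_nil.
  by rewrite Rintegral_cst// mul0r.
rewrite big_cons -ih -RintegralD//.
- by apply: eq_Rintegral => x _; rewrite big_cons.
- have := @integrable_sum _ _ _ mu setT measurableT I r xpredT (fun i => EFin \o F i).
  move=> /(_ (fun i _ => iF i)); apply: eq_integrable => // x _.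
  by rewrite /= sumEFin.
Qed.

Lemma sq2_integrable f : measurable_fun setT f -> (sq2 mu f < +oo)%E ->
  mu.-integrable setT (EFin \o (fun x => f x ^+ 2)).
Proof.
move=> mf f2; have := sq2_mul_integrable mf mf f2 f2.
by apply: eq_integrable => // x _; rewrite /= expr2.
Qed.

Lemma integrable_cst_lty (A : set T) (k : R) : measurable A -> (mu A < +oo)%E ->
  mu.-integrable A (EFin \o cst k).
Proof.
move=> mA Aoo; apply: measurable_bounded_integrable => //.
exists `|k|; split; first exact: num_real.
by move=> M kM y _ /=; exact: ltW.
Qed.

Lemma integrable_finite_measure f (A : set T) : measurable_fun setT f ->
  measurable A -> (mu A < +oo)%E -> (sq2 mu f < +oo)%E ->
  mu.-integrable A (EFin \o f).
Proof.
move=> mf mA Aoo f2.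
have i1 : mu.-integrable A (EFin \o cst (1 : R)).
  exact: integrable_cst_lty.
have i2 : mu.-integrable A (EFin \o (fun x => f x ^+ 2)).
  by apply: integrableS (sq2_integrable mf f2).
have i3 : mu.-integrable A (EFin \o (fun x => 1 + f x ^+ 2)).
  by have := integrableD mA i1 i2; apply: eq_integrable.
apply: le_integrable i3 => //.
  by apply/measurable_EFinP; exact: measurable_funTS.
move=> x _ /=; rewrite lee_fin [leRHS]ger0_norm; last first.
  by rewrite addr_ge0// sqr_ge0.
by rewrite ler_norml; have := sqr_ge0 (f x); move: (f x) => t; nra.
Qed.

Lemma fine_sq2 f : fine (sq2 mu f) = \int[mu]_x (f x ^+ 2).
Proof. by []. Qed.

End Rintegral_facts.

(** * A quantitative Rellich estimate on a mesh of cells *)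

Section rellich.
Context {dd} {T : measurableType dd} {R : realType}.
Context (mu : {sigma_finite_measure set T -> \bar R}) (w : T * T -> R).
Hypotheses (mw : measurable_fun setT w).
Context (n : nat) (s c h : R) (I : finType) (Q : I -> set T).
Hypotheses (c_gt0 : 0 < c) (h_gt0 : 0 < h).
Hypotheses (mQ : forall i, measurable (Q i)).
Hypotheses (QE : forall i, mu (Q i) = (h ^+ n)%:E).
Hypotheses (tQ : forall i j x, Q i x -> Q j x -> i = j).
Hypotheses (Qw : forall i x y, Q i x -> Q i y -> x <> y ->
  1 <= c * h `^ (n%:R + 2 * s) * w (x, y) ^+ 2).
Notation mf v := (measurable_fun setT (v : T -> R)).
Notation energy := (nonlocal_energy mu w).
Notation gd := (weighted_diff w).
Implicit Types (f g u v : T -> R).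

Let m := h ^+ n.
Let m0 : 0 < m. Proof. by rewrite exprn_gt0. Qed.
Let Qoo i : (mu (Q i) < +oo)%E. Proof. by rewrite QE ltry. Qed.

Let cell_cst i (k : R) : \int[mu]_(y in Q i) cst k y = k * m.
Proof.
by transitivity (k * fine (mu (Q i))); [exact: Rintegral_cst|rewrite QE].
Qed.

Definition cell_mean v i := m^-1 * \int[mu]_(y in Q i) v y.

(** The mean minimises [t -> \int (t - v y) ^ 2] over the cell, and moving [t] from the mean to
    [v x] adds exactly [m * (v x - mean) ^ 2]. The remaining integral of [(v x - v y) ^ 2] is
    controlled by the kernel inside the cell, and dividing by [m] leaves the factor [h ^ (2s)]. *)
Lemma cell_mean_slice v x i : mf v -> (sq2 mu v < +oo)%E -> Q i x ->
  (((v x - cell_mean v i) ^+ 2)%:E <=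
   (c * h `^ (2 * s))%:E * \int[mu]_y (gd v (x, y) ^+ 2)%:E)%E.
Proof.
move=> mv v2 Qx; set a := cell_mean v i.
pose K := c * h `^ (n%:R + 2 * s).
have K0 : 0 < K by rewrite mulr_gt0// powR_gt0.
have i1 : mu.-integrable (Q i) (EFin \o v).
  by apply: integrable_finite_measure => //; exact: Qoo.
have i2 : mu.-integrable (Q i) (EFin \o (fun x => v x ^+ 2)).
  by apply: integrableS (sq2_integrable mv v2).
have ic k : mu.-integrable (Q i) (EFin \o cst (k : R)).
  by apply: integrable_cst_lty => //; exact: Qoo.
have iZ k : mu.-integrable (Q i) (EFin \o (fun y => k * v y)).
  by have := integrableZl (mQ i) k i1; apply: eq_integrable => //.
have icZ k k' : mu.-integrable (Q i) (EFin \o (fun y => k + k' * v y)).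
  by have := integrableD (mQ i) (ic k) (iZ k'); apply: eq_integrable => //.
have quad t : \int[mu]_(y in Q i) ((t - v y) ^+ 2) =
    m * t ^+ 2 - 2 * t * (m * a) + \int[mu]_(y in Q i) (v y ^+ 2).
  transitivity (\int[mu]_(y in Q i) ((t ^+ 2 + (- (2 * t)) * v y) + v y ^+ 2)).
    by apply: eq_Rintegral => y _; ring.
  rewrite RintegralD//.
  rewrite (@RintegralD _ _ _ mu _ (cst (t ^+ 2)) (fun y => - (2 * t) * v y))//.
  rewrite cell_cst RintegralZl// mulNr; congr (_ - _ + _); first by rewrite mulrC.
  by congr (_ * _); rewrite /a /cell_mean mulrA divff ?mul1r// gt_eqF.
have J0 : 0 <= \int[mu]_(y in Q i) ((a - v y) ^+ 2).
  by apply: Rintegral_ge0 => y _; exact: sqr_ge0.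
have Jx : m * (v x - a) ^+ 2 <= \int[mu]_(y in Q i) ((v x - v y) ^+ 2).
  by move: J0; rewrite !quad; move: (\int[mu]_(y in _) _) (v x) => V t; nra.
have ii : mu.-integrable (Q i) (EFin \o (fun y => (v x - v y) ^+ 2)).
  have := integrableD (mQ i) (icZ (v x ^+ 2) (- (2 * v x))) i2.
  by apply: eq_integrable => // y _ /=; rewrite -EFinD; congr EFin; ring.
have le1 : ((\int[mu]_(y in Q i) ((v x - v y) ^+ 2))%:E <=
    K%:E * \int[mu]_y (gd v (x, y) ^+ 2)%:E)%E.
  rewrite /Rintegral fineK; last exact: integrable_fin_num.
  rewrite -ge0_integralZl_EFin ?(ltW K0)//; last 2 first.
  - by move=> y _; rewrite lee_fin sqr_ge0.
  - exact: measurable_gd2_slice.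
  apply: (@le_trans _ _ (\int[mu]_(y in Q i) (K%:E * (gd v (x, y) ^+ 2)%:E))%E);
    last first.
    apply: ge0_subset_integral => //.
    - by apply: measurable_funeM; exact: measurable_gd2_slice.
    - by move=> y _; rewrite -EFinM lee_fin mulr_ge0 ?sqr_ge0 ?ltW.
  apply: ge0_le_integral => //.
  - by move=> y _; rewrite lee_fin sqr_ge0.
  - exact: measurable_int ii.
  - by apply: measurable_funTS; apply: measurable_funeM; exact: measurable_gd2_slice.
  - move=> y Qy; rewrite -EFinM lee_fin /gd/= exprMn mulrCA.
    have [->|xy] := pselect (x = y); first by rewrite subrr expr0n/= mul0r.
    by rewrite ler_peMr ?sqr_ge0//; exact: (Qw Qx Qy xy).
rewrite (_ : c * h `^ (2 * s) = m^-1 * K); last first.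
  rewrite /K powRDx// powR_mulrn ?(ltW h_gt0)// -/m; field.
  by rewrite gt_eqF.
rewrite [(m^-1 * K)%:E]EFinM -muleA; apply: (@le_trans _ _ ((m^-1)%:E *
    (\int[mu]_(y in Q i) ((v x - v y) ^+ 2))%:E)%E); last first.
  by apply: lee_wpmul2l => //; rewrite lee_fin invr_ge0 ltW.
by rewrite -EFinM lee_fin ler_pdivlMl.
Qed.

(** A crude consequence of [|v| <= 1 + v ^ 2]. On a fixed mesh only a bound uniform in [v] matters,
    because it multiplies cell integrals that tend to 0. *)
Lemma cell_mean_le v i (V : R) : mf v -> (sq2 mu v <= V%:E)%E ->
  `|cell_mean v i| <= 1 + V / m.
Proof.
move=> mv v2; have v2oo : (sq2 mu v < +oo)%E by rewrite (le_lt_trans v2)// ltry.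
have i1 : mu.-integrable (Q i) (EFin \o v).
  by apply: integrable_finite_measure => //; exact: Qoo.
have i2 : mu.-integrable setT (EFin \o (fun x => v x ^+ 2)) by exact: sq2_integrable.
have i2Q : mu.-integrable (Q i) (EFin \o (fun x => v x ^+ 2)) by exact: integrableS i2.
have ic : mu.-integrable (Q i) (EFin \o cst (1 : R)).
  by apply: integrable_cst_lty => //; exact: Qoo.
rewrite /cell_mean normrM gtr0_norm ?invr_gt0// ler_pdivrMl// mulrDr mulr1 mulrCA divff
  ?gt_eqF// mulr1.
apply: le_trans (le_normr_Rintegral _ i1) _ => //.
apply: (@le_trans _ _ (\int[mu]_(y in Q i) (1 + v y ^+ 2))).
  apply: le_Rintegral => //.
  - exact: integrable_norm.
  - exact: integrableD ic i2Q.
  by move=> y _; rewrite ler_norml; have := sqr_ge0 (v y); move: (v y) => t; nra.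
rewrite (@RintegralD _ _ _ mu _ (cst 1) (fun y => v y ^+ 2))// cell_cst mul1r lerD2l.
apply: (@le_trans _ _ (fine (sq2 mu v))); last first.
  by rewrite -lee_fin fineK// ge0_fin_numE// sq2_ge0.
apply: fine_le; first exact: integrable_fin_num i2Q.
  by rewrite ge0_fin_numE// sq2_ge0.
apply: ge0_subset_integral => //; first exact: measurable_int i2.
by move=> y _; rewrite lee_fin sqr_ge0.
Qed.

(* Split [v] into its cell means and the oscillation around them; the oscillation is
   of order [h ^ s] in L^2, and [tau] is the weight in Young's inequality. *)
Lemma cell_duality g v (tau V E : R) : mf g -> mf v -> (sq2 mu g < +oo)%E ->
  (forall x, (forall i, ~ Q i x) -> g x = 0) ->
  (sq2 mu v <= V%:E)%E -> (energy v <= E%:E)%E -> 0 < tau ->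
  `|\int[mu]_x (g x * v x)| <= tau / 2 * fine (sq2 mu g) +
    c * h `^ (2 * s) / (2 * tau) * E +
    (1 + V / m) * \sum_i `|\int[mu]_(x in Q i) g x|.
Proof.
move=> mg mv g2 g0 v2 Ev tau0.
have v2oo : (sq2 mu v < +oo)%E by rewrite (le_lt_trans v2)// ltry.
pose U := \big[setU/set0]_(i : I) Q i.
have UP x : U x <-> exists i, Q i x.
  rewrite /U -bigcup_seq; split => [[i _ Qi]|[i Qi]]; first by exists i.
  by exists i => //=; rewrite mem_index_enum.
have mU : measurable U by exact: bigsetU_measurable.
pose a := cell_mean v.
pose av x := \sum_i a i * \1_(Q i) x.
have avE i x : Q i x -> av x = a i.
  move=> Qi; rewrite /av (bigD1 i)//= indicE mem_set// mulr1 big1 ?addr0// => j ji.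
  rewrite indicE memNset ?mulr0// => Qj.
  by move: ji; rewrite (tQ Qj Qi) eqxx.
have mav : mf av.
  by apply: measurable_sum => i; apply: measurable_funM => //; exact: measurable_indic.
pose r x := (v x - av x) * \1_U x.
have mr : mf r.
  by apply: measurable_funM; [exact: measurable_funB|exact: measurable_indic].
have r2 : (sq2 mu r <= (c * h `^ (2 * s) * E)%:E)%E.
  apply: (@le_trans _ _ ((c * h `^ (2 * s))%:E * energy v)%E); last first.
    by rewrite [leRHS]EFinM; apply: lee_wpmul2l => //;
      rewrite lee_fin mulr_ge0 ?powR_ge0// ltW.
  rewrite (energyE mu mw mv) -ge0_integralZl_EFin//; last 3 first.
  - by move=> x _; apply: integral_ge0 => y _; rewrite lee_fin sqr_ge0.
  - exact: measurable_slice_energy.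
  - by rewrite mulr_ge0 ?powR_ge0// ltW.
  apply: ge0_le_integral => //.
  - by move=> x _; rewrite lee_fin sqr_ge0.
  - by apply/measurable_EFinP; exact: measurable_funX.
  - by apply: measurable_funeM; exact: measurable_slice_energy.
  move=> x _; have [/[dup] Ux /UP[i Qi]|nUx] := pselect (U x).
    rewrite /r (avE i)// indicE mem_set// mulr1.
    exact: cell_mean_slice.
  rewrite /r indicE memNset// mulr0 expr0n/=; apply: mule_ge0.
    by rewrite lee_fin mulr_ge0 ?powR_ge0// ltW.
  by apply: integral_ge0 => y _; rewrite lee_fin sqr_ge0.
have r2oo : (sq2 mu r < +oo)%E by rewrite (le_lt_trans r2)// ltry.
have igr : mu.-integrable setT (EFin \o (fun x => g x * r x)) by exact:
  sq2_mul_integrable.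
have igQ i : mu.-integrable (Q i) (EFin \o g).
  by apply: integrable_finite_measure => //; exact: Qoo.
have igQT i : mu.-integrable setT (EFin \o (g \_ (Q i))).
  have := (integrable_mkcond (EFin \o g) (mQ i)).1 (igQ i).
  by apply: eq_integrable => // x _; rewrite restrict_EFin.
have igQTa i : mu.-integrable setT (EFin \o (fun x => a i * (g \_ (Q i)) x)).
  by have := integrableZl measurableT (a i) (igQT i); apply: eq_integrable.
have dec : \int[mu]_x (g x * v x) = \int[mu]_x (g x * r x) +
    \sum_i a i * \int[mu]_(x in Q i) g x.
  have -> : \sum_i a i * \int[mu]_(x in Q i) g x =
      \int[mu]_x (\sum_i a i * (g \_ (Q i)) x).
    rewrite Rintegral_sum//; apply: eq_bigr => i _.
    by rewrite RintegralZl// [in LHS]Rintegral_mkcond.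
  rewrite -RintegralD//; last first.
    have := @integrable_sum _ _ _ mu setT measurableT I (index_enum I) xpredT
      (fun i => EFin \o (fun x => a i * (g \_ (Q i)) x)) (fun i _ => igQTa i).
    by apply: eq_integrable => // x _; rewrite /= sumEFin.
  apply: eq_Rintegral => x _; have [/[dup] Ux /UP[i Qi]|nUx] := pselect (U x).
    rewrite /r (avE i)// indicE mem_set// mulr1 (bigD1 i)//= patchE mem_set//.
    rewrite big1 ?addr0; first by ring.
    move=> j ji; rewrite patchE memNset ?mulr0// => Qj.
    by move: ji; rewrite (tQ Qj Qi) eqxx.
  have gx : g x = 0 by apply: g0 => i Qi; apply: nUx; apply/UP; exists i.
  by rewrite gx !mul0r add0r big1// => i _; rewrite patchE; case: ifPn;
    rewrite ?gx mulr0.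
rewrite dec; apply: le_trans (ler_normD _ _) _; apply: lerD; last first.
  rewrite mulr_sumr; apply: le_trans (ler_norm_sum _ _ _) _.
  apply: ler_sum => i _; rewrite normrM ler_wpM2r//.
  exact: cell_mean_le.
have ig2 := sq2_integrable mg g2; have ir2 := sq2_integrable mr r2oo.
apply: le_trans (le_normr_Rintegral _ igr) _ => //.
have iZ k f : mu.-integrable setT (EFin \o f) -> mu.-integrable setT (EFin \o (fun x =>
  k * f x)).
  by move=> fi; have := integrableZl measurableT k fi; apply: eq_integrable.
apply: (@le_trans _ _ (\int[mu]_x (tau / 2 * g x ^+ 2 + (2 * tau)^-1 * r x ^+ 2))).
  apply: le_Rintegral => //.
  - exact: integrable_norm.
  - by have := integrableD measurableT (iZ (tau / 2) _ ig2) (iZ ((2 * tau)^-1) _ ir2);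
    apply: eq_integrable.
  move=> x _; rewrite -subr_ge0.
  have -> : tau / 2 * g x ^+ 2 + (2 * tau)^-1 * r x ^+ 2 - `|g x * r x| =
      (2 * tau)^-1 * (tau * `|g x| - `|r x|) ^+ 2.
    have sq (z : R) : z ^+ 2 = `|z| ^+ 2 by rewrite real_normK ?num_real.
    rewrite normrM (sq (g x)) (sq (r x)).
    by field; rewrite gt_eqF.
  by rewrite mulr_ge0 ?sqr_ge0// invr_ge0 mulr_ge0// ltW.
rewrite RintegralD//; [|exact: iZ|exact: iZ].
rewrite !RintegralZl//; apply: lerD => //.
have -> : c * h `^ (2 * s) / (2 * tau) * E = (2 * tau)^-1 * (c * h `^ (2 * s) * E).
  by field; rewrite gt_eqF.
rewrite ler_wpM2l ?invr_ge0 ?mulr_ge0 ?(ltW tau0)//.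
rewrite -lee_fin -fine_sq2 fineK ?ge0_fin_numE ?sq2_ge0//.
Qed.

End rellich.

(** The two terms cover the cases [t <= tau] and [tau < t]. Integrated over a set of finite measure
    with the best [tau], this stands in for Hoelder's inequality between two exponents. *)
Lemma powR_young {R : realType} (t tau a b : R) : 0 <= t -> 0 < tau ->
  0 < a -> a < b -> t `^ a <= tau `^ a + t `^ b * tau `^ (a - b).
Proof.
move=> t0 tau0 a0 ab; have [tt|tt] := leP t tau.
  apply: (@le_trans _ _ (tau `^ a)).
    by apply: ge0_ler_powR; rewrite ?nnegrE ?(ltW a0) ?(ltW tau0).
  by rewrite lerDl mulr_ge0// powR_ge0.
have t1 : 0 < t by exact: lt_trans tau0 tt.
apply: (@le_trans _ _ (t `^ b * tau `^ (a - b))); last by rewrite lerDr powR_ge0.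
have -> : t `^ a = t `^ b * t `^ (a - b) by rewrite -powRDx// addrC subrK.
rewrite ler_wpM2l ?powR_ge0//.
have -> : a - b = - (b - a) by ring.
rewrite !powRN lef_pV2 ?posrE ?powR_gt0//.
by apply: ge0_ler_powR; rewrite ?nnegrE ?subr_ge0 ?(ltW ab) ?(ltW tau0) ?(ltW t1) ?(ltW
  tt).
Qed.

Lemma Lnorm_le_powR dd (T : measurableType dd) (R : realType)
    (mu : {measure set T -> \bar R}) (f : T -> R) (q X : R) : 0 < q -> 0 <= X ->
  (\int[mu]_x (`|f x| `^ q)%:E <= X%:E)%E ->
  ('N[mu]_q%:E[EFin \o f] <= (X `^ q^-1)%:E)%E.
Proof.
move=> q0 X0 fX; rewrite unlock/= -poweR_EFin.
apply: gt0_ler_poweR; rewrite ?invr_ge0 ?(ltW q0)//.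
- rewrite in_itv/= leey andbT.
  by apply: integral_ge0 => x _; rewrite lee_fin powR_ge0.
- by rewrite in_itv/= leey andbT lee_fin.
Qed.

(** * Boundedness of solutions *)

Section stampacchia.
Context {dd} {T : measurableType dd} {R : realType}.
Context (mu : {sigma_finite_measure set T -> \bar R}) (w : T * T -> R).
Hypotheses (mw : measurable_fun setT w).
Context (n : nat) (s CS : R).
Hypotheses (n_gt0 : (0 < n)%N) (s_gt0 : 0 < s) (s_lt : 2 * s < n%:R).
Let p := 2 * n%:R / (n%:R - 2 * s).
Let p' := 2 * n%:R / (n%:R + 2 * s).
Notation mf v := (measurable_fun setT (v : T -> R)).
Notation energy := (nonlocal_energy mu w).
Implicit Types (f g u v : T -> R).
Hypotheses (CS_gt0 : 0 < CS).
Hypotheses (sob : forall v, mf v -> (sq2 mu v < +oo)%E -> (energy v < +oo)%E ->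
  (\int[mu]_x (`|v x| `^ p)%:E <= ((CS * fine (energy v)) `^ (p / 2))%:E)%E).

Let nR0 : 0 < n%:R :> R. Proof. by rewrite ltr0n. Qed.
Let nm0 : 0 < n%:R - 2 * s :> R. Proof. by rewrite subr_gt0. Qed.
Let np0 : 0 < n%:R + 2 * s :> R. Proof. by rewrite addr_gt0// mulr_gt0. Qed.
Let p0 : 0 < p. Proof. by rewrite divr_gt0// mulr_gt0. Qed.
Let p'0 : 0 < p'. Proof. by rewrite divr_gt0// mulr_gt0. Qed.

Lemma dual_exponents : p'^-1 + p^-1 = 1.
Proof. by rewrite /p /p'; field; rewrite !gt_eqF. Qed.

Lemma dual_bound f v (F : R) : mf f -> mf v -> (sq2 mu v < +oo)%E ->
  (energy v < +oo)%E -> (\int[mu]_x (`|f x| `^ p')%:E <= F%:E)%E ->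
  (\int[mu]_x `|f x * v x|%:E <=
     (F `^ p'^-1 * Num.sqrt (CS * fine (energy v)))%:E)%E.
Proof.
move=> mf' mv v2 Ev fF.
have F0 : 0 <= F.
  by rewrite -lee_fin (le_trans _ fF)// integral_ge0// => x _; rewrite lee_fin powR_ge0.
have := hoelder mu mf' mv p'0 p0 dual_exponents.
rewrite Lnorm1 => /le_trans; apply.
have E0 : 0 <= CS * fine (energy v) by rewrite mulr_ge0 ?(ltW CS_gt0)// fine_ge0//
  energy_ge0.
have -> : Num.sqrt (CS * fine (energy v)) = ((CS * fine (energy v)) `^ (p / 2)) `^ p^-1.
  by rewrite -powRrM -powR12_sqrt//; congr (_ `^ _); field; rewrite !gt_eqF.
rewrite [leRHS]EFinM; apply: lee_pmul;
  [exact: Lnorm_ge0|exact: Lnorm_ge0|exact: Lnorm_le_powR|].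
by apply: Lnorm_le_powR => //; [exact: powR_ge0|exact: sob].
Qed.

Lemma dual_integrable f v (F : R) : mf f -> mf v -> (sq2 mu v < +oo)%E ->
  (energy v < +oo)%E -> (\int[mu]_x (`|f x| `^ p')%:E <= F%:E)%E ->
  mu.-integrable setT (EFin \o (fun x => f x * v x)).
Proof.
move=> mf' mv v2 Ev fF; apply/integrableP; split.
  by apply/measurable_EFinP; exact: measurable_funM.
by apply: le_lt_trans (dual_bound mf' mv v2 Ev fF) _; rewrite ltry.
Qed.

Definition excess (k : R) v : T -> R := fun x => Num.max (v x - k) 0.

Lemma measurable_excess k v : mf v -> mf (excess k v).
Proof.
move=> mv; apply: measurable_maxr; last exact: measurable_cst.
by apply: measurable_funB => //; exact: measurable_cst.
Qed.

(** Let [phi k] be the measure of the set where [v > k]. Sobolev bounds [(h - k) ^ p * phi h] by a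
    power of the energy of [excess k v]; the energy inequality bounds this energy by the L^p' norm
    of [f] over that set; and [p' < r] turns this norm into a positive power of [phi k]. The result
    is the hypothesis of [de_giorgi] with exponent [p * (1/p' - 1/r)]. *)
Lemma stampacchia (kap r F A : R) : 0 < kap -> n%:R / (2 * s) < r -> 0 <= F -> 0 <= A ->
  exists2 M : R, 0 < M & forall S f v, measurable S -> (mu S <= A%:E)%E ->
    mf f -> (\int[mu]_x (`|f x| `^ r)%:E <= F%:E)%E -> mf v ->
    (forall x, ~ S x -> v x <= 0) ->
    (forall k, 0 <= k -> [/\ (sq2 mu (excess k v) < +oo)%E,
      (energy (excess k v) < +oo)%E &
      (kap%:E * energy (excess k v) <= \int[mu]_x `|f x * excess k v x|%:E)%E]) ->
    {ae mu, forall x, v x <= M}.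
Proof.
move=> kap0 rn F0 A0.
have s20 : 0 < 2 * s by rewrite mulr_gt0.
have r0 : 0 < r by apply: lt_trans rn; rewrite divr_gt0.
have rV : r^-1 < 2 * s / n%:R.
  rewrite -[X in _ < X]invrK ltf_pV2 ?posrE ?invr_gt0 ?divr_gt0//.
  by rewrite invf_div.
have p'V : p'^-1 = p^-1 + 2 * s / n%:R.
  by rewrite /p /p'; field; rewrite !gt_eqF.
have pV0 : 0 < p^-1 by rewrite invr_gt0.
have p'r : p' < r.
  rewrite -[p']invrK -[r]invrK ltf_pV2 ?posrE ?invr_gt0//.
  by rewrite p'V; lra.
pose b := p * (p'^-1 - r^-1).
(* [n / (2 * s) < r] is what makes De Giorgi's iteration superlinear. *)
have b1 : 1 < b.
  rewrite /b -(@ltr_pM2l _ p^-1)// mulr1 mulrA mulVf ?gt_eqF// mul1r p'V; lra.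
pose C := ((1 + F) `^ p'^-1 * CS / kap) `^ p.
have F1 : 0 < 1 + F by lra.
have C00 : 0 < (1 + F) `^ p'^-1 * CS / kap by rewrite divr_gt0 ?mulr_gt0 ?powR_gt0.
have C0 : 0 < C by rewrite powR_gt0.
have A1 : 0 < A + 1 by lra.
have [M M0 HM] := de_giorgi C0 p0 b1 A1.
exists M => // S f v mS muS mf' fF mv vS vk.
pose L k := S `&` [set x | k < v x].
have mL k : measurable (L k).
  apply: measurableI => //; rewrite -[X in measurable X]setTI.
  have -> : [set x | k < v x] = v @^-1` `]k, +oo[.
    by apply/seteqP; split=> y /=; rewrite in_itv/= andbT.
  exact: mv.
have Loo k : (mu (L k) <= A%:E)%E.
  by apply: le_trans muS; apply: le_measure; rewrite ?inE// => x [].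
have Lfin k : mu (L k) \is a fin_num.
  by rewrite ge0_fin_numE// (le_lt_trans (Loo k))// ltry.
pose phi k := fine (mu (L k)).
have : phi M = 0.
  apply: HM.
  - by move=> k; rewrite fine_ge0.
  - move=> k h kh; apply: fine_le => //; apply: le_measure; rewrite ?inE//.
    by move=> x [Sx /= hv]; split => //=; exact: le_lt_trans kh hv.
  - move=> k h k0 kh; have [v2 Ev le1] := vk k k0.
    have mex := measurable_excess k mv.
    set E := fine (energy (excess k v)).
    have E0 : 0 <= E by rewrite fine_ge0// energy_ge0.
    have Efin : energy (excess k v) \is a fin_num by rewrite ge0_fin_numE// energy_ge0.
    have exL x : 0 <= k -> ~ L k x -> excess k v x = 0.
      move=> _ nL; rewrite /excess; apply: max_r; rewrite subr_le0.
      have [Sx|Sx] := pselect (S x); last by apply: le_trans (vS _ Sx) k0.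
      by rewrite leNgt; apply/negP => kv; apply: nL; split.
    have le2 : (h - k) `^ p * phi h <= (CS * E) `^ (p / 2).
      rewrite -lee_fin; apply: le_trans (sob mex v2 Ev).
      rewrite EFinM /phi fineK// -integral_cst//.
      have mp : measurable_fun setT (fun x => (`|excess k v x| `^ p)%:E).
        apply/measurable_EFinP; apply: (measurableT_comp (measurable_powR _)).
        exact: measurableT_comp.
      apply: (@le_trans _ _ (\int[mu]_(x in L h) (`|excess k v x| `^ p)%:E)%E);
        last first.
        by apply: ge0_subset_integral => // x _; rewrite lee_fin powR_ge0.
      apply: ge0_le_integral => //.
      - by move=> x _; rewrite lee_fin powR_ge0.
      - exact: measurable_funTS.
      - move=> x [_ /= hv]; rewrite lee_fin; apply: ge0_ler_powR;
        rewrite ?nnegrE ?(ltW p0) ?subr_ge0 ?(ltW kh)//.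
        apply: le_trans (ler_norm _); rewrite /excess le_max lerD2r (ltW hv)//.
    (* A level set of measure 0 is treated apart, because [tau] below is a negative power of
       [phi k]. *)
    have [phi0|phi0] := eqVneq (phi k) 0.
      rewrite phi0 powR0 ?gt_eqF ?mulr0//; last by lra.
      have -> : phi h = 0; last by rewrite mulr0.
      apply/eqP; rewrite eq_le fine_ge0// andbT -[leRHS]phi0.
      apply: fine_le => //; apply: le_measure; rewrite ?inE// => x [Sx /= hv];
        split => //=.
      exact: lt_trans kh hv.
    have {}phi0 : 0 < phi k by rewrite lt_def phi0 fine_ge0.
    pose g x := f x * \1_(L k) x.
    have mg : mf g by apply: measurable_funM => //; exact: measurable_indic.
    have gE : (\int[mu]_x `|f x * excess k v x|%:E = \int[mu]_x `|g x * excess k v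
      x|%:E)%E.
      apply: eq_integral => x _; rewrite /g indicE; have [Lx|Lx] := pselect (L k x).
        by rewrite mem_set// mulr1.
      by rewrite (exL x k0 Lx) !mulr0.
    (* This choice gives both terms of [powR_young] the same scaling [phi k ^ (1 - p' / r)] after
       integration. *)
    pose tau := phi k `^ (- r^-1).
    have tau0 : 0 < tau by rewrite powR_gt0.
    have gF : (\int[mu]_x (`|g x| `^ p')%:E <= ((1 + F) * phi k `^ (1 - p' / r))%:E)%E.
      have mfr : measurable_fun setT (fun x => (`|f x| `^ r)%:E).
        apply/measurable_EFinP; apply: (measurableT_comp (measurable_powR _)).
        exact: measurableT_comp.
      apply: (@le_trans _ _ (\int[mu]_x ((tau `^ p')%:E * (\1_(L k) x)%:E +
          (tau `^ (p' - r))%:E * (`|f x| `^ r)%:E))%E).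
        apply: ge0_le_integral => //.
        - apply/measurable_EFinP; apply: (measurableT_comp (measurable_powR _)).
          exact: measurableT_comp.
        - apply: emeasurable_funD; apply: measurable_funeM => //.
          by apply/measurable_EFinP; exact: measurable_indic.
        - move=> x _; rewrite -!EFinM -EFinD lee_fin /g indicE.
          case: (x \in L k); rewrite ?mulr1 ?mulr0.
            by rewrite [X in _ + X]mulrC; exact: powR_young.
          by rewrite normr0 powR0 ?gt_eqF// add0r mulr_ge0// powR_ge0.
      rewrite ge0_integralD//; last 4 first.
      - by move=> x _; rewrite -EFinM lee_fin mulr_ge0// powR_ge0.
      - by apply: measurable_funeM; apply/measurable_EFinP; exact: measurable_indic.
      - by move=> x _; rewrite -EFinM lee_fin mulr_ge0// powR_ge0.
      - exact: measurable_funeM.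
      rewrite ge0_integralZl_EFin ?powR_ge0//; last first.
        by apply/measurable_EFinP; exact: measurable_indic.
      rewrite ge0_integralZl_EFin ?powR_ge0//.
      have -> : (\int[mu]_x (\1_(L k) x)%:E = (phi k)%:E)%E.
        rewrite integral_indic// setIT; exact/esym/fineK/Lfin.
      apply: (@le_trans _ _ ((tau `^ p')%:E * (phi k)%:E + (tau `^ (p' - r))%:E *
        F%:E)%E).
        by apply: leeD => //; apply: lee_wpmul2l => //; rewrite lee_fin powR_ge0.
      rewrite -!EFinM -EFinD lee_fin mulrDl mul1r le_eqVlt; apply/orP; left; apply/eqP.
      have e1 : tau `^ p' * phi k = phi k `^ (1 - p' / r).
        rewrite /tau -powRrM -[X in _ * X](powRr1 (ltW phi0)) -powRDx//.
        by congr (_ `^ _); ring.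
      have e2 : tau `^ (p' - r) = phi k `^ (1 - p' / r).
        rewrite /tau -powRrM; congr (_ `^ _); field.
        by rewrite gt_eqF.
      by rewrite e1 e2 [F * _]mulrC.
    set X := ((1 + F) * phi k `^ (1 - p' / r)) `^ p'^-1.
    have X0 : 0 <= X by exact: powR_ge0.
    have := dual_bound mg mex v2 Ev gF; rewrite -gE -/X -/E => le3.
    have le4 : kap * E <= X * Num.sqrt (CS * E).
      by rewrite -lee_fin EFinM /E fineK//; exact: le_trans le1 le3.
    have CE0 : 0 <= CS * E by rewrite mulr_ge0// ltW.
    have le5 : Num.sqrt (CS * E) <= X * CS / kap.
      rewrite ler_pdivlMr//; move: CE0; rewrite le_eqVlt => /orP[/eqP <-|CEp].
        by rewrite sqrtr0 mul0r mulr_ge0// ltW.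
      have q0 : 0 < Num.sqrt (CS * E) by rewrite sqrtr_gt0.
      rewrite -(ler_pM2l q0).
      have -> : Num.sqrt (CS * E) * (Num.sqrt (CS * E) * kap) = CS * (kap * E).
        by rewrite mulrA -expr2 sqr_sqrtr ?ltW//; ring.
      rewrite [leRHS](_ : _ = CS * (X * Num.sqrt (CS * E))); last by ring.
      by rewrite ler_wpM2l// ltW.
    apply: (le_trans le2).
    have -> : (CS * E) `^ (p / 2) = (Num.sqrt (CS * E)) `^ p.
      by rewrite -powR12_sqrt// -powRrM; congr (_ `^ _); rewrite mulrC.
    apply: (@le_trans _ _ ((X * CS / kap) `^ p)).
      apply: ge0_ler_powR; rewrite ?nnegrE ?(ltW p0) ?sqrtr_ge0//.
      by rewrite divr_ge0 ?mulr_ge0// ltW.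
    rewrite le_eqVlt; apply/orP; left; apply/eqP.
    have -> : X * CS / kap =
      ((1 + F) `^ p'^-1 * CS / kap) * phi k `^ ((1 - p' / r) / p').
      by rewrite /X powRM ?powR_ge0 ?(ltW F1)// powRrM; ring.
    rewrite /C powRM ?powR_ge0 ?(ltW C00)//; congr (_ * _).
    rewrite -powRrM; congr (_ `^ _); rewrite /b; field.
    by rewrite !gt_eqF.
  - rewrite -lee_fin /phi fineK//; apply: le_trans (Loo 0) _.
    by rewrite lee_fin; lra.
move=> phiM; exists (L M); split => //.
  by rewrite -(fineK (Lfin M)) -/(phi M) phiM.
move=> x /= /negP; rewrite -ltNge => Mv; split => //.
apply: contrapT => nS; have := vS x nS; lra.
Qed.

End stampacchia.

(** * The state equation *)

Section caratheodory_functions.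
Context {dd} {T : measurableType dd} {R : realType}.
Implicit Types (g : T -> R -> R) (u v : T -> R).
Notation mf v := (measurable_fun setT (v : T -> R)).

(** Rounding [t] down to a multiple of [1/(N+1)] makes [g] piecewise constant in [t], so preimages
    are countable unions of rectangles; continuity in [t] recovers [g] as a pointwise limit. *)
Lemma caratheodory_measurable g : (forall t, mf (g ^~ t)) ->
  (forall x, continuous (g x)) ->
  measurable_fun setT (fun p : T * R => g p.1 p.2).
Proof.
move=> mg cg.
pose tau (N : nat) (t : R) : R := (Num.floor (t * N.+1%:R))%:~R / N.+1%:R.
pose h (N : nat) (p : T * R) := g p.1 (tau N p.2).
apply: (@measurable_fun_cvg _ _ _ setT h).
  move=> N _ Y mY; rewrite setTI.
  have N0 : 0 < N.+1%:R :> R by rewrite ltr0n.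
  have -> : h N @^-1` Y = \bigcup_(z : int) ((g ^~ (z%:~R / N.+1%:R) @^-1` Y) `*`
      `[z%:~R / N.+1%:R, (z + 1)%:~R / N.+1%:R[).
    apply/seteqP; split => [[x t] Yh|[x t] [z _ [/= gY]]].
      exists (Num.floor (t * N.+1%:R)) => //; split => //=.
      rewrite in_itv/= ler_pdivrMr// ltr_pdivlMr//; exact: floor_itv.
    rewrite in_itv/= ler_pdivrMr// ltr_pdivlMr// => /floor_def zE.
    by rewrite /h /tau/= zE.
  apply: countable_bigcupT_measurable => // z.
  apply: measurableX => //.
  by rewrite -[X in measurable X]setTI; exact: mg.
move=> [x t] _; rewrite /h /=.
apply: (@continuous_cvg _ _ _ _ _ (tau ^~ t) (g x) t); first exact: cg.
apply/cvgrPdist_le => /= e e0.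
have := @cvg_harmonic R; move/cvgrPdist_le => /(_ _ e0); apply: filterS => N.
rewrite sub0r normrN => He; apply: le_trans He.
have N0 : 0 < N.+1%:R :> R by rewrite ltr0n.
rewrite /harmonic/= [leRHS]ger0_norm ?invr_ge0 ?(ltW N0)//.
have /andP[f1 f2] := floor_itv (t * N.+1%:R).
rewrite intrD mulr1z in f2.
rewrite -[leRHS]div1r ler_pdivlMr//.
have -> : `|t - tau N t| * N.+1%:R = `|t * N.+1%:R - (Num.floor (t * N.+1%:R))%:~R|.
  by rewrite -[X in _ * X](gtr0_norm N0) -normrM mulrBl /tau divfK ?gt_eqF.
rewrite ger0_norm; last by rewrite subr_ge0.
by rewrite lerBlDl ltW.
Qed.

Lemma caratheodory_comp g u : (forall t, mf (g ^~ t)) ->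
  (forall x, continuous (g x)) -> mf u -> mf (fun x => g x (u x)).
Proof.
move=> mg cg mu.
have := measurableT_comp (caratheodory_measurable mg cg)
  (measurable_fun_pair (@measurable_id _ T setT) mu).
by [].
Qed.

(* The antiderivative is only used through its subgradient inequality, which spares
   differentiating it. *)
Lemma caratheodory_potential g (m : R) : (forall t, mf (g ^~ t)) ->
  (forall x, continuous (g x)) -> (forall x, {homo g x : t t' / t <= t'}) ->
  (forall x t, t <= - m -> g x t = g x (- m)) ->
  exists Phi : T -> R -> R, [/\ forall x, Phi x 0 = 0,
    forall x (v w : R), Phi x w + g x w * (v - w) <= Phi x v &
    forall u, mf u -> mf (fun x => Phi x (u x))].
Proof.
move=> mg cg hg gm.
pose leb := @lebesgue_measure R.
(* [g x] is constant below [- m], so [h x] vanishes there and is nonnegative everywhere. Its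
   primitive can be taken from minus infinity as a nonnegative integral, and the linear term
   [g x (- m) * t] is added back in [Phi0]. *)
pose h x t := g x t - g x (- m).
have h0 x t : 0 <= h x t.
  rewrite subr_ge0; have [tm|tm] := leP t (- m); first by rewrite gm.
  exact: hg (ltW tm).
have hh x t t' : t <= t' -> h x t <= h x t' by move=> tt; rewrite lerD2r hg.
pose k x (t y : R) : R := if y <= t then h x y else 0.
have k0 x t y : 0 <= k x t y by rewrite /k; case: ifP.
have mh x : measurable_fun setT (h x).
  apply: measurable_funB; last exact: measurable_cst.
  exact: continuous_measurable_fun.
have mk x t : measurable_fun setT (k x t).
  apply: measurable_fun_ifT; [|exact: mh|exact: measurable_cst].
  by apply: measurable_fun_ler => //; exact: measurable_cst.
pose G x t : \bar R := (\int[leb]_y (k x t y)%:E)%E.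
have mEk x t : measurable_fun setT (fun y => (k x t y)%:E) by apply/measurable_EFinP.
have mind (a b : R) : measurable_fun setT (fun y : R => (\1_(`]a, b]%classic) y : R)).
  exact: measurable_indic.
have iI (a b c : R) : a <= b -> 0 <= c ->
    (\int[leb]_y (c * \1_(`]a, b]%classic) y)%:E = (c * (b - a))%:E)%E.
  move=> ab c0; under eq_integral do rewrite EFinM.
  rewrite ge0_integralZl_EFin//; last by apply/measurable_EFinP; exact: mind.
  have mI : leb `]a, b]%classic = (b - a)%:E.
    rewrite /leb lebesgue_measure_itv/= lte_fin; have [ba|ba] := ltP a b => //.
    have -> : a = b by apply/eqP; rewrite eq_le ab.
    by rewrite subrr.
  rewrite EFinM; congr (_ * _)%E; rewrite integral_indic// setIT; exact: mI.
(* [D1] and [D2] are the two halves of the subgradient inequality, written without a difference of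
   values of [G] while [G] is not yet known to be finite. *)
have D1 x (u v : R) : u <= v -> (G x u + (h x u * (v - u))%:E <= G x v)%E.
  move=> uv; rewrite -iI// /G -ge0_integralD//;
    try (by move=> y _; rewrite lee_fin ?mulr_ge0); try exact: mEk;
    try (by apply/measurable_EFinP; apply: measurable_funM).
  apply: ge0_le_integral => //.
  - by move=> y _; rewrite -EFinD lee_fin addr_ge0// mulr_ge0.
  - by apply: emeasurable_funD; [exact: mEk|apply/measurable_EFinP;
    apply: measurable_funM].
  - exact: mEk.
  - move=> y _; rewrite -EFinD lee_fin /k indicE.
    have [yu|uy] := leP y u.
      by rewrite (le_trans yu uv) memNset ?mulr0 ?addr0//= in_itv/= ltNge yu.
    have [yv|vy] := leP y v.
      by rewrite mem_set ?mulr1 ?add0r ?hh ?(ltW uy)//= in_itv/= uy.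
    by rewrite memNset ?mulr0 ?addr0//= in_itv/= leNgt vy andbF.
have D2 x (u v : R) : v <= u -> (G x u <= G x v + (h x u * (u - v))%:E)%E.
  move=> vu; rewrite -iI// /G -ge0_integralD//;
    try (by move=> y _; rewrite lee_fin ?mulr_ge0); try exact: mEk;
    try (by apply/measurable_EFinP; apply: measurable_funM).
  apply: ge0_le_integral => //.
  - by move=> y _; rewrite lee_fin.
  - exact: mEk.
  - by apply: emeasurable_funD; [exact: mEk|apply/measurable_EFinP;
    apply: measurable_funM].
  - move=> y _; rewrite -EFinD lee_fin /k indicE.
    have [yv|vy] := leP y v; first by rewrite (le_trans yv vu) lerDl mulr_ge0.
    have [yu|uy] := leP y u.
      by rewrite mem_set ?mulr1 ?add0r ?hh//= in_itv/= vy.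
    by rewrite add0r mulr_ge0.
have Gm x : G x (- m) = 0%E.
  rewrite /G -[RHS](@integral0 _ _ _ leb setT); apply: eq_integral => y _.
  by rewrite /k; case: ifPn => // ym; rewrite /h gm// subrr.
have Gfin x t : G x t \is a fin_num.
  rewrite ge0_fin_numE; last by apply: integral_ge0 => y _; rewrite lee_fin.
  have [tm|mt] := leP t (- m).
    apply: (@le_lt_trans _ _ 0%E); last exact: ltry.
    rewrite -(Gm x); have := D1 x _ _ tm.
    by apply: le_trans; rewrite leeDl// lee_fin mulr_ge0// subr_ge0.
  by apply: le_lt_trans (D2 x _ _ (ltW mt)) _; rewrite Gm add0e ltry.
pose Phi0 x t := g x (- m) * t + fine (G x t).
have sub x (v w : R) : Phi0 x w + g x w * (v - w) <= Phi0 x v.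
  have gE : g x w = h x w + g x (- m) by rewrite subrK.
  rewrite /Phi0 gE; have [wv|vw] := leP w v.
    have : fine (G x w) + h x w * (v - w) <= fine (G x v).
      by rewrite -lee_fin EFinD !fineK//; exact: D1.
    move: (g x (- m)) (h x w) (fine _) (fine _) => ? ? ? ?; lra.
  have : fine (G x w) <= fine (G x v) + h x w * (w - v).
    by rewrite -lee_fin EFinD !fineK//; apply: D2; exact: ltW.
  move: (g x (- m)) (h x w) (fine _) (fine _) => ? ? ? ?; lra.
have mPhi0 u : mf u -> mf (fun x => Phi0 x (u x)).
  move=> mu; apply: measurable_funD; first exact: measurable_funM.
  apply: (measurableT_comp (fine_measurable measurableT)) => //.
  pose f (p : T * R) : \bar R := (k p.1 (u p.1) p.2)%:E.
  have mfk : measurable_fun setT f.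
    apply/measurable_EFinP; apply: measurable_fun_ifT.
    - apply: measurable_fun_ler; first exact: measurable_snd.
      exact: (measurableT_comp mu measurable_fst).
    - apply: measurable_funB; first exact: caratheodory_measurable.
      exact: (measurableT_comp (mg (- m)) measurable_fst).
    - exact: measurable_cst.
  have f0 p : (0 <= f p)%E by rewrite lee_fin.
  exact: (@measurable_fun_fubini_tonelli_F _ _ _ _ _ leb f mfk f0).
exists (fun x t => Phi0 x t - Phi0 x 0); split.
- by move=> x; rewrite subrr.
- move=> x v w; have := sub x v w; move: (Phi0 x v) (Phi0 x w) (Phi0 x 0) => ? ? ?; lra.
- move=> u mu; apply: measurable_funB; first exact: mPhi0.
  by apply: (mPhi0 (cst 0)); exact: measurable_cst.
Qed.

End caratheodory_functions.

Section Rintegral_convergence.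
Context {dd} {T : measurableType dd} {R : realType}.
Context (mu : {measure set T -> \bar R}).
Implicit Types (f g : T -> R).

Lemma Rintegral_dominated_cvg (f_ : nat -> T -> R) f g :
  (forall k, measurable_fun setT (f_ k)) -> measurable_fun setT f ->
  mu.-integrable setT (EFin \o g) ->
  {ae mu, forall x, f_ ^~ x @ \oo --> f x} ->
  {ae mu, forall x, forall k, `|f_ k x| <= g x} ->
  (fun k => \int[mu]_x f_ k x) @ \oo --> \int[mu]_x f x.
Proof.
move=> mf_ mf ig cf bf.
have [|||||if1 _ cI] := @dominated_convergence _ T R mu setT measurableT
    (fun k => EFin \o f_ k) (EFin \o f) (EFin \o g).
- by move=> k; apply/measurable_EFinP.
- exact/measurable_EFinP.
- by apply: filterS cf => x cx _; apply: cvg_EFin => //; exact: nearW.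
- exact: ig.
- by apply: filterS bf => x bx k _ /=; rewrite lee_fin.
apply: fine_cvg; rewrite fineK; last exact: integrable_fin_num.
exact: cI.
Qed.

Lemma norm_Rintegral_le f (X : R) : measurable_fun setT f ->
  (\int[mu]_x `|f x|%:E <= X%:E)%E -> `|\int[mu]_x f x| <= X.
Proof.
move=> mf fX.
have If : mu.-integrable setT (EFin \o f).
  apply/integrableP; split; first exact/measurable_EFinP.
  by apply: le_lt_trans fX _; rewrite ltry.
apply: le_trans (le_normr_Rintegral _ _) _ => //.
by rewrite -lee_fin /Rintegral fineK//; exact: integrable_fin_num (integrable_norm If).
Qed.

Lemma norm_Rintegral_mul_le f g : measurable_fun setT f -> measurable_fun setT g ->
  (sq2 mu f < +oo)%E -> (sq2 mu g < +oo)%E ->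
  `|\int[mu]_x (f x * g x)| <= Num.sqrt (fine (sq2 mu f)) * Num.sqrt (fine (sq2 mu g)).
Proof.
move=> mf mg f2 g2; apply: norm_Rintegral_le; first exact: measurable_funM.
have h2 : 0 < 2 :> R by [].
have hh : 2^-1 + 2^-1 = 1 :> R by lra.
have := hoelder mu mf mg h2 h2 hh; rewrite Lnorm1 => /le_trans; apply.
have N2 h : measurable_fun setT h -> (sq2 mu h < +oo)%E ->
    ('N[mu]_2%:E[EFin \o h] <= (Num.sqrt (fine (sq2 mu h)))%:E)%E.
  move=> mh hoo; rewrite -powR12_sqrt ?fine_ge0 ?sq2_ge0//.
  apply: Lnorm_le_powR => //; first by rewrite fine_ge0// sq2_ge0.
  rewrite fineK; last by rewrite ge0_fin_numE// sq2_ge0.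
  rewrite le_eqVlt; apply/orP; left; apply/eqP; apply: eq_integral => x _.
  by rewrite powR_mulrn// real_normK ?num_real.
by rewrite EFinM; apply: lee_pmul;
  [exact: Lnorm_ge0|exact: Lnorm_ge0|exact: N2|exact: N2].
Qed.

End Rintegral_convergence.

(* What the existence proof uses of the space H^~s(Omega); [H] is the space. *)
Record energy_space {dd} {T : measurableType dd} {R : realType}
    (mu : {sigma_finite_measure set T -> \bar R}) (w : T * T -> R) (n : nat)
    (s CS CP : R) (Om : set T) (H : set (T -> R)) : Prop := EnergySpace {
  es_complete_measure : measure_is_complete mu;
  es_measurable_weight : measurable_fun setT w;
  es_dim_gt0 : (0 < n)%N;
  es_s_gt0 : 0 < s;
  es_s_lt : 2 * s < n%:R;
  es_CS_gt0 : 0 < CS;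
  es_CP_gt0 : 0 < CP;
  es_sobolev : forall v, measurable_fun setT v -> (sq2 mu v < +oo)%E ->
    (nonlocal_energy mu w v < +oo)%E ->
    (\int[mu]_x (`|v x| `^ (2 * n%:R / (n%:R - 2 * s)))%:E <=
     ((CS * fine (nonlocal_energy mu w v)) `^ (2 * n%:R / (n%:R - 2 * s) / 2))%:E)%E;
  es_measurable_domain : measurable Om;
  es_finite_domain : (mu Om < +oo)%E;
  es_measurable : forall v, H v -> measurable_fun setT v;
  es_lty : forall v, H v -> (Hs_sq mu w v < +oo)%E;
  es_0 : H (cst 0);
  es_D : forall u v, H u -> H v -> H (u \+ v)%R;
  es_Z : forall k v, H v -> H (fun x => k * v x);
  es_ae : forall u v, {ae mu, forall x, u x = v x} -> H u -> H v;
  es_supp : forall v, H v -> {ae mu, forall x, ~ Om x -> v x = 0};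
  es_excess : forall (k : R) v, 0 <= k -> H v -> H (excess k v);
  es_complete : forall u : nat -> T -> R, (forall n, H (u n)) ->
    (forall e : R, 0 < e -> exists N, forall m n, (N <= m)%N -> (m <= n)%N ->
      (Hs_sq mu w (u n \- u m)%R <= e%:E)%E) ->
    exists2 v, H v & forall e : R, 0 < e -> exists N, forall n,
      (N <= n)%N -> (Hs_sq mu w (u n \- v)%R <= e%:E)%E;
  es_poincare : forall v, H v -> (sq2 mu v <= CP%:E * nonlocal_energy mu w v)%E }.

(** * Minimisation of the truncated energy *)

Section variational.
Context {dd} {T : measurableType dd} {R : realType}.
Context (mu : {sigma_finite_measure set T -> \bar R}) (w : T * T -> R).
Context (n : nat) (s CS CP : R) (Om : set T) (H : set (T -> R)).
Hypothesis ES : energy_space mu w n s CS CP Om H.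
Let p' := 2 * n%:R / (n%:R + 2 * s).
Notation mu2 := (mu \x mu)%E.
Notation mf v := (measurable_fun setT (v : T -> R)).
Notation energy := (nonlocal_energy mu w).
Notation gd := (weighted_diff w).
Implicit Types (f u v z : T -> R).
Let mw := es_measurable_weight ES.
Let n_gt0 := es_dim_gt0 ES.
Let s_gt0 := es_s_gt0 ES.
Let s_lt := es_s_lt ES.
Let CS_gt0 := es_CS_gt0 ES.
Let CP_gt0 := es_CP_gt0 ES.
Let sob := es_sobolev ES.
Let H_mf := es_measurable ES.
Let H_lty := es_lty ES.
Let H0 := es_0 ES.
Let HD := es_D ES.
Let HZ := es_Z ES.
Let H_complete := es_complete ES.
Let H_poincare := es_poincare ES.

Lemma HB u v : H u -> H v -> H (u \- v).
Proof.
move=> hu hv; have -> : u \- v = u \+ (fun x => -1 * v x).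
  by apply/funext => x /=; rewrite mulN1r.
by apply: HD => //; exact: HZ.
Qed.

Lemma H_sq2 v : H v -> (sq2 mu v < +oo)%E.
Proof. by move=> /H_lty; apply: le_lt_trans; exact: sq2_le_hs2. Qed.

Lemma H_energy v : H v -> (energy v < +oo)%E.
Proof. by move=> /H_lty; exact: energy_lty. Qed.

Definition energy_form u v : R := \int[mu2]_p (gd u p * gd v p).
Notation eform := energy_form.

Definition energy_val v : R := fine (energy v).
Notation en := energy_val.

Lemma energy_en v : H v -> energy v = (en v)%:E.
Proof. by move=> hv; rewrite /en fineK// ge0_fin_numE ?energy_ge0 ?H_energy. Qed.

Lemma en_ge0 v : 0 <= en v.
Proof. by rewrite fine_ge0// energy_ge0. Qed.

Lemma eform_integrable u v : H u -> H v ->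
  mu2.-integrable setT (EFin \o (fun p => gd u p * gd v p)).
Proof.
move=> hu hv; apply: sq2_mul_integrable; [| |exact: H_energy|exact: H_energy];
  exact: measurable_gd (H_mf _).
Qed.

Lemma eform_sym u v : eform u v = eform v u.
Proof. by apply: eq_Rintegral => p _; rewrite mulrC. Qed.

Lemma eformD u v z : H u -> H v -> H z -> eform u (v \+ z) = eform u v + eform u z.
Proof.
move=> hu hv hz; rewrite /eform -RintegralD//;
  [|exact: eform_integrable|exact: eform_integrable].
by apply: eq_Rintegral => p _; rewrite gdD mulrDr.
Qed.

Lemma eformZ k u v : H u -> H v -> eform u (fun x => k * v x) = k * eform u v.
Proof.
move=> hu hv; rewrite /eform -RintegralZl//; last exact: eform_integrable.
by apply: eq_Rintegral => p _; rewrite gdZ mulrCA.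
Qed.

Lemma eformB u v z : H u -> H v -> H z -> eform u (v \- z) = eform u v - eform u z.
Proof.
move=> hu hv hz; rewrite -[X in _ + X]mulN1r -eformZ// -eformD//; last exact: HZ.
by congr eform; apply/funext => x /=; rewrite mulN1r.
Qed.

Lemma eform_en v : eform v v = en v.
Proof. by rewrite /en /energy fine_sq2; apply: eq_Rintegral => p _; rewrite expr2. Qed.

Lemma enD u z : H u -> H z -> en (u \+ z) = en u + 2 * eform u z + en z.
Proof.
move=> hu hz; have huz := HD hu hz.
rewrite -eform_en eformD// eform_sym eformD// [eform (_ \+ _) z]eform_sym eformD//.
rewrite !eform_en [eform z u]eform_sym; ring.
Qed.

Lemma enZ k v : H v -> en (fun x => k * v x) = k ^+ 2 * en v.
Proof.
move=> hv; have hkv := HZ k hv.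
by rewrite -eform_en eformZ// eform_sym eformZ// eform_en mulrA expr2.
Qed.

Lemma norm_eform_le u v : H u -> H v -> `|eform u v| <= Num.sqrt (en u) * Num.sqrt (en
  v).
Proof.
move=> hu hv; apply: norm_Rintegral_mul_le; [| |exact: H_energy|exact: H_energy];
  exact: measurable_gd (H_mf _).
Qed.

Lemma dual_le f v (F : R) : mf f -> H v -> (\int[mu]_x (`|f x| `^ p')%:E <= F%:E)%E ->
  mu.-integrable setT (EFin \o (fun x => f x * v x)) /\
  `|\int[mu]_x (f x * v x)| <= F `^ p'^-1 * Num.sqrt CS * Num.sqrt (en v).
Proof.
move=> mf' hv fF; have mv := H_mf hv; have v2 := H_sq2 hv; have Ev := H_energy hv;
  split.
  exact: (dual_integrable n_gt0 s_gt0 s_lt CS_gt0 sob mf' mv v2 Ev fF).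
apply: norm_Rintegral_le; first exact: measurable_funM.
rewrite -mulrA -sqrtrM ?(ltW CS_gt0)//.
exact: (dual_bound n_gt0 s_gt0 s_lt CS_gt0 sob mf' mv v2 Ev fF).
Qed.

(** The solution minimises [kap * en u + \int Phi x (u x)], where [Phi] is a primitive of [g].
    Domination by [phi] in L^p', the dual of the Sobolev exponent, makes the functional finite and
    bounded below on all of [H]. *)
Lemma monotone_variational (kap m F : R) (g : T -> R -> R) (phi : T -> R) : 0 < kap ->
  (forall t, mf (g ^~ t)) -> (forall x, continuous (g x)) ->
  (forall x, {homo g x : t t' / t <= t'}) ->
  (forall x t, t <= - m -> g x t = g x (- m)) ->
  mf phi -> (forall x t, `|g x t| <= phi x) ->
  (\int[mu]_x (`|phi x| `^ p')%:E <= F%:E)%E ->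
  exists2 u, H u & forall v, H v -> 2 * kap * eform u v + \int[mu]_x (g x (u x) * v x)
    = 0.
Proof.
move=> kap0 mg cg hg gm mphi gphi phiF.
have [Phi [Phi0 sub mPhi]] := caratheodory_potential mg cg hg gm.
have phi0 x : 0 <= phi x by apply: le_trans (gphi x 0).
have Phile x t : `|Phi x t| <= phi x * `|t|.
  have h1 := sub x t 0; have h2 := sub x 0 t.
  rewrite Phi0 in h1 h2; rewrite ler_norml; apply/andP; split.
    apply: le_trans h1; rewrite add0r subr0 -[leLHS]mulNr;
      apply: le_trans (_ : - (`|g x 0| * `|t|) <= _).
      by rewrite mulNr lerN2 ler_wpM2r.
    by rewrite -normrM lerNl -normrN; exact: ler_norm.
  have : Phi x t <= g x t * t by lra.
  move=> /le_trans; apply; apply: le_trans (ler_norm _) _.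
  by rewrite normrM ler_wpM2r.
have mgu u : mf u -> mf (fun x => g x (u x)) by move=> mu'; exact: caratheodory_comp.
have gF u : mf u -> (\int[mu]_x (`|g x (u x)| `^ p')%:E <= F%:E)%E.
  move=> mu'; apply: le_trans phiF; apply: ge0_le_integral => //.
  - apply/measurable_EFinP; apply: (measurableT_comp (measurable_powR _)).
    by apply: (measurableT_comp (@normr_measurable _ _)); exact: mgu.
  - apply/measurable_EFinP; apply: (measurableT_comp (measurable_powR _)).
    exact: measurableT_comp.
  - move=> x _; rewrite lee_fin; apply: ge0_ler_powR; rewrite ?nnegrE//.
      by rewrite divr_ge0// ?addr_ge0// mulr_ge0// ltW.
    by rewrite [leRHS]ger0_norm.
have gI u v : mf u -> H v -> mu.-integrable setT (EFin \o (fun x => g x (u x) * v x)).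
  by move=> mu' hv; have [] := dual_le (mgu _ mu') hv (gF _ mu').
have PhiI u : H u -> mu.-integrable setT (EFin \o (fun x => Phi x (u x))).
  move=> hu; have [iu _] := dual_le mphi hu phiF.
  apply: le_integrable iu => //.
    by apply/measurable_EFinP; apply: mPhi; exact: H_mf.
  move=> x _ /=; rewrite lee_fin; apply: le_trans (Phile _ _) _.
  by rewrite normrM ler_wpM2r// ler_norm.
pose E u := kap * en u + \int[mu]_x Phi x (u x).
pose l u z := 2 * kap * eform u z + \int[mu]_x (g x (u x) * z x).
(* The quadratic part is expanded exactly and [Phi] is bounded by its subgradient. Without the first
   term, [l y] is a subgradient of [E] at [y]; with it, the directions [z] and [- z] at a midpoint
   give the modulus of convexity [Emid]. *)
have Eexp y t : H y -> H t -> kap * en t + (E y + l y t) <= E (y \+ t).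
  move=> hy ht; rewrite /E /l enD//.
  have : \int[mu]_x Phi x (y x) + \int[mu]_x (g x (y x) * t x) <= \int[mu]_x Phi x ((y
    \+ t) x).
    rewrite -RintegralD//; [|exact: PhiI|exact: gI (H_mf hy) ht].
    apply: le_Rintegral => //; [|by apply: PhiI; exact: HD|].
      by have := integrableD measurableT (PhiI _ hy) (gI _ _ (H_mf hy) ht).
    move=> x _ /=; have := sub x (y x + t x) (y x).
    by rewrite addrAC subrr add0r.
  by move: (en t) (en y) (eform y t) (Rintegral _ _ _) (Rintegral _ _ _) (Rintegral _ _
    _) => ? ? ? ? ? ?; lra.
have Esub u z : H u -> H z -> E u + l u z <= E (u \+ z).
  move=> hu hz; apply: le_trans (Eexp _ _ hu hz).
  by rewrite lerDr mulr_ge0 ?en_ge0// ltW.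
have lle u z : H u -> H z -> `|l u z| <= (2 * kap * Num.sqrt (en u) + F `^ p'^-1 *
  Num.sqrt CS) * Num.sqrt (en z).
  move=> hu hz; have [_ h1] := dual_le (mgu _ (H_mf hu)) hz (gF _ (H_mf hu)).
  have h2 := norm_eform_le hu hz; rewrite /l [leRHS]mulrDl.
  apply: le_trans (ler_normD _ _) _; apply: lerD => //.
  by rewrite normrM gtr0_norm ?mulr_gt0// -[leRHS]mulrA ler_pM2l// mulr_gt0.
have hN v : H v -> H (fun x => - v x).
  by move=> hv; have := HZ (-1) hv; under eq_fun do rewrite mulN1r.
have E0 : E (cst 0) = 0.
  rewrite /E (_ : en _ = 0); last first.
    by have := enZ 0 H0; rewrite expr0n mul0r /=; under eq_fun do rewrite mul0r.
  rewrite mulr0 add0r (@eq_Rintegral _ _ _ mu setT (cst 0)) ?Rintegral_cst ?mul0r//.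
pose X := F `^ p'^-1 * Num.sqrt CS.
have X0 : 0 <= X by rewrite mulr_ge0 ?powR_ge0 ?sqrtr_ge0.
have Elb u : H u -> - (X ^+ 2 / kap) <= E u.
  move=> hu; have [_ h1] := dual_le mphi hu phiF.
  have h2 : - (X * Num.sqrt (en u)) <= \int[mu]_x Phi x (u x).
    rewrite lerNl; apply: le_trans (ler_norm _) _; rewrite normrN;
      apply: norm_Rintegral_le.
      by apply: mPhi; exact: H_mf.
    apply: (@le_trans _ _ (\int[mu]_x `|phi x * u x|%:E)%E); last first.
      rewrite /X -mulrA -sqrtrM ?(ltW CS_gt0)//.
      exact: (dual_bound n_gt0 s_gt0 s_lt CS_gt0 sob mphi (H_mf hu) (H_sq2 hu)
        (H_energy hu) phiF).
    apply: ge0_le_integral => //.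
    - by apply/measurable_EFinP; apply: (measurableT_comp (@normr_measurable _ _));
      apply: mPhi; exact: H_mf.
    - apply/measurable_EFinP; apply: (measurableT_comp (@normr_measurable _ _)).
      by apply: measurable_funM => //; exact: H_mf.
    - by move=> x _; rewrite lee_fin normrM [in leRHS](ger0_norm (phi0 x));
      exact: Phile.
  rewrite /E; have h3 := sqr_sqrtr (en_ge0 u); rewrite -h3.
  move: (Num.sqrt (en u)) (Rintegral _ _ _) h2 => y I h2.
  (* The quadratic energy dominates the linear lower bound of the potential, by completing the
     square. *)
  suff : X * y <= kap * y ^+ 2 + X ^+ 2 / kap by lra.
  have h4 := sqr_ge0 (kap * y - X / 2); have h5 : 0 <= X ^+ 2 by rewrite sqr_ge0.
  rewrite -(ler_pM2l kap0) mulrDr [kap * (_ / _)]mulrC divfK ?gt_eqF//.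
  nra.
have Emid u v : H u -> H v -> E (midpt u v) + kap / 4 * en (u \- v) <= (E u + E v) / 2.
  move=> hu hv; pose c := midpt u v; pose z : T -> R := fun x => 2^-1 * (u \- v) x.
  have huv := HB hu hv.
  have hz : H z by apply: HZ.
  have hc : H c by rewrite /c /midpt; apply: (HZ 2^-1 (HD hu hv)).
  have -> : en (u \- v) = 4 * en z by rewrite /z enZ// exprVn; field.
  have := Eexp _ _ hc hz; have := Eexp _ _ hc (hN _ hz).
  have -> : c \+ z = u by apply/funext => x; rewrite /c /z /midpt/=; field.
  have -> : c \+ (fun x => - z x) = v by apply/funext => x; rewrite /c /z /midpt/=;
    field.
  have -> : en (fun x => - z x) = en z.
    have := enZ (-1) hz; rewrite sqrrN expr1n mul1r => <-; congr en.
    by apply/funext => x; rewrite mulN1r.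
  have -> : l c (fun x => - z x) = - l c z.
    rewrite /l; have := eformZ (-1) hc hz; under eq_fun do rewrite mulN1r.
    move=> ->; rewrite (@eq_Rintegral _ _ _ mu setT (fun x => -1 * (g x (c x) * z x)));
      last first.
      by move=> x _; rewrite mulN1r mulrN.
    by rewrite RintegralZl//; [ring|exact: gI (H_mf hc) hz].
  move: (en z) (E c) (E u) (E v) (l c z) => ? ? ? ? ?; lra.
have Eub (k : nat) : exists2 u, H u & E u <= 0 by exists (cst 0); rewrite ?E0.
have [q [Hq qmin qC]] := @minimizing_cauchy R _ midpt (fun u v => kap / 4 * en (u \-
  v)) E
   (fun=> H) (- (X ^+ 2 / kap)) 0 (fun _ v hv => hv) (fun _ u v hu hv => HZ 2^-1 (HD hu
     hv))
   Elb Eub Emid.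
have [||u hu qu] := H_complete (u := q) => //.
  move=> e e0; have c0 : 0 < kap / 4 / (CP + 1) * e.
    by rewrite mulr_gt0// divr_gt0 ?divr_gt0// addr_gt0.
  have [N HN] := qC _ c0; exists N => i j Ni ij.
  have hij := HB (Hq j) (Hq i).
  have hji := HB (Hq i) (Hq j).
  apply: (@le_trans _ _ (((CP + 1) * en (q j \- q i))%:E)).
    rewrite /Hs_sq mulrDl mul1r EFinD -energy_en// EFinM -energy_en//.
    by apply: leeD => //; exact: H_poincare.
  rewrite lee_fin; have := HN _ _ Ni ij.
  have -> : en (q i \- q j) = en (q j \- q i).
    have := enZ (-1) hij; rewrite sqrrN expr1n mul1r => <-; congr en.
    by apply/funext => x /=; rewrite mulN1r opprB.
  have CP1 : 0 < CP + 1 by rewrite addr_gt0.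
  have k4 : 0 < kap / 4 by rewrite divr_gt0.
  have -> : kap / 4 / (CP + 1) * e = kap / 4 * ((CP + 1)^-1 * e) by rewrite mulrA.
  by rewrite (ler_pM2l k4) ler_pdivlMl.
(* The subgradient at [u] is a functional of norm at most [Y], so [E (q k)] falls below [E u] by at
   most [Y] times the distance. Within distance [d] this is at most half of the supposed gap, which
   contradicts near-minimality of [q k]. *)
have umin v : H v -> E u <= E v.
  move=> hv; rewrite leNgt; apply/negP => lt.
  pose Y := 2 * kap * Num.sqrt (en u) + X.
  have Y0 : 0 <= Y by rewrite addr_ge0// mulr_ge0 ?sqrtr_ge0// mulr_ge0// ltW.
  pose d := (E u - E v) / 2 / (Y + 1).
  have Y1 : 0 < Y + 1 by rewrite ltr_wpDl.
  have d0 : 0 < d by rewrite divr_gt0// divr_gt0// subr_gt0.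
  have [N HN] := qu _ (exprn_gt0 2 d0).
  have [M _ HM] : \forall k \near \oo, k.+1%:R^-1 < (E u - E v) / 2 :> R.
    have e2 : 0 < (E u - E v) / 2 by rewrite divr_gt0// subr_gt0.
    have := @cvg_harmonic R; move/cvgrPdist_lt/(_ _ e2); apply: filterS => k.
    by rewrite sub0r normrN; apply: le_lt_trans; exact: ler_norm.
  pose k := maxn N M.
  have hz := HB (Hq k) hu.
  have := Esub _ _ hu hz.
  have -> : u \+ (q k \- u) = q k by apply/funext => x /=; rewrite subrKC.
  have ed : Num.sqrt (en (q k \- u)) <= d.
    rewrite -[d in leRHS](ger0_norm (ltW d0)) -sqrtr_sqr ler_sqrt ?exprn_ge0 ?(ltW
      d0)//.
    rewrite -lee_fin -energy_en//; apply: le_trans (energy_le_hs2 _ _ _) _.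
    by apply: HN; exact: leq_maxl.
  have := lle _ _ hu hz; rewrite -/X -/Y ler_norml => /andP[l1 _].
  have l2 : Y * Num.sqrt (en (q k \- u)) <= (E u - E v) / 2.
    apply: (@le_trans _ _ ((Y + 1) * d)).
      by apply: ler_pM => //; lra.
    by rewrite /d mulrC divfK// gt_eqF.
  have := HM k (leq_maxr _ _); rewrite /=.
  have := qmin k v hv; move: l1 l2;
    move: (k.+1%:R^-1) (Y * _) (E u) (E v) (E (q k)) (l _ _) => ? ? ? ? ? ?; lra.
(* The subgradient is taken at [u + t v] and tested backwards towards the minimiser. This gives the
   sign of [l (u + t v) v], and [t -> 0] uses only the continuity of [g x] and dominated
   convergence, so [E] is never differentiated. *)
have lge0 v : H v -> 0 <= l u v.
  move=> hv; pose t k : R := k.+1%:R^-1.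
  have t0 k : 0 < t k by rewrite invr_gt0.
  pose z k : T -> R := fun x => t k * v x.
  have hz k : H (z k) by exact: HZ.
  have huz k : H (u \+ z k) by exact: HD.
  have step k : 0 <= 2 * kap * (eform u v + t k * en v) + \int[mu]_x (g x ((u \+ z k)
    x) * v x).
    have h1 := umin _ (huz k); have := Esub _ _ (huz k) (hN _ (hz k)).
    have -> : (u \+ z k) \+ (fun x => - z k x) = u by apply/funext => x /=;
      rewrite addrK.
    have -> : l (u \+ z k) (fun x => - z k x) = - t k * (2 * kap * (eform u v + t k *
      en v) + \int[mu]_x (g x ((u \+ z k) x) * v x)).
      rewrite /l (_ : (fun x => - z k x) = (fun x => - t k * v x)); last first.
        by apply/funext => x; rewrite mulNr.
      rewrite eformZ// eform_sym eformD// eformZ// eform_en [eform v u]eform_sym.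
      rewrite (@eq_Rintegral _ _ _ mu setT (fun x => - t k * (g x ((u \+ z k) x) * v
        x))); last first.
        by move=> x _; rewrite /z; ring.
      rewrite RintegralZl//; [|exact: gI (H_mf (huz k)) hv].
      ring.
    rewrite mulNr => h2; rewrite -(pmulr_rge0 _ (t0 k)).
    by move: (t k * (2 * kap * _ + _)) (E _) (E _) h1 h2 => ? ? ?; lra.
  have c1 : t @ \oo --> (0 : R) by exact: cvg_harmonic.
  have c2 : (fun k => \int[mu]_x (g x ((u \+ z k) x) * v x)) @ \oo --> \int[mu]_x (g x
    (u x) * v x).
    have [iv _] := dual_le mphi hv phiF.
    apply: (Rintegral_dominated_cvg _ _ (integrable_norm iv)).
    - by move=> k; apply: measurable_funM; [exact: mgu (H_mf (huz k))|exact: H_mf].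
    - by apply: measurable_funM; [exact: mgu (H_mf hu)|exact: H_mf].
    - apply: nearW => x; apply: cvgM; last exact: cvg_cst.
      apply: (@continuous_cvg _ _ _ _ _ (fun k => (u \+ z k) x) (g x) (u x));
        first exact: cg.
      rewrite -[X in _ --> X]addr0; apply: cvgD; first exact: cvg_cst.
      by rewrite -[X in _ --> X](mul0r (v x)); apply: cvgM => //; exact: cvg_cst.
    - apply: nearW => x k /=; rewrite !normrM ler_wpM2r//.
      by apply: le_trans (gphi _ _) _; exact: ler_norm.
  have c3 : (fun k => 2 * kap * (eform u v + t k * en v) + \int[mu]_x (g x ((u \+ z k)
    x) * v x)) @ \oo --> l u v.
    rewrite /l -[eform u v in X in _ --> X]addr0 -[X in eform u v + X](mul0r (en v)).
    apply: cvgD => //; apply: cvgM; first exact: cvg_cst.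
    apply: cvgD; first exact: cvg_cst.
    by apply: cvgM => //; exact: cvg_cst.
  rewrite -(cvg_lim _ c3)//; apply: limr_ge; last exact: nearW.
  by apply/cvg_ex; exists (l u v).
exists u => // v hv; apply/eqP; rewrite eq_le lge0// andbT.
have := lge0 _ (hN _ hv).
have -> : l u (fun x => - v x) = - l u v.
  rewrite /l; have := eformZ (-1) hu hv; under eq_fun do rewrite mulN1r.
  move=> ->; rewrite (@eq_Rintegral _ _ _ mu setT (fun x => -1 * (g x (u x) * v x)));
    last first.
    by move=> x _; rewrite mulN1r mulrN.
  by rewrite RintegralZl//; [ring|exact: gI (H_mf hu) hv].
by rewrite oppr_ge0.
Qed.

End variational.

Section ae_Rintegral.
Context {dd} {T : measurableType dd} {R : realType}.
Context (mu : {measure set T -> \bar R}).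
Implicit Types (f g : T -> R).
Notation mf v := (measurable_fun setT (v : T -> R)).

Lemma ae_integrable f g : mf f -> mf g -> {ae mu, forall x, f x = g x} ->
  mu.-integrable setT (EFin \o f) -> mu.-integrable setT (EFin \o g).
Proof.
move=> mf' mg fg /integrableP[_ fi]; apply/integrableP; split;
  first exact/measurable_EFinP.
rewrite (@ae_eq_integral _ _ _ mu setT (abse \o (EFin \o f)))//.
- by apply: measurableT_comp => //; exact/measurable_EFinP.
- by apply: measurableT_comp => //; exact/measurable_EFinP.
- by apply: filterS fg => x /= -> _.
Qed.

Lemma ae_Rintegral f g : mf f -> mf g -> {ae mu, forall x, f x = g x} ->
  \int[mu]_x f x = \int[mu]_x g x.
Proof.
move=> mf' mg fg; congr fine; apply: ae_eq_integral => //; try exact/measurable_EFinP.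
by apply: filterS fg => x /= -> _.
Qed.

Lemma ae_le_Rintegral f g : mu.-integrable setT (EFin \o f) ->
  mu.-integrable setT (EFin \o g) -> {ae mu, forall x, f x <= g x} ->
  \int[mu]_x f x <= \int[mu]_x g x.
Proof.
move=> If Ig fg; rewrite -subr_ge0 -RintegralB//.
have mf' : mf f by apply/measurable_EFinP; exact: measurable_int If.
have mg : mf g by apply/measurable_EFinP; exact: measurable_int Ig.
rewrite (@ae_Rintegral _ (fun x => Num.max (g x - f x) 0)).
- by apply: Rintegral_ge0 => x _; rewrite le_max lexx orbT.
- exact: measurable_funB.
- apply: measurable_maxr; last exact: measurable_cst.
  exact: measurable_funB.
- by apply: filterS fg => x fg; rewrite max_l// subr_ge0.
Qed.

Lemma powR_normD_le (p x y : R) : 0 < p ->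
  `|x + y| `^ p <= 2 `^ p * (`|x| `^ p + `|y| `^ p).
Proof.
move=> p0; have pp := powR_ge0.
have h (a b : R) : `|a| <= `|b| -> `|a + b| `^ p <= 2 `^ p * (`|a| `^ p + `|b| `^ p).
  move=> ab; apply: (@le_trans _ _ (2 `^ p * `|b| `^ p)).
    rewrite -powRM//; apply: ge0_ler_powR; rewrite ?nnegrE ?mulr_ge0 ?(ltW p0)//.
    by apply: le_trans (ler_normD _ _) _; lra.
  by rewrite ler_wpM2l// lerDr.
have [xy|yx] := leP `|x| `|y|; first exact: h.
by rewrite addrC [X in _ * X]addrC; apply: h; exact: ltW.
Qed.

Lemma measurable_powR_norm p f : mf f -> measurable_fun setT (fun x => (`|f x| `^
  p)%:E).
Proof.
move=> mf'; apply/measurable_EFinP; apply: (measurableT_comp (measurable_powR _)).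
exact: measurableT_comp.
Qed.

Lemma integral_powR_normD_le (p F G : R) f g : 0 < p -> mf f -> mf g ->
  (\int[mu]_x (`|f x| `^ p)%:E <= F%:E)%E -> (\int[mu]_x (`|g x| `^ p)%:E <= G%:E)%E ->
  (\int[mu]_x (`|f x + g x| `^ p)%:E <= (2 `^ p * (F + G))%:E)%E.
Proof.
move=> p0 mf' mg fF gG.
have mp := @measurable_powR_norm p.
apply: (@le_trans _ _ (\int[mu]_x ((2 `^ p)%:E * ((`|f x| `^ p)%:E + (`|g x| `^
  p)%:E)))%E).
  apply: ge0_le_integral => //.
  - by apply: mp; exact: measurable_funD.
  - by apply: measurable_funeM; apply: emeasurable_funD; exact: mp.
  - by move=> x _; rewrite -EFinD -EFinM lee_fin powR_normD_le.
rewrite ge0_integralZl_EFin ?powR_ge0//; last first.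
- by apply: emeasurable_funD; exact: mp.
- by move=> x _; rewrite -EFinD lee_fin addr_ge0// powR_ge0.
rewrite ge0_integralD//; [|exact: mp|exact: mp].
rewrite EFinM; apply: lee_wpmul2l; first by rewrite lee_fin powR_ge0.
by rewrite EFinD; exact: leeD.
Qed.

Lemma integral_powR_bounded_le (p Q A : R) (S : set T) f : 0 < p -> mf f ->
  measurable S -> (mu S <= A%:E)%E -> (forall x, ~ S x -> f x = 0) ->
  (forall x, `|f x| <= Q) -> (\int[mu]_x (`|f x| `^ p)%:E <= (Q `^ p * A)%:E)%E.
Proof.
move=> p0 mf' mS SA f0 fQ.
apply: (@le_trans _ _ (\int[mu]_x ((Q `^ p)%:E * (\1_S x)%:E))%E).
  apply: ge0_le_integral => //.
  - exact: measurable_powR_norm.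
  - by apply: measurable_funeM; apply/measurable_EFinP; exact: measurable_indic.
  - move=> x _; rewrite -EFinM lee_fin indicE; have [Sx|Sx] := pselect (S x).
      rewrite mem_set// mulr1; apply: ge0_ler_powR; rewrite ?nnegrE ?(ltW p0)//.
      exact: le_trans (fQ x).
    by rewrite memNset// mulr0 f0// normr0 powR0// gt_eqF.
rewrite ge0_integralZl_EFin ?powR_ge0//; last first.
  by apply/measurable_EFinP; exact: measurable_indic.
rewrite integral_indic// setIT EFinM; apply: lee_wpmul2l => //.
by rewrite lee_fin powR_ge0.
Qed.

End ae_Rintegral.

(** * Uniform bounds and solvability of the state equation *)

Section state.
Context {dd} {T : measurableType dd} {R : realType}.
Context (mu : {sigma_finite_measure set T -> \bar R}) (w : T * T -> R).
Context (n : nat) (s CS CP : R) (Om : set T) (H : set (T -> R)).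
Hypothesis ES : energy_space mu w n s CS CP Om H.
Let p' := 2 * n%:R / (n%:R + 2 * s).
Notation mf v := (measurable_fun setT (v : T -> R)).
Notation eform := (energy_form mu w).
Notation en := (energy_val mu w).
Implicit Types (f h u v z : T -> R).
Let mw := es_measurable_weight ES.
Let H_mf := es_measurable ES.

(** The factor 2 makes the left-hand side the derivative of [kap * en]; for [kap] equal to a quarter
    of the normalising constant it is the fractional bilinear form. *)
Definition solves_weakly (kap : R) u h := forall v, H v ->
  mu.-integrable setT (EFin \o (fun x => h x * v x)) /\
  2 * kap * eform u v = \int[mu]_x (h x * v x).

Notation solves := solves_weakly.

Lemma HN v : H v -> H (fun x => - v x).
Proof. by move=> hv; have := es_Z ES (-1) hv; under eq_fun do rewrite mulN1r. Qed.

Lemma solvesN kap u h : H u -> solves kap u h ->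
  solves kap (fun x => - u x) (fun x => - h x).
Proof.
move=> hu uh v hv; have [Ih e] := uh _ (HN hv); split.
  by have := Ih; rewrite (_ : (fun x => h x * - v x) = (fun x => - h x * v x))//;
    apply/funext => x; rewrite mulrN mulNr.
rewrite (eform_sym _ _ (fun x => - u x)).
have := eformZ ES (-1) hv hu; under eq_fun do rewrite mulN1r.
move=> ->; rewrite (eform_sym _ _ v).
have := eformZ ES (-1) hu hv; under eq_fun do rewrite mulN1r.
move=> <-; rewrite e; apply: eq_Rintegral => x _; ring.
Qed.

Lemma solves_ae kap u h h' : mf h -> mf h' -> {ae mu, forall x, h x = h' x} ->
  solves kap u h -> solves kap u h'.
Proof.
move=> mh mh' hh uh v hv; have [Ih e] := uh _ hv; have mv := H_mf hv.
have hv' : {ae mu, forall x, h x * v x = h' x * v x} by apply: filterS hh => x ->.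
split; first by apply: ae_integrable hv' Ih; exact: measurable_funM.
by rewrite e; apply: ae_Rintegral hv'; exact: measurable_funM.
Qed.

(** Pointwise under the integral: the positive part is monotone and 1-Lipschitz, so the product of
    an increment with the increment of the positive part is at least the square of the latter. *)
Lemma en_excess_le k u : 0 <= k -> H u -> en (excess k u) <= eform u (excess k u).
Proof.
move=> k0 hu; have he := es_excess ES k0 hu.
rewrite -(eform_en mu w (excess k u)); apply: le_Rintegral => //.
- exact: (eform_integrable ES).
- exact: (eform_integrable ES).
move=> [x y] _; rewrite /weighted_diff/= /excess.
have -> : (Num.max (u x - k) 0 - Num.max (u y - k) 0) * w (x, y) *
   ((Num.max (u x - k) 0 - Num.max (u y - k) 0) * w (x, y)) =
   w (x, y) ^+ 2 * ((Num.max (u x - k) 0 - Num.max (u y - k) 0) *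
    (Num.max (u x - k) 0 - Num.max (u y - k) 0)) by ring.
have -> : (u x - u y) * w (x, y) * ((Num.max (u x - k) 0 - Num.max (u y - k) 0) * w (x,
  y)) =
   w (x, y) ^+ 2 * ((u x - u y) * (Num.max (u x - k) 0 - Num.max (u y - k) 0)) by ring.
apply: ler_wpM2l; first exact: sqr_ge0.
move: (u x) (u y) => a b.
have [ha|ha] := leP (a - k) 0; have [hb|hb] := leP (b - k) 0; nra.
Qed.

(** The equation is tested with [excess k u], which is positive only where [u > 0]; hence [h <= f]
    is needed only there. This one-sided condition lets monotonicity replace the unknown [a x (u x)]
    by [a x 0]. *)
Lemma solution_upper_bound (kap r F : R) : 0 < kap -> n%:R / (2 * s) < r -> 0 <= F ->
  exists2 M : R, 0 < M & forall u f h, H u -> solves kap u h -> mf f ->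
    (\int[mu]_x (`|f x| `^ r)%:E <= F%:E)%E ->
    {ae mu, forall x, 0 < u x -> h x <= f x} ->
    {ae mu, forall x, u x <= M}.
Proof.
move=> kap0 rn F0; have k20 : 0 < 2 * kap by rewrite mulr_gt0.
have mOm := es_measurable_domain ES.
have Omfin : mu Om \is a fin_num by rewrite ge0_fin_numE//; exact: es_finite_domain ES.
have A0 : 0 <= fine (mu Om) by rewrite fine_ge0.
have [M M0 HM] := stampacchia (es_dim_gt0 ES) (es_s_gt0 ES) (es_s_lt ES)
  (es_CS_gt0 ES) (es_sobolev ES) k20 rn F0 A0.
exists M => // u f h hu uh mf' fF hf.
have mu' := H_mf hu.
(* Elements of [H] vanish off [Om] only almost everywhere, whereas [stampacchia] asks for a sign at
   every such point. *)
pose u' : T -> R := fun x => u x * \1_Om x.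
have uu : {ae mu, forall x, u x = u' x}.
  apply: filterS (es_supp ES hu) => x ux; rewrite /u' indicE.
  have [Ox|Ox] := pselect (Om x); first by rewrite mem_set// mulr1.
  by rewrite ux// mul0r.
have hu' := es_ae ES uu hu.
suff : {ae mu, forall x, u' x <= M} by apply: filterS2 uu => x ->.
apply: (HM Om f) => //.
- by rewrite fineK.
- exact: H_mf.
- by move=> x Ox; rewrite /u' indicE memNset// mulr0.
move=> k k0; have he' := es_excess ES k0 hu'; have he := es_excess ES k0 hu.
split; [exact: (H_sq2 ES)|exact: (H_energy ES)|].
have ee : {ae mu, forall x, excess k u x = excess k u' x}.
  by apply: filterS uu => x e; rewrite /excess e.
have me := H_mf he; have me' := H_mf he'.
rewrite -(ae_energy mw me me' ee).
have -> : (\int[mu]_x `|f x * excess k u' x|%:E = \int[mu]_x `|f x * excess k u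
  x|%:E)%E.
  apply: ae_eq_integral => //.
  - apply/measurable_EFinP; apply: (measurableT_comp (@normr_measurable _ _)).
    exact: measurable_funM.
  - apply/measurable_EFinP; apply: (measurableT_comp (@normr_measurable _ _)).
    exact: measurable_funM.
  - by apply: filterS ee => x ->.
rewrite (energy_en ES he) -EFinM.
have [Ih e] := uh _ he.
have [oo|foo] := eqVneq (\int[mu]_x `|f x * excess k u x|%:E)%E +oo%E.
  by rewrite oo leey.
have If : mu.-integrable setT (EFin \o (fun x => `|f x * excess k u x|)).
  apply/integrableP; split.
    apply/measurable_EFinP; apply: (measurableT_comp (@normr_measurable _ _)).
    exact: measurable_funM.
  rewrite (_ : (\int[mu]_x _)%E = \int[mu]_x `|f x * excess k u x|%:E)%E ?ltey//.
  by apply: eq_integral => x _; rewrite /= normr_id.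
rewrite -[leRHS]fineK; last exact: integrable_fin_num If.
rewrite lee_fin; apply: (@le_trans _ _ (2 * kap * eform u (excess k u))).
  by rewrite ler_pM2l// en_excess_le.
rewrite e; apply: ae_le_Rintegral => //.
apply: filterS hf => x hx.
apply: le_trans (_ : f x * excess k u x <= _); last exact: ler_norm.
rewrite /excess; have [ux|ux] := leP (u x - k) 0; first by rewrite !mulr0.
rewrite ler_pM2r// hx//; lra.
Qed.

Lemma solution_bound (kap r F : R) : 0 < kap -> n%:R / (2 * s) < r -> 0 <= F ->
  exists2 M : R, 0 < M & forall u f h, H u -> solves kap u h -> mf f ->
    (\int[mu]_x (`|f x| `^ r)%:E <= F%:E)%E ->
    {ae mu, forall x, 0 < u x -> h x <= f x} ->
    {ae mu, forall x, u x < 0 -> f x <= h x} ->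
    {ae mu, forall x, `|u x| <= M}.
Proof.
move=> kap0 rn F0; have [M M0 HM] := solution_upper_bound kap0 rn F0.
exists M => // u f h hu uh mf' fF h1 h2.
have b1 := HM _ _ _ hu uh mf' fF h1.
have b2 : {ae mu, forall x, - u x <= M}.
  apply: (HM _ (fun x => - f x) (fun x => - h x)).
  - exact: HN.
  - exact: solvesN.
  - exact: measurableT_comp.
  - by under eq_integral do rewrite normrN.
  - by apply: filterS h2 => x hx; rewrite oppr_gt0 lerN2.
by apply: filterS2 b1 b2 => x; rewrite ler_norml lerNl => -> ->.
Qed.

Section nonlinear_state.
Context (a : T -> R -> R) (kap r : R).
Hypotheses (kap0 : 0 < kap) (rn : n%:R / (2 * s) < r).
Hypotheses (ma : forall t, mf (a ^~ t)) (ca : forall x, continuous (a x)).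
Hypotheses (ha : forall x, {homo a x : t t' / t <= t'}).
Hypotheses (ar : (\int[mu]_x (`|a x 0| `^ r)%:E < +oo)%E).
Hypotheses (ap : forall m : R, 0 < m -> exists phi : T -> R, [/\ mf phi,
  (\int[mu]_x (`|phi x| `^ p')%:E < +oo)%E &
  forall x t, `|t| <= m -> `|a x t| <= phi x]).

Let r0 : 0 < r.
Proof.
apply: lt_trans rn; rewrite divr_gt0 ?mulr_gt0 ?ltr0n ?(es_dim_gt0 ES)//;
  exact: es_s_gt0 ES.
Qed.

Let p'0 : 0 < p'.
Proof.
have s0 := es_s_gt0 ES; have n0 : 0 < n%:R :> R by rewrite ltr0n; exact: es_dim_gt0 ES.
by rewrite divr_gt0 ?mulr_gt0// addr_gt0// mulr_gt0.
Qed.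

(** [M] is obtained first, from the source [q - a x 0], and serves as the truncation level
    afterwards. The bound is stated for every solution, since the competitors in the control problem
    are arbitrary feasible states. *)
Lemma state_solution (Q : R) : 0 <= Q -> exists2 M : R, 0 < M & forall q, mf q ->
  (forall x, `|q x| <= Q) -> (forall x, ~ Om x -> q x = 0) ->
  (forall u, H u -> solves kap u (fun x => q x - a x (u x)) ->
     {ae mu, forall x, `|u x| <= M}) /\
  exists2 u, H u & solves kap u (fun x => q x - a x (u x)).
Proof.
move=> Q0; set A := fine (mu Om).
have mOm := es_measurable_domain ES.
have OmA : (mu Om <= A%:E)%E.
  by rewrite /A fineK// ge0_fin_numE//; exact: es_finite_domain ES.
have A0 : 0 <= A by rewrite fine_ge0.
set F0 := fine (\int[mu]_x (`|a x 0| `^ r)%:E)%E.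
have F00 : 0 <= F0 by rewrite fine_ge0// integral_ge0// => x _;
  rewrite lee_fin powR_ge0.
have aF0 : (\int[mu]_x (`|- a x 0| `^ r)%:E <= F0%:E)%E.
  under eq_integral do rewrite normrN.
  rewrite /F0 fineK// ge0_fin_numE// integral_ge0// => x _; rewrite lee_fin powR_ge0//.
pose F := 2 `^ r * (Q `^ r * A + F0).
have F_ge0 : 0 <= F by rewrite mulr_ge0 ?powR_ge0// addr_ge0// mulr_ge0// powR_ge0.
have [M M0 HM] := solution_bound kap0 rn F_ge0.
exists M => // q mq qQ q0.
have ma0 : mf (fun x => - a x 0) by exact: measurableT_comp (ma 0).
pose f x := q x - a x 0.
have mf' : mf f by exact: measurable_funD.
have fF : (\int[mu]_x (`|f x| `^ r)%:E <= F%:E)%E.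
  by apply: integral_powR_normD_le => //; exact: (integral_powR_bounded_le r0 mq mOm).
have hbound u : H u -> solves kap u (fun x => q x - a x (u x)) ->
    {ae mu, forall x, `|u x| <= M}.
  move=> hu us; apply: (HM u f _ hu us) => //.
    by apply: nearW => x ux; rewrite lerD2l lerN2; apply: ha; exact: ltW.
  by apply: nearW => x ux; rewrite lerD2l lerN2; apply: ha; exact: ltW.
split=> //.
pose g x t := a x (clamp M t) - q x.
have M00 := ltW M0.
have [phi [mphi phip aphi]] := ap M0.
pose P x := phi x + `|q x|.
have mP : mf P by apply: measurable_funD => //; exact: measurableT_comp.
set Fp := fine (\int[mu]_x (`|phi x| `^ p')%:E)%E.
have phiF : (\int[mu]_x (`|phi x| `^ p')%:E <= Fp%:E)%E.
  rewrite /Fp fineK// ge0_fin_numE// integral_ge0// => x _; rewrite lee_fin powR_ge0//.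
have qF : (\int[mu]_x (`|(`|q x|)| `^ p')%:E <= (Q `^ p' * A)%:E)%E.
  under eq_integral do rewrite normr_id.
  exact: (integral_powR_bounded_le p'0 mq mOm).
have PF := integral_powR_normD_le p'0 mphi (measurableT_comp (@normr_measurable _ _)
  mq) phiF qF.
have cclamp : continuous (clamp M).
  move=> t; apply/cvgrPdist_le => /= e e0; near=> y.
  apply: le_trans (clamp_dist _ _ _) _; near: y.
  exact: (@cvgr_dist_le _ _ _ _ _ id t) e0.
have mg t : mf (g ^~ t) by apply: measurable_funB => //; exact: ma.
have cg x : continuous (g x).
  move=> t; apply: cvgB; last exact: cvg_cst.
  by apply: (@continuous_cvg _ _ _ _ _ (clamp M) (a x) (clamp M t));
    [exact: ca|exact: cclamp].
have hg x : {homo g x : t t' / t <= t'}.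
  by move=> t t' tt; rewrite lerD2r; apply: ha; exact: clamp_nd.
have gm x t : t <= - M -> g x t = g x (- M).
  move=> tM; rewrite /g /clamp; congr (a x _ - _).
  have -> : Num.min M t = t by apply: min_r; lra.
  have -> : Num.min M (- M) = - M by apply: min_r; lra.
  by rewrite maxxx; apply: max_l.
have gP x t : `|g x t| <= P x.
  apply: le_trans (ler_normB _ _) _; rewrite lerD2r; apply: aphi.
  exact: clamp_le.
have [u hu ueq] := monotone_variational ES kap0 mg cg hg gm mP gP PF.
have mu' := H_mf hu.
have mgu : mf (fun x => g x (u x)) by exact: caratheodory_comp.
pose h x := q x - a x (clamp M (u x)).
have mcu : mf (fun x => clamp M (u x)) by exact: measurableT_comp (measurable_clamp M)
  mu'.
have mh : mf h by apply: measurable_funB => //; exact: caratheodory_comp mcu.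
have hg' x : h x = - g x (u x) by rewrite /h /g opprB.
have us : solves kap u h.
  move=> v hv.
  have gF : (\int[mu]_x (`|g x (u x)| `^ p')%:E <= (2 `^ p' * (Fp + Q `^ p' * A))%:E)%E.
    apply: le_trans PF; apply: ge0_le_integral => //.
    - exact: measurable_powR_norm.
    - exact: measurable_powR_norm.
    - move=> x _; rewrite lee_fin; apply: ge0_ler_powR; rewrite ?nnegrE ?(ltW p'0)//.
      by apply: le_trans (gP x (u x)) _; exact: ler_norm.
  have hF : (\int[mu]_x (`|h x| `^ p')%:E <= (2 `^ p' * (Fp + Q `^ p' * A))%:E)%E.
    by under eq_integral do rewrite hg' normrN.
  split; first by have [] := dual_le ES mh hv hF.
  have [Ig _] := dual_le ES mgu hv gF.
  have := ueq v hv; rewrite (@eq_Rintegral _ _ _ mu setT (fun x => -1 * (g x (u x) * v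
    x)) (fun x => h x * v x)).
    by rewrite RintegralZl// => e; lra.
  by move=> x _; rewrite hg'; ring.
exists u => //.
(* Clamping preserves signs, so the comparison with [f] also holds for the truncated equation. The
   bound then makes the clamp act as the identity almost everywhere. *)
have uM : {ae mu, forall x, `|u x| <= M}.
  apply: (HM u f h hu us) => //.
    apply: nearW => x ux; rewrite lerD2l lerN2; apply: ha.
    by rewrite /clamp le_max le_min M00 (ltW ux) orbT.
  apply: nearW => x ux; rewrite lerD2l lerN2; apply: ha.
  by rewrite /clamp ge_max oppr_le0 M00 ge_min (ltW ux) orbT.
apply: solves_ae us => //.
  by apply: measurable_funB => //; exact: caratheodory_comp.
by apply: filterS uM => x ux; rewrite /h clamp_id.
Unshelve. all: by end_near. Qed.

End nonlinear_state.
End state.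

Lemma cvgn_dense {R : realType} (u : nat -> R) (B : R) :
  (forall e : R, 0 < e -> exists N, forall k, (N <= k)%N -> u k <= B + e) ->
  forall l : R, u @ \oo --> l -> l <= B.
Proof.
move=> h l ul; apply/ler_addgt0Pr => e e0; have [N HN] := h _ e0.
rewrite -(cvg_lim _ ul)//; apply: limr_le; first by apply/cvg_ex; exists l.
by exists N.
Qed.

(** * The control problem *)

Section bounded_functions.
Context {dd} {T : measurableType dd} {R : realType}.
Context (mu : {measure set T -> \bar R}) (Om : set T) (B : R).
Hypotheses (mOm : measurable Om) (Omoo : (mu Om < +oo)%E).
Notation mf v := (measurable_fun setT (v : T -> R)).
Implicit Types (f : T -> R).

Lemma integrable_scaled_indic : mu.-integrable setT (EFin \o (fun x => B * \1_Om x)).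
Proof.
apply/integrableP; split.
  by apply/measurable_EFinP; apply: measurable_funM => //; exact: measurable_indic.
rewrite (_ : (\int[mu]_x _)%E = (\int[mu]_x (`|B|%:E * (\1_Om x)%:E))%E); last first.
  by apply: eq_integral => x _ /=; rewrite -EFinM normrM (ger0_norm (_ : 0 <= \1_Om x)).
rewrite ge0_integralZl_EFin//; last by apply/measurable_EFinP; exact: measurable_indic.
by rewrite integral_indic// setIT lte_mul_pinfty.
Qed.

Lemma bounded_integrable f S : mf f -> measurable S -> (forall x, `|f x| <= B) ->
  (forall x, ~ Om x -> f x = 0) -> mu.-integrable S (EFin \o f).
Proof.
move=> mf' mS fB f0; apply: (@integrableS _ _ _ mu setT) => //.
apply: (@le_integrable _ _ _ mu setT measurableT _ (EFin \o (fun x => B * \1_Om x))).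
- exact/measurable_EFinP.
- move=> x _ /=; rewrite lee_fin indicE; have [Ox|Ox] := pselect (Om x).
    by rewrite mem_set// mulr1; apply: le_trans (fB x) (ler_norm _).
  by rewrite f0// normr0.
- exact: integrable_scaled_indic.
Qed.

Lemma bounded_cvg (f_ : nat -> T -> R) f S : (forall k, mf (f_ k)) -> mf f ->
  measurable S -> (forall k x, `|f_ k x| <= B) ->
  (forall k x, ~ Om x -> f_ k x = 0) ->
  {ae mu, forall x, f_ ^~ x @ \oo --> f x} ->
  (fun k => \int[mu]_(x in S) f_ k x) @ \oo --> \int[mu]_(x in S) f x.
Proof.
(* A negative [B] can bound an absolute value only if [T] is empty. *)
move=> mf_ mf' mS fB f0 cf; have [B0|B0] := leP 0 B; last first.
  have h x : f_ 0%N x = 0.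
    by apply/eqP; rewrite -normr_le0; apply: le_trans (fB 0%N x) (ltW B0).
  have e (x : T) : False by have := fB 0%N x; rewrite h normr0 leNgt B0.
  rewrite (_ : (fun k => _) = cst (\int[mu]_(x in S) f x)); first exact: cvg_cst.
  by apply/funext => k; apply: eq_Rintegral => x; have := e x.
rewrite (_ : (fun k => _) = fun k => \int[mu]_x (f_ k \_ S) x); last first.
  by apply/funext => k; rewrite Rintegral_mkcond.
rewrite Rintegral_mkcond.
have mr g : mf g -> mf (g \_ S).
  move=> mg; apply/(measurable_restrictT _ mS).
  exact: measurable_funTS.
apply: (@Rintegral_dominated_cvg _ _ _ mu _ _ (fun x => B * \1_Om x)).
- by move=> k; exact: mr.
- exact: mr.
- exact: integrable_scaled_indic.
- apply: filterS cf => x cx; rewrite patchE; under eq_fun do rewrite patchE.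
  by case: (x \in S) => //; exact: cvg_cst.
- apply: nearW => x k; rewrite patchE; case: ifP => _; last by rewrite normr0 mulr_ge0.
  rewrite indicE; have [Ox|Ox] := pselect (Om x); first by rewrite mem_set// mulr1.
  by rewrite f0// normr0 mulr_ge0.
Qed.

End bounded_functions.

Section control.
Context {dd} {T : measurableType dd} {R : realType}.
Context (mu : {sigma_finite_measure set T -> \bar R}) (w : T * T -> R).
Context (n : nat) (s CS CP : R) (Om : set T) (H : set (T -> R)).
Hypothesis ES : energy_space mu w n s CS CP Om H.
Let p' := 2 * n%:R / (n%:R + 2 * s).
Notation mf v := (measurable_fun setT (v : T -> R)).
Notation en := (energy_val mu w).
Notation eform := (energy_form mu w).
Notation solves := (solves_weakly mu w H).
Implicit Types (f p q u v z : T -> R).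
Let mw := es_measurable_weight ES.
Let H_mf := es_measurable ES.
Let mOm := es_measurable_domain ES.
Let Omoo := es_finite_domain ES.
Context (c : R) (h : nat -> R) (K : nat -> nat) (Q : forall N, 'I_(K N) -> set T).
Hypotheses (c_gt0 : 0 < c) (h_gt0 : forall N, 0 < h N).
Hypotheses (h_small : forall e : R, 0 < e -> exists N, h N <= e).
Hypotheses (mQ : forall N i, measurable (@Q N i)).
Hypotheses (QE : forall N i, mu (@Q N i) = (h N ^+ n)%:E).
Hypotheses (tQ : forall N (i j : 'I_(K N)) x, Q i x -> Q j x -> i = j).
Hypotheses (Qw : forall N (i : 'I_(K N)) x y, Q i x -> Q i y -> x <> y ->
  1 <= c * h N `^ (n%:R + 2 * s) * w (x, y) ^+ 2).
Hypotheses (Qcov : forall N x, Om x -> exists i : 'I_(K N), Q i x).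
Context (a L : T -> R -> R) (kap r alpha beta lam nu : R).
Hypotheses (kap0 : 0 < kap) (rn : n%:R / (2 * s) < r).
Hypotheses (ma : forall t, mf (a ^~ t)) (ca : forall x, continuous (a x)).
Hypotheses (ha : forall x, {homo a x : t t' / t <= t'}).
Hypotheses (ar : (\int[mu]_x (`|a x 0| `^ r)%:E < +oo)%E).
Hypotheses (ap : forall m : R, 0 < m -> exists phi : T -> R, [/\ mf phi,
  (\int[mu]_x (`|phi x| `^ p')%:E < +oo)%E &
  forall x t, `|t| <= m -> `|a x t| <= phi x]).
Hypotheses (mL : forall t, mf (L ^~ t)) (cL : forall x, continuous (L x)).
Hypotheses (bL : forall m : R, 0 < m -> exists2 sigma : T -> R,
  mu.-integrable setT (EFin \o sigma) & forall x t, `|t| <= m -> `|L x t| <= sigma x).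
Hypotheses (alpha0 : alpha <= 0) (beta0 : 0 <= beta) (lam0 : 0 <= lam) (nu0 : 0 <= nu).

(** A normal form of admissible controls: the constraints hold at every point and the values off
    [Om] are 0, so that hulls and pointwise limits need no exceptional sets. *)
Definition adm q := [/\ mf q, forall x, Om x -> alpha <= q x <= beta &
  forall x, ~ Om x -> q x = 0].

Let B := `|alpha| + `|beta|.
Let B0 : 0 <= B. Proof. by rewrite addr_ge0. Qed.

Lemma adm_bound q x : adm q -> `|q x| <= B.
Proof.
move=> [_ qab q0]; have [Ox|Ox] := pselect (Om x); last by rewrite q0// normr0.
have /andP[qa qb] := qab _ Ox; rewrite ler_norml.
have := ler_norm beta; have := ler_norm (- alpha); have := normr_ge0 alpha.
have := normr_ge0 beta; rewrite normrN /B => ? ? ? ?; apply/andP; split; lra.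
Qed.

Definition control_cost q := \int[mu]_x (lam / 2 * q x ^+ 2 + nu * `|q x|).

Let cd q x := lam / 2 * q x ^+ 2 + nu * `|q x|.
Let Bc := lam / 2 * B ^+ 2 + nu * B.

Let cd_bound q x : adm q -> `|cd q x| <= Bc.
Proof.
move=> aq; have qB := adm_bound x aq.
have l2 : 0 <= lam / 2 by rewrite divr_ge0.
rewrite ger0_norm; last by rewrite addr_ge0// mulr_ge0// sqr_ge0.
apply: lerD; last exact: ler_wpM2l.
rewrite ler_wpM2l// -real_normK ?num_real//.
by rewrite lerXn2r ?nnegrE.
Qed.

Let cd0 q x : adm q -> ~ Om x -> cd q x = 0.
Proof. by move=> [_ _ q0] Ox; rewrite /cd q0// expr0n normr0 !mulr0 addr0. Qed.

Let mcd q : mf q -> mf (cd q).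
Proof.
move=> mq; apply: measurable_funD; apply: measurable_funM; try exact: measurable_cst.
  exact: measurable_funX.
exact: measurableT_comp.
Qed.

Lemma adm_mf q : adm q -> mf q. Proof. by case. Qed.

Lemma adm_integrable q S : adm q -> measurable S -> mu.-integrable S (EFin \o q).
Proof.
move=> aq mS; apply: (bounded_integrable mOm Omoo (adm_mf aq) mS (fun x => adm_bound x
  aq)).
by case: aq.
Qed.

Lemma control_cost_integrable q : adm q -> mu.-integrable setT (EFin \o cd q).
Proof.
move=> aq; apply: (bounded_integrable mOm Omoo (mcd (adm_mf aq)) measurableT
  (fun x => cd_bound x aq)).
by move=> x; exact: cd0.
Qed.

Let A := fine (mu Om).
Let A0 : 0 <= A. Proof. exact: fine_ge0. Qed.
Let OmA : mu Om = A%:E. Proof. by rewrite /A fineK// ge0_fin_numE. Qed.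

Let norm_integral_bound f S (D : R) : 0 <= D -> mf f -> measurable S ->
  (forall x, `|f x| <= D) -> (forall x, ~ Om x -> f x = 0) ->
  `|\int[mu]_(x in S) f x| <= D * A.
Proof.
move=> D0 mf' mS fD f0; rewrite Rintegral_mkcond.
have mr : mf (f \_ S).
  by apply/(measurable_restrictT _ mS); exact: measurable_funTS.
apply: norm_Rintegral_le => //.
apply: (@le_trans _ _ (\int[mu]_x (D%:E * (\1_Om x)%:E))%E).
  apply: ge0_le_integral => //.
  - by apply/measurable_EFinP; exact: measurableT_comp.
  - by apply: measurable_funeM; apply/measurable_EFinP; exact: measurable_indic.
  - move=> x _; rewrite -EFinM lee_fin patchE indicE; have [Ox|Ox] := pselect (Om x).
      by rewrite (mem_set Ox) mulr1; case: ifP => // _; rewrite normr0.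
    by rewrite f0//; case: ifP => _; rewrite normr0 mulr_ge0.
rewrite ge0_integralZl_EFin//; last by apply/measurable_EFinP; exact: measurable_indic.
have -> : (\int[mu]_x (\1_Om x)%:E = A%:E)%E by rewrite integral_indic// setIT;
  exact: OmA.
by rewrite EFinM.
Qed.

Lemma adm_midpt p q : adm p -> adm q -> adm (midpt p q).
Proof.
move=> [mp pab p0] [mq qab q0]; split.
- by apply: measurable_funM => //; exact: measurable_funD.
- by move=> x Ox; have := pab x Ox; have := qab x Ox; rewrite /midpt; lra.
- by move=> x Ox; rewrite /midpt p0// q0// addr0 mulr0.
Qed.

Lemma control_cost_midpt p q : adm p -> adm q ->
  control_cost (midpt p q) <= (control_cost p + control_cost q) / 2.
Proof.
move=> ap' aq; have am := adm_midpt ap' aq.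
have ip := control_cost_integrable ap'; have iq := control_cost_integrable aq.
rewrite /control_cost -RintegralD// [leRHS]mulrC -RintegralZl//; last first.
  by have := integrableD measurableT ip iq.
apply: le_Rintegral => //; [exact: (control_cost_integrable am)| |].
  by have := integrableZl measurableT 2^-1 (integrableD measurableT ip iq).
move=> x _; rewrite /midpt; move: (p x) (q x) => y z.
have h1 : `|2^-1 * (y + z)| <= 2^-1 * (`|y| + `|z|).
  by rewrite normrM ger0_norm ?ler_wpM2l ?ler_normD.
have h2 : (2^-1 * (y + z)) ^+ 2 <= 2^-1 * (y ^+ 2 + z ^+ 2).
  have := sqr_ge0 (y - z); nra.
have l2 : 0 <= lam / 2 by rewrite divr_ge0.
have := ler_wpM2l l2 h2; have := ler_wpM2l nu0 h1; lra.
Qed.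

Lemma adm_ae_limit (p_ : nat -> T -> R) : (forall k, adm (p_ k)) ->
  {ae mu, forall x, cvgn (p_ ^~ x)} ->
  exists2 p, adm p & {ae mu, forall x, p_ ^~ x @ \oo --> p x}.
Proof.
move=> ap_ cp.
pose C := [set x | cvgn (p_ ^~ x)].
pose p k x := if x \in C then p_ k x else 0.
(* The default value 0 is admissible because [alpha <= 0 <= beta]. *)
pose l x := if x \in C then limn (p_ ^~ x) else 0.
have pp k : {ae mu, forall x, p_ k x = p k x}.
  by apply: filterS cp => x cx; rewrite /p mem_set.
have mp k : mf (p k).
  exact: ae_measurable_real (es_complete_measure ES) (pp k) (adm_mf (ap_ k)).
have pl x : p ^~ x @ \oo --> l x.
  rewrite /p /l; case: ifPn => [/set_mem//|_]; exact: cvg_cst.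
exists l; last by apply: filterS cp => x cx; have := pl x; rewrite /p mem_set.
split; first exact: (measurable_fun_cvg mp (fun x _ => pl x)).
- move=> x Ox; rewrite /l; case: ifPn => [/set_mem cx|_]; last by rewrite alpha0 beta0.
  apply/andP; split.
    by apply: limr_ge => //; apply: nearW => k; have [_ /(_ _ Ox)/andP[]] := ap_ k.
  by apply: limr_le => //; apply: nearW => k; have [_ /(_ _ Ox)/andP[]] := ap_ k.
- move=> x Ox; rewrite /l; case: ifPn => [/set_mem cx|//].
  rewrite (_ : p_ ^~ x = cst 0) ?lim_cst//; apply/funext => k.
  by have [_ _ ->] := ap_ k.
Qed.

(* A substitute for weak compactness: [q] is a strong limit of iterated midpoints
   of far terms of the sequence, after the integrals over the countably many mesh
   cells and the cost have been made to converge along the terms [f k]. *)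
Lemma adm_weak_limit (q_ : nat -> T -> R) : (forall k, adm (q_ k)) ->
  exists (q : T -> R) (f : nat -> nat), [/\ adm q, forall k, (k <= f k)%N,
    forall N (i : 'I_(K N)) (e : R), 0 < e -> exists N0, forall k, (N0 <= k)%N ->
      `|\int[mu]_(x in Q i) q_ (f k) x - \int[mu]_(x in Q i) q x| <= e &
    forall e : R, 0 < e -> exists N0, forall k, (N0 <= k)%N ->
      control_cost q <= control_cost (q_ (f k)) + e].
Proof.
move=> aq.
(* One countable family holds every functional that must converge: the integrals over all cells of
   all meshes, and the cost as [None]. Pickling makes it a sequence for [cluster_values]. *)
pose I := option {N : nat & 'I_(K N)}.
pose val p (j : I) : R := if j is Some j then \int[mu]_(x in Q (projT2 j)) p x
  else control_cost p.
pose y k (j : nat) := if (unpickle j : option I) is Some j then val (q_ k) j else 0.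
have yB j : exists D : R, forall k, `|y k j| <= D.
  rewrite /y; case: (unpickle j : option I) => [[[N i]|]|].
  - exists (B * A) => k /=; apply: norm_integral_bound => //; first exact: adm_mf.
      by move=> x; exact: adm_bound.
    by have [] := aq k.
  - exists (Bc * A) => k /=; apply: norm_integral_bound => //.
    + by rewrite addr_ge0// mulr_ge0// ?divr_ge0// sqr_ge0.
    + exact: mcd (adm_mf (aq k)).
    + by move=> x; exact: cd_bound.
    + by move=> x; exact: cd0.
  - by exists 0 => k; rewrite normr0.
have [cv Hcv] := cluster_values yB.
have t0 k : 0 < k.+1%:R^-1 :> R by rewrite invr_gt0.
(* These index sets decrease. Passing to the midpoint hull keeps the two-sided estimate for cell
   integrals, which are affine in the control, and the upper estimate for the cost, which is
   convex. *)
pose Sel N := [set k | (N <= k)%N /\ forall j, (j < N)%N -> `|y k j - cv j| <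
  N.+1%:R^-1].
have SelP N : exists k, Sel N k by have [k Nk Hk] := Hcv N _ (t0 N); exists k.
have Sel_dec N : Sel N.+1 `<=` Sel N.
  move=> k [Nk Hk]; split; first exact: ltnW.
  move=> j jN; apply: lt_le_trans (Hk j (ltnW jN)) _.
  by rewrite lef_pV2 ?posrE// ler_nat.
have [f Hf] := choice SelP.
have fval N (j : I) : (pickle j < N)%N -> `|val (q_ (f N)) j - cv (pickle j)| <
  N.+1%:R^-1.
  by move=> jN; have [_ /(_ _ jN)] := Hf N; rewrite /y pickleK.
pose hull N := midhull midpt (q_ @` Sel N).
have hullP N p : hull N p -> [/\ adm p,
    forall N' (i : 'I_(K N')), (pickle (Some (existT _ N' i) : I) < N)%N ->
      `|\int[mu]_(x in Q i) p x - cv (pickle (Some (existT _ N' i) : I))| <= N.+1%:R^-1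
        &
    (pickle (None : I) < N)%N -> control_cost p <= cv (pickle (None : I)) + N.+1%:R^-1].
  move: p; apply: midhull_ind_prop.
    move=> _ [k [Nk Hk] <-]; split=> //.
    - move=> N' i iN; have := Hk _ iN; rewrite /y pickleK/=; exact: ltW.
    - move=> iN; have := Hk _ iN; rewrite /y pickleK/= ltr_norml => /andP[_].
      by rewrite ltrBlDl => /ltW.
  move=> u v [au iu cu] [av iv' cv']; split; first exact: adm_midpt.
  - move=> N' i iN; have := iu _ _ iN; have := iv' _ _ iN.
    have -> : \int[mu]_(x in Q i) midpt u v x =
        2^-1 * (\int[mu]_(x in Q i) u x + \int[mu]_(x in Q i) v x).
      rewrite -RintegralD//; [|exact: adm_integrable|exact: adm_integrable].
      rewrite -RintegralZl//.
      by have := integrableD (mQ i) (adm_integrable au (mQ i)) (adm_integrable av (mQ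
        i)).
    move: (cv _) (Rintegral _ _ _) (Rintegral _ _ _) (N.+1%:R^-1) => ? ? ? ?.
    rewrite !ler_norml => /andP[? ?] /andP[? ?]; apply/andP; split; lra.
  - move=> iN; have := cu iN; have := cv' iN; have := control_cost_midpt au av.
    move: (control_cost (midpt u v)) (control_cost u) (control_cost v) (cv _)
      (N.+1%:R^-1) => ? ? ? ? ?; lra.
have sq_fin p : adm p -> (sq2 mu p <= (B ^+ 2 * A)%:E)%E.
  move=> ap'; have h2 : 0 < 2 :> R by [].
  have OmA' : (mu Om <= A%:E)%E by rewrite OmA.
  have p0 x : ~ Om x -> p x = 0 by case: ap' => _ _; exact.
  have := integral_powR_bounded_le h2 (adm_mf ap') mOm OmA' p0 (fun x => adm_bound x
    ap').
  rewrite powR_mulrn//; apply: le_trans; rewrite le_eqVlt; apply/orP; left; apply/eqP.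
  by apply: eq_integral => x _; rewrite powR_mulrn// real_normK ?num_real.
have sq_lty p : adm p -> (sq2 mu p < +oo)%E by move=> /sq_fin /le_lt_trans; apply;
  rewrite ltry.
have sq_fine p : adm p -> sq2 mu p = (fine (sq2 mu p))%:E.
  by move=> ap'; rewrite fineK// ge0_fin_numE ?sq2_ge0// sq_lty.
have hd k : hull k.+1 `<=` hull k.
  by apply: midhullS => _ [j Sj <-]; exists j => //; exact: Sel_dec.
have hm k u v : hull k u -> hull k v -> hull k (midpt u v) by exact: midhull_mid.
have hlb u : hull 0%N u -> 0 <= fine (sq2 mu u) by move=> _; rewrite fine_ge0// sq2_ge0.
have hub k : exists2 u, hull k u & fine (sq2 mu u) <= B ^+ 2 * A.
  exists (q_ (f k)); first by apply: midhull_in; exists (f k).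
  by rewrite -lee_fin -sq_fine//; exact: sq_fin.
have hmid u v : hull 0%N u -> hull 0%N v ->
    fine (sq2 mu (midpt u v)) + 4^-1 * fine (sq2 mu (u \- v)%R) <=
    (fine (sq2 mu u) + fine (sq2 mu v)) / 2.
  move=> /hullP[au _ _] /hullP[av _ _].
  have mu' := adm_mf au; have mv := adm_mf av.
  have := sq2_parallelogram mu mu' mv.
  have fB : (sq2 mu (u \- v)%R < +oo)%E by apply: sq2B_lty => //; exact: sq_lty.
  have fD : (sq2 mu (u \+ v)%R < +oo)%E by apply: sq2D_lty => //; exact: sq_lty.
  have -> : sq2 mu (midpt u v) = ((2^-1 ^+ 2)%:E * sq2 mu (u \+ v)%R)%E.
    by rewrite /midpt -sq2Z//; exact: measurable_funD.
  rewrite -(@fineK _ (sq2 mu (u \+ v)%R)) ?ge0_fin_numE ?sq2_ge0//.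
  rewrite -(@fineK _ (sq2 mu (u \- v)%R)) ?ge0_fin_numE ?sq2_ge0//.
  rewrite (sq_fine u)// (sq_fine v)// -!EFinM -!EFinD => -[].
  rewrite /=.
  move: (fine _) (fine _) (fine _) (fine _) => ? ? ? ?; lra.
have [p [Hp _ pC]] := minimizing_cauchy hd hm hlb hub hmid.
have ap' k : adm (p k) by have [] := hullP _ _ (Hp k).
have pC' (e : R) : 0 < e -> exists N, forall m k, (N <= m)%N -> (m <= k)%N ->
    (sq2 mu (p k \- p m)%R <= e%:E)%E.
  move=> e0; have e4 : 0 < 4^-1 * e by rewrite mulr_gt0// invr_gt0.
  have [N HN] := pC _ e4; exists N => m k Nm mk.
  have fB : (sq2 mu (p m \- p k)%R < +oo)%E.
    by apply: sq2B_lty; try exact: adm_mf; exact: sq_lty.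
  have -> : sq2 mu (p k \- p m)%R = sq2 mu (p m \- p k)%R.
    by apply: eq_integral => x _ /=; rewrite -sqrrN opprB.
  rewrite -(@fineK _ (sq2 mu _)) ?ge0_fin_numE ?sq2_ge0// lee_fin.
  by have := HN _ _ Nm mk; rewrite ler_pM2l// invr_gt0.
have [sg [sgk _ sgc]] := sq2_cauchy_subseq (fun k => adm_mf (ap' k)) pC'.
have [q aq' qc] := adm_ae_limit (fun k => ap' (sg k)) sgc.
(* The strong limit of the hull elements has the same cell integrals as the limit along [f], and
   this is all the weak convergence that is used later. *)
have cells N (i : 'I_(K N)) : \int[mu]_(x in Q i) q x = cv (pickle (Some (existT _ N i)
  : I)).
  have cvg1 : (fun k => \int[mu]_(x in Q i) p (sg k) x) @ \oo --> \int[mu]_(x in Q i) q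
    x.
    apply: (bounded_cvg mOm Omoo (fun k => adm_mf (ap' (sg k))) (adm_mf aq') (mQ i)
      (fun k x => adm_bound x (ap' (sg k)))) => //.
    by move=> k; have [] := ap' (sg k).
  have key (e : R) : 0 < e -> exists N0, forall k, (N0 <= k)%N ->
      `|\int[mu]_(x in Q i) p (sg k) x - cv (pickle (Some (existT _ N i) : I))| <= e.
    move=> e0; have [N1 HN1] := harmonic_small e0.
    exists (maxn N1 (pickle (Some (existT _ N i) : I)).+1) => k.
    rewrite geq_max => /andP[k1 k2].
    have [_ /(_ N i) cl _] := hullP _ _ (Hp (sg k)).
    apply: le_trans (cl _) (HN1 _ _); first exact: leq_trans k2 (sgk k).
    exact: leq_trans k1 (sgk k).
  apply/eqP; rewrite eq_le; apply/andP; split.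
    apply: (cvgn_dense _ cvg1) => e e0; have [N0 HN0] := key _ e0; exists N0 => k /HN0.
    by rewrite ler_norml lerBlDl => /andP[].
  rewrite -lerN2; apply: (cvgn_dense (u := fun k => - \int[mu]_(x in Q i) p (sg k) x));
    last exact: cvgN.
  move=> e e0; have [N0 HN0] := key _ e0; exists N0 => k /HN0.
  by rewrite ler_norml => /andP[+ _]; move: (Rintegral _ _ _) (cv _) => ? ?; lra.
have costq : control_cost q <= cv (pickle (None : I)).
  have cvg1 : (fun k => \int[mu]_(x in setT) cd (p (sg k)) x) @ \oo --> \int[mu]_(x in
    setT) cd q x.
    apply: (bounded_cvg mOm Omoo (fun k => mcd (adm_mf (ap' (sg k)))) (mcd (adm_mf
      aq')) measurableT
      (fun k x => cd_bound x (ap' (sg k)))).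
      by move=> k x; exact: cd0.
    apply: filterS qc => x cx; apply: cvgD; apply: cvgM; try exact: cvg_cst.
      by under eq_fun do rewrite expr2; rewrite expr2; exact: cvgM.
    exact: cvg_norm.
  apply: (cvgn_dense _ cvg1) => e e0; have [N1 HN1] := harmonic_small e0.
  exists (maxn N1 (pickle (None : I)).+1) => k; rewrite geq_max => /andP[k1 k2].
  have [_ _ cl] := hullP _ _ (Hp (sg k)).
  apply: le_trans (cl (leq_trans k2 (sgk k))) _; rewrite lerD2l.
  exact: HN1 (leq_trans k1 (sgk k)).
exists q, f; split => //; first by move=> k; have [] := Hf k.
- move=> N i e e0; have [N1 HN1] := harmonic_small e0.
  exists (maxn N1 (pickle (Some (existT _ N i) : I)).+1) => k;
    rewrite geq_max => /andP[k1 k2].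
  by rewrite cells; apply: le_trans (ltW (fval k (Some (existT _ N i)) k2)) (HN1 _ k1).
- move=> e e0; have [N1 HN1] := harmonic_small e0.
  exists (maxn N1 (pickle (None : I)).+1) => k; rewrite geq_max => /andP[k1 k2].
  have := fval k None k2; have := HN1 _ k1; rewrite ltr_norml /=.
  move: costq; move: (control_cost _) (control_cost _) (cv _) (k.+1%:R^-1) => ? ? ? ? ?
    ? /andP[? ?]; lra.
Qed.

Definition feas u q := [/\ H u, adm q & solves kap u (fun x => q x - a x (u x))].

Definition total_cost u q := \int[mu]_x L x (u x) + control_cost q.

Let p'0 : 0 < p'.
Proof.
have s0 := es_s_gt0 ES; have n0 : 0 < n%:R :> R by rewrite ltr0n; exact: es_dim_gt0 ES.
by rewrite divr_gt0 ?mulr_gt0// addr_gt0// mulr_gt0.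
Qed.

Lemma state_convergence (q_ u_ : nat -> T -> R) q u :
  (forall k, feas (u_ k) (q_ k)) -> feas u q ->
  (forall N (i : 'I_(K N)) (e : R), 0 < e -> exists N0, forall k, (N0 <= k)%N ->
      `|\int[mu]_(x in Q i) q_ k x - \int[mu]_(x in Q i) q x| <= e) ->
  forall e : R, 0 < e -> exists N0, forall k, (N0 <= k)%N -> en (u_ k \- u) <= e.
Proof.
move=> fk [hu aq us] cells e e0.
have k20 : 0 < 2 * kap by rewrite mulr_gt0.
pose g k x := q_ k x - q x.
have ak k : adm (q_ k) by have [] := fk k.
have hk k : H (u_ k) by have [] := fk k.
have mg k : mf (g k) by apply: measurable_funB; exact: adm_mf.
have gB k x : `|g k x| <= B + B.
  by apply: le_trans (ler_normB _ _) _; apply: lerD; exact: adm_bound.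
have g0 k x : ~ Om x -> g k x = 0.
  by move=> Ox; have [_ _ /(_ _ Ox) h1] := ak k; have [_ _ /(_ _ Ox) h2] := aq;
    rewrite /g h1 h2 subrr.
have BB0 : 0 <= B + B by rewrite addr_ge0.
have OmA' : (mu Om <= A%:E)%E by rewrite OmA.
have hw k : H (u_ k \- u) := HB ES (hk k) hu.
pose F := (B + B) `^ p' * A.
have gF k : (\int[mu]_x (`|g k x| `^ p')%:E <= F%:E)%E.
  exact: (integral_powR_bounded_le p'0 (mg k) mOm OmA' (g0 k) (gB k)).
pose X := F `^ p'^-1 * Num.sqrt CS.
have X0 : 0 <= X by rewrite mulr_ge0 ?powR_ge0 ?sqrtr_ge0.
have key k : 2 * kap * en (u_ k \- u) <= \int[mu]_x (g k x * (u_ k \- u) x).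
  have [_ _ /(_ _ (hw k))[I1 e1]] := fk k; have [I2 e2] := us _ (hw k).
  rewrite -eform_en (eformB ES (hw k) (hk k) hu).
  rewrite [eform _ (u_ k)]eform_sym [eform _ u]eform_sym mulrBr e1 e2 -RintegralB//.
  have [I3 _] := dual_le ES (mg k) (hw k) (gF k).
  apply: le_Rintegral => //; first by have := integrableB measurableT I1 I2.
  move=> x _ /=; rewrite -mulrBl /g.
  have -> : (q_ k x - a x (u_ k x) - (q x - a x (u x))) * (u_ k x - u x) =
    (q_ k x - q x) * (u_ k x - u x) - (a x (u_ k x) - a x (u x)) * (u_ k x - u x) by
      ring.
  rewrite gerBl; have [uu|uu] := leP (u x) (u_ k x).
    by rewrite mulr_ge0 ?subr_ge0//; exact: ha.
  by rewrite mulr_le0 ?subr_le0 ?(ltW uu)//; apply: ha; exact: ltW.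
(* From [2 * kap * en <= X * sqrt en], by dividing by the square root: an energy bound independent
   of [k], required before any smallness. *)
pose E0 := (X / (2 * kap)) ^+ 2.
have E00 : 0 <= E0 by exact: sqr_ge0.
have enE0 k : en (u_ k \- u) <= E0.
  have [_ h1] := dual_le ES (mg k) (hw k) (gF k).
  have h2 := le_trans (key k) (le_trans (ler_norm _) h1).
  rewrite -(sqr_sqrtr (en_ge0 mu w (u_ k \- u))) /E0 lerXn2r ?nnegrE ?sqrtr_ge0//.
    by rewrite divr_ge0// ltW.
  rewrite ler_pdivlMr//; move: h2;
    rewrite -/X -{1}(sqr_sqrtr (en_ge0 mu w (u_ k \- u))).
  have [->|y0] := eqVneq (Num.sqrt (en (u_ k \- u))) 0; first by rewrite mul0r.
  have {}y0 : 0 < Num.sqrt (en (u_ k \- u)) by rewrite lt_def y0 sqrtr_ge0.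
  by rewrite expr2 mulrA ler_pM2r// mulrC.
pose V := CP * E0.
have CP0 := es_CP_gt0 ES.
have V0 : 0 <= V by rewrite mulr_ge0// ltW.
have wV k : (sq2 mu (u_ k \- u)%R <= V%:E)%E.
  apply: le_trans (es_poincare ES (hw k)) _.
  by rewrite (energy_en ES (hw k)) -EFinM lee_fin ler_pM2l.
pose G := (B + B) ^+ 2 * A.
have G0 : 0 <= G by rewrite mulr_ge0// sqr_ge0.
have gG' k : (sq2 mu (g k) <= G%:E)%E.
  have h2 : 0 < 2 :> R by [].
  have := integral_powR_bounded_le h2 (mg k) mOm OmA' (g0 k) (gB k).
  rewrite powR_mulrn//; apply: le_trans; rewrite le_eqVlt; apply/orP; left; apply/eqP.
  by apply: eq_integral => x _; rewrite powR_mulrn// real_normK ?num_real.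
have gfin k : sq2 mu (g k) \is a fin_num.
  by rewrite ge0_fin_numE ?sq2_ge0// (le_lt_trans (gG' k))// ltry.
have gG k : fine (sq2 mu (g k)) <= G by rewrite -lee_fin fineK.
(* Each of the three terms of [cell_duality] is brought below [e'], in a forced order: [tau] for the
   size of [g], then the mesh [j], which depends on [tau], for the oscillation, then [k], which
   depends on the mesh through [W], for the cell integrals. *)
pose e' := 2 * kap * e / 3.
have e'0 : 0 < e' by rewrite divr_gt0// mulr_gt0.
have G1 : 0 < G + 1 by rewrite ltr_wpDl.
pose tau := 2 * e' / (G + 1).
have tau0 : 0 < tau by rewrite divr_gt0// mulr_gt0.
have t1 k : tau / 2 * fine (sq2 mu (g k)) <= e'.
  have -> : tau / 2 = e' / (G + 1) by rewrite /tau; field; rewrite gt_eqF.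
  rewrite mulrAC ler_pdivrMr// ler_pM2l//; have := gG k; lra.
have s20 : 0 < 2 * s by rewrite mulr_gt0//; exact: es_s_gt0 ES.
have E1 : 0 < E0 + 1 by rewrite ltr_wpDl.
pose d := e' * (2 * tau) / (c * (E0 + 1)).
have d0 : 0 < d by apply: divr_gt0; apply: mulr_gt0 => //; apply: mulr_gt0.
have [j hj] := h_small (powR_gt0 (2 * s)^-1 d0).
have t2 : c * h j `^ (2 * s) / (2 * tau) * E0 <= e'.
  have hd : h j `^ (2 * s) <= d.
    have -> : d = (d `^ (2 * s)^-1) `^ (2 * s).
      by rewrite -powRrM mulVf ?gt_eqF// powRr1// ltW.
    by apply: ge0_ler_powR; rewrite ?nnegrE ?powR_ge0 ?(ltW s20) ?(ltW (h_gt0 j)).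
  apply: (@le_trans _ _ (c * d / (2 * tau) * (E0 + 1))).
    apply: ler_pM => //.
    - by apply: divr_ge0; apply: mulr_ge0; rewrite ?powR_ge0 ?(ltW c_gt0) ?(ltW tau0).
    - by rewrite ler_pM2r ?ler_pM2l// invr_gt0; apply: mulr_gt0.
    - by rewrite lerDl.
  rewrite le_eqVlt; apply/orP; left; apply/eqP; rewrite /d; field.
  by rewrite !gt_eqF.
pose W := 1 + V / h j ^+ n.
have W0 : 0 < W by rewrite ltr_pwDl// divr_ge0// exprn_ge0// ltW.
have K0 : 0 < (K j).+1%:R :> R by [].
pose de := e' / W / (K j).+1%:R.
have de0 : 0 < de by apply: divr_gt0 => //; exact: divr_gt0.
have [N0 HN0] := choice (fun i : 'I_(K j) => cells j i de de0).
exists (\max_i N0 i)%N => k Nk.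
have t3 : W * \sum_(i < K j) `|\int[mu]_(x in Q i) g k x| <= e'.
  have : \sum_(i < K j) `|\int[mu]_(x in Q i) g k x| <= \sum_(i < K j) de.
    apply: ler_sum => i _; rewrite /g RintegralB//;
      [|exact: adm_integrable|exact: adm_integrable].
    by apply: HN0; apply: leq_trans Nk; exact: leq_bigmax.
  rewrite sumr_const card_ord -[_ *+ _]mulr_natr => h3.
  apply: (@le_trans _ _ (W * (de * (K j).+1%:R))).
    by rewrite ler_pM2l//; apply: le_trans h3 _; rewrite ler_pM2l// ler_nat.
  by rewrite /de divfK ?gt_eqF// mulrC divfK// gt_eqF.
have nQ x : (forall i : 'I_(K j), ~ Q i x) -> g k x = 0.
  move=> nq; apply: g0 => Ox; have [i Qi] := Qcov j Ox; exact: (nq i).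
have enk : (nonlocal_energy mu w (u_ k \- u)%R <= E0%:E)%E.
  by rewrite (energy_en ES (hw k)) lee_fin.
have glt : (sq2 mu (g k) < +oo)%E by apply: le_lt_trans (gG' k) _; rewrite ltry.
have := cell_duality mw c_gt0 (h_gt0 j) (@mQ j) (@QE j) (@tQ j) (@Qw j) (mg k) (H_mf
  (hw k)) glt
  nQ (wV k) enk tau0.
rewrite -/W => h4.
have h5 := le_trans (key k) (le_trans (ler_norm _) h4).
rewrite -(ler_pM2l k20); have -> : 2 * kap * e = 3 * e' by rewrite /e'; field.
have add3 (y1 y2 y3 y4 y5 : R) :
  y1 <= y5 -> y2 <= y5 -> y4 <= y3 + y1 + y2 -> y3 <= y5 -> y4 <= 3 * y5 by lra.
exact: add3 t2 t3 h5 (t1 k).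
Qed.

(** The integrability of [L x (u x)] is part of the conclusion because [total_cost] is a real-valued
    integral with a default value; it is what allows the comparison with the extended-real cost. *)
Lemma optimal_control :
  (forall u q, feas u q -> mu.-integrable setT (EFin \o (fun x => L x (u x)))) /\
  exists u q, [/\ feas u q, exists M : R, {ae mu, forall x, `|u x| <= M} &
    forall u' q', feas u' q' -> total_cost u q <= total_cost u' q'].
Proof.
have [M M0 HM] := state_solution ES kap0 rn ma ca ha ar ap B0.
have HM' q : adm q -> (forall u, H u -> solves kap u (fun x => q x - a x (u x)) ->
     {ae mu, forall x, `|u x| <= M}) /\
  exists2 u, H u & solves kap u (fun x => q x - a x (u x)).
  by move=> aq; apply: HM; [exact: adm_mf|move=> x; exact: adm_bound|case: aq].
have feasM u q : feas u q -> {ae mu, forall x, `|u x| <= M}.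
  by move=> [hu aq us]; have [+ _] := HM' _ aq; exact.
have [sigma isg Lsg] := bL M0.
have sg0 x : 0 <= sigma x.
  by apply: le_trans (normr_ge0 (L x 0)) _; apply: Lsg; rewrite normr0 ltW.
have mLu u : mf u -> mf (fun x => L x (u x)) by exact: caratheodory_comp.
have Lu u q : feas u q -> {ae mu, forall x, `|L x (u x)| <= sigma x}.
  by move=> /feasM; apply: filterS => x; exact: Lsg.
have msg : mf sigma by apply/measurable_EFinP; exact: measurable_int isg.
have LI u q : feas u q -> mu.-integrable setT (EFin \o (fun x => L x (u x))).
  move=> fu; have [hu _ _] := fu; have mu' := H_mf hu.
  (* The bound by [sigma] holds only almost everywhere, since [u] is bounded only almost everywhere;
     clipping gives a representative dominated at every point. *)
  pose Lm x := Num.max (- sigma x) (Num.min (L x (u x)) (sigma x)).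
  have mLm : mf Lm.
    apply: measurable_maxr; first exact: measurableT_comp.
    by apply: measurable_minr => //; exact: mLu.
  apply: (@ae_integrable _ _ _ mu Lm) => //; first exact: mLu.
    apply: filterS (Lu _ _ fu) => x; rewrite ler_norml => /andP[l1 l2].
    by rewrite /Lm (min_l l2) (max_r l1).
  apply: (@le_integrable _ _ _ mu setT measurableT _ (EFin \o sigma)) => //.
    exact/measurable_EFinP.
  move=> x _ /=; rewrite lee_fin (ger0_norm (sg0 x)) ler_norml /Lm.
  by rewrite le_max lexx/= ge_max ge_min lexx orbT andbT; have := sg0 x; lra.
split=> //.
have Llow u q : feas u q -> - (\int[mu]_x sigma x) <= \int[mu]_x L x (u x).
  move=> fu; have iN := integrableZl measurableT (-1) isg.
  have -> : - (\int[mu]_x sigma x) = \int[mu]_x (-1 * sigma x) by rewrite RintegralZl//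
    mulN1r.
  apply: ae_le_Rintegral => //; first exact: LI fu.
  by apply: filterS (Lu _ _ fu) => x; rewrite ler_norml mulN1r => /andP[].
have clow q : adm q -> 0 <= control_cost q.
  by move=> aq; apply: Rintegral_ge0 => x _;
    rewrite addr_ge0// mulr_ge0// ?sqr_ge0// divr_ge0.
pose S := [set t | exists u q, feas u q /\ total_cost u q = t].
have adm0 : adm (cst 0).
  by split=> // x _; rewrite /= alpha0 beta0.
have Sinf : has_inf S.
  split.
    have [_ [u hu us]] := HM' _ adm0.
    by exists (total_cost u (cst 0)), u, (cst 0); split.
  exists (- (\int[mu]_x sigma x)) => _ [u [q [fu <-]]].
  have := Llow _ _ fu; have [_ aq _] := fu; have := clow _ aq.
  rewrite /total_cost; move: (control_cost q) (\int[mu]_x sigma x) (\int[mu]_x L x (u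
    x)) => ? ? ?; lra.
have /choice[uq Huq] k : exists uq : (T -> R) * (T -> R),
    feas uq.1 uq.2 /\ total_cost uq.1 uq.2 <= inf S + k.+1%:R^-1.
  have k0 : 0 < k.+1%:R^-1 :> R by rewrite invr_gt0.
  have [_ [u [q [fu <-]]] lt] := inf_adherent k0 Sinf.
  by exists (u, q); split => //; exact: ltW.
have fk k : feas (uq k).1 (uq k).2 by have [] := Huq k.
have [q [f [aq kf cells cost]]] := @adm_weak_limit (fun k => (uq k).2) (fun k => let:
  And3 _ z _ := fk k in z).
have [_ [u hu us]] := HM' _ aq.
have fu : feas u q by split.
exists u, q; split => //; first by exists M; exact: feasM fu.
pose u_ k := (uq (f k)).1; pose q_ k := (uq (f k)).2.
have fk' k : feas (u_ k) (q_ k) by exact: fk.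
have ecv := state_convergence fk' fu cells.
have hk k : H (u_ k) by have [] := fk' k.
have CP0 := es_CP_gt0 ES.
(* The rate [8 ^ -k] is the one [sq2_fast_cvg0] asks for; [k <= j] keeps the choice cofinal, so that
   the asymptotic estimates for the cost still apply. *)
have /choice[g Hg] k : exists j, (k <= j)%N /\ (sq2 mu (u_ j \- u)%R <= (8^-1 ^+
  k)%:E)%E.
  have d0 : 0 < 8^-1 ^+ k / CP :> R by rewrite divr_gt0// exprn_gt0// invr_gt0.
  have [N HN] := ecv _ d0; exists (maxn N k); split; first exact: leq_maxr.
  have hw := HB ES (hk (maxn N k)) hu.
  apply: le_trans (es_poincare ES hw) _; rewrite (energy_en ES hw) -EFinM lee_fin.
  by rewrite mulrC -ler_pdivlMr//; apply: HN; exact: leq_maxl.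
have ucv : {ae mu, forall x, (fun k => u_ (g k) x) @ \oo --> u x}.
  have := @sq2_fast_cvg0 _ _ _ mu (fun k => (u_ (g k) \- u)%R) _ (fun k => (Hg k).2).
  have mm k : mf (u_ (g k) \- u)%R by apply: measurable_funB; exact: H_mf.
  move=> /(_ mm); apply: filterS => x cx.
  rewrite -[X in _ --> X]add0r.
  rewrite (_ : (fun k => u_ (g k) x) = (fun k => (u_ (g k) x - u x) + u x)); last first.
    by apply/funext => k; rewrite subrK.
  by apply: cvgD => //; exact: cvg_cst.
have Lcv : (fun k => \int[mu]_x L x (u_ (g k) x)) @ \oo --> \int[mu]_x L x (u x).
  apply: (@Rintegral_dominated_cvg _ _ _ mu _ _ sigma) => //.
  - by move=> k; apply: mLu; exact: H_mf.
  - by apply: mLu; exact: H_mf.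
  - apply: filterS ucv => x cx.
    by apply: (@continuous_cvg _ _ _ _ _ (fun k => u_ (g k) x) (L x) (u x)) => //;
      exact: cL.
  - exact: (ae_foralln (fun k => Lu _ _ (fk' (g k)))).
have : total_cost u q <= inf S.
  rewrite /total_cost -lerBrDr; apply: (cvgn_dense _ Lcv) => e e0.
  have e2 : 0 < e / 2 by rewrite divr_gt0.
  have [N1 HN1] := cost _ e2; have [N2 HN2] := harmonic_small e2.
  exists (maxn N1 N2) => k; rewrite geq_max => /andP[k1 k2].
  have [gk _] := Hg k.
  have [_] := Huq (f (g k)); rewrite /total_cost -/(u_ (g k)) -/(q_ (g k)).
  have := HN1 _ (leq_trans k1 gk); have := HN2 _ (leq_trans k2 (leq_trans gk (kf _))).
  rewrite -/(q_ (g k)); move: (control_cost q) (control_cost _) (Rintegral _ _ _)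
    (_.+1%:R^-1) (inf S).
  by move=> ? ? ? ? ? ? ? ?; lra.
move=> h1 u' q' fu'; apply: le_trans h1 _; apply: ge_inf; first exact: Sinf.2.
by exists u', q'.
Qed.

End control.

(** * Supports and truncations in the closure of the test functions *)

Section Htilde_space.
Context {dd} {T : measurableType dd} {R : realType}.
Context (mu : {sigma_finite_measure set T -> \bar R}) (w : T * T -> R).
Context (test : set (T -> R)) (Om : set T).
Hypotheses (cmu : measure_is_complete mu) (mw : measurable_fun setT w).
Notation mf v := (measurable_fun setT (v : T -> R)).
Notation hs2 := (Hs_sq mu w).
Notation Htilde := (energy_closure mu w test).
Implicit Types (f u v phi : T -> R).
Hypotheses (mtest : forall phi, test phi -> mf phi).
Hypotheses (test_cst0 : test (cst 0)).
Hypotheses (testD : forall phi psi, test phi -> test psi -> test (phi \+ psi)%R).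
Hypotheses (testZ : forall k phi, test phi -> test (fun x => k * phi x)).
Hypotheses (test_off : forall phi x, test phi -> ~ Om x -> phi x = 0).
Hypotheses (test_posp : forall k e : R, 0 <= k -> 0 < e -> exists G : R -> R,
  [/\ measurable_fun setT G, G 0 = 0, forall t t', `|G t - G t'| <= `|t - t'|,
      forall t, `|G t - Num.max (t - k) 0| <= e &
      forall phi, test phi -> test (G \o phi)]).
Hypotheses (mOm : measurable Om) (Omoo : (mu Om < +oo)%E).

Lemma hs2_cst0 : hs2 (cst 0) = 0%E.
Proof.
have z dd' (U : measurableType dd') (m : {measure set U -> \bar R}) (f0 : U -> R) :
    (forall x : U, f0 x = 0 :> R) -> sq2 m f0 = 0%E.
  by move=> h; rewrite /sq2 -[RHS](@integral0 _ _ _ m setT); apply: eq_integral => x _;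
    rewrite h expr0n.
by rewrite /Hs_sq /nonlocal_energy !z ?adde0// => p;
  rewrite /weighted_diff /= subrr mul0r.
Qed.

Lemma test_Htilde phi : test phi -> (hs2 phi < +oo)%E -> Htilde phi.
Proof.
move=> tp pp; split => // [|e e0]; first exact: mtest.
exists phi => //; rewrite (_ : (phi \- phi)%R = cst 0) ?hs2_cst0//.
by apply/funext => x; rewrite /= subrr.
Qed.

Lemma Htilde_cst0 : Htilde (cst 0).
Proof. by apply: test_Htilde => //; rewrite hs2_cst0. Qed.

(** Off [Om] a test function vanishes, so there [v] coincides with [v - phi], whose L^2 norm is
    arbitrarily small. *)
Lemma Htilde_off v : Htilde v -> {ae mu, forall x, ~ Om x -> v x = 0}.
Proof.
move=> hv; have mv := Htilde_measurable hv.
pose v' x := v x * \1_(~` Om) x.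
have mv' : mf v'.
  by apply: measurable_funM => //; apply: measurable_indic; exact: measurableC.
have : {ae mu, forall x, v' x = 0}.
  apply: sq2_eq0 => //; apply/eqP; rewrite eq_le sq2_ge0 andbT;
    apply/lee_addgt0Pr => e e0.
  rewrite add0e; have [_ _ /(_ _ e0)[phi tphi lt]] := hv; have mphi := mtest tphi.
  apply: le_trans (ltW lt); apply: le_trans (sq2_le_hs2 _ _ _).
  apply: le_sq2 => //; first exact: measurable_funB.
  move=> x; rewrite /v' indicE; have [Ox|Ox] := pselect (Om x).
    by rewrite memNset ?mulr0 ?normr0//= => /(_ Ox).
  by rewrite mem_set// mulr1 /= (test_off tphi Ox) subr0.
apply: filterS => x + Ox; rewrite /v' indicE mem_set//=.
by rewrite mulr1.
Qed.

(** The [G j \o phi j] are test functions. Being 1-Lipschitz, [G j] does not increase norms, so they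
    are bounded in the full norm; they converge in L^2 since [G j] is uniformly close to the
    positive part and [Om] has finite measure. [Htilde_weak_closed] asks for no more. *)
Lemma Htilde_excess k v : 0 <= k -> Htilde v -> Htilde (excess k v).
Proof.
move=> k0 hv; have mv := Htilde_measurable hv.
have t0 j : 0 < j.+1%:R^-1 :> R by rewrite invr_gt0.
have /choice[phi Hphi] j : exists phi, test phi /\ (hs2 (v \- phi)%R <
  (j.+1%:R^-1)%:E)%E.
  by have [_ _ /(_ _ (t0 j))[phi ? ?]] := hv; exists phi.
have /choice[G HG] j := test_posp k0 (t0 j).
have tphi j : test (phi j) by have [] := Hphi j.
have mphi j : mf (phi j) by exact: mtest.
have mGp j : mf (G j \o phi j) by have [mG _ _ _ _] := HG j; exact: measurableT_comp.
have le1 j : j.+1%:R^-1 <= 1 :> R by rewrite invf_le1// ler1n.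
have hv0 := Htilde_lty hv.
pose D := 2 * fine (hs2 v) + 2.
have phiD j : (hs2 (phi j) <= D%:E)%E.
  rewrite (_ : phi j = (v \- (v \- phi j))%R); last by apply/funext => x /=; ring.
  apply: le_trans (hs2B_le mu mw mv (measurable_funB mv (mphi j))) _.
  have -> : D%:E = (2%:E * hs2 v + 2%:E)%E.
    by rewrite -[hs2 v in RHS]fineK// ge0_fin_numE ?hs2_ge0.
  apply: leeD => //.
  rewrite -[leRHS]mule1; apply: lee_wpmul2l => //.
  by have [_ /ltW/le_trans] := Hphi j; apply; rewrite lee_fin.
have GphiD j : (hs2 (G j \o phi j) <= D%:E)%E.
  have [mG G0 Glip _ _] := HG j; apply: le_trans (phiD j); apply: leeD.
    apply: le_sq2 => // x /=; have := Glip (phi j x) 0; by rewrite G0 !subr0.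
  apply: le_sq2; try exact: measurable_gd.
  by move=> p; rewrite /weighted_diff !normrM; apply: ler_wpM2r => //; exact: Glip.
apply: (@Htilde_weak_closed _ _ _ mu w cmu mw test mtest testD testZ (fun j => G j \o
  phi j) _ D).
- move=> j; apply: test_Htilde; first by have [_ _ _ _] := HG j; exact.
  by apply: le_lt_trans (GphiD j) _; rewrite ltry.
- by [].
- exact: measurable_excess.
- pose A := fine (mu Om).
  have A0 : 0 <= A by rewrite fine_ge0.
  have OmA : mu Om = A%:E by rewrite /A fineK// ge0_fin_numE.
  move=> e e0.
  have d0 : 0 < e / (2 * (A + 1)) by rewrite divr_gt0// mulr_gt0// ltr_wpDl.
  have [N HN] := harmonic_small d0.
  exists N => j /HN; rewrite /=; set t := j.+1%:R^-1 => tN.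
  have t1 : t <= 1 by exact: le1.
  have tp : 0 < t by exact: t0.
  have [mG G0 Glip Gap _] := HG j.
  have me : mf (excess k (phi j)) by exact: measurable_excess.
  have mev : mf (excess k v) by exact: measurable_excess.
  rewrite (_ : ((G j \o phi j) \- excess k v)%R =
     ((G j \o phi j \- excess k (phi j)) \+ (excess k (phi j) \- excess k v))%R);
       last first.
    by apply/funext => x /=; ring.
  apply: le_trans (sq2D_le _ _ _) _; try exact: measurable_funB.
  have s1 : (sq2 mu (G j \o phi j \- excess k (phi j))%R <= (t * A)%:E)%E.
    apply: (@le_trans _ _ (\int[mu]_x (t%:E * (\1_Om x)%:E))%E).
      apply: ge0_le_integral => //.
      - by move=> x _; rewrite lee_fin sqr_ge0.
      - by apply/measurable_EFinP; apply: measurable_funX; exact: measurable_funB.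
      - by apply: measurable_funeM; apply/measurable_EFinP; exact: measurable_indic.
      - move=> x _; rewrite -EFinM lee_fin indicE /excess /=;
        have [Ox|Ox] := pselect (Om x).
          rewrite mem_set// mulr1; have := Gap (phi j x); rewrite -/t => h.
          rewrite -real_normK ?num_real//; apply: (@le_trans _ _ (t ^+ 2)).
            by rewrite lerXn2r ?nnegrE// ltW.
          by rewrite expr2 -[leRHS]mulr1 ler_pM2l.
        rewrite memNset// mulr0 (test_off (tphi j) Ox) G0 sub0r.
        by rewrite sub0r max_r ?oppr_le0// oppr0 expr0n.
    rewrite ge0_integralZl_EFin ?(ltW tp)//; last by apply/measurable_EFinP;
      exact: measurable_indic.
    have -> : (\int[mu]_x (\1_Om x)%:E = A%:E)%E by rewrite integral_indic// setIT;
      exact: OmA.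
    by rewrite EFinM.
  have s2 : (sq2 mu (excess k (phi j) \- excess k v)%R <= t%:E)%E.
    apply: (@le_trans _ _ (sq2 mu (v \- phi j)%R)).
      apply: le_sq2; try exact: measurable_funB.
      move=> x; rewrite /excess /=; move: (phi j x) (v x) => y z.
      have [h1|h1] := leP (y - k) 0; have [h2|h2] := leP (z - k) 0;
        rewrite ler_norml; have := ler_norm (z - y); have := ler_norm (- (z - y));
        rewrite normrN => ? ?; apply/andP; split; lra.
    by have [_ /ltW lt] := Hphi j; exact: le_trans (sq2_le_hs2 _ _ _) lt.
  apply: (@le_trans _ _ (2%:E * (t * A)%:E + 2%:E * t%:E)%E).
    by apply: leeD; apply: lee_wpmul2l.
  rewrite -!EFinM -EFinD lee_fin.
  have -> : 2 * (t * A) + 2 * t = t * (2 * (A + 1)) by ring.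
  by rewrite -ler_pdivlMr// mulr_gt0// ltr_wpDl.
Qed.

Context (n : nat) (s c : R) (cube : T -> R -> set T).
Hypotheses (n_gt0 : (0 < n)%N) (c_gt0 : 0 < c) (s_gt0 : 0 < s) (s_lt : 2 * s < n%:R).
Hypotheses (mcube : forall x h, measurable (cube x h)).
Hypotheses (cubeE : forall x (h : R), 0 <= h -> mu (cube x h) = (h ^+ n)%:E).
Hypotheses (cubew : forall x y (h : R), 0 < h -> cube x h y -> x <> y ->
  1 <= c * h `^ (n%:R + 2 * s) * w (x, y) ^+ 2).

Lemma Htilde_energy_space : exists CS CP, energy_space mu w n s CS CP Om Htilde.
Proof.
have [CS CS0 sob] := sobolev mw n_gt0 c_gt0 mcube cubeE cubew s_gt0 s_lt.
(* The added 1 makes the bound on the measure positive, as [poincare] requires, even if [Om] is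
   null. *)
pose A := fine (mu Om) + 1.
have A0 : 0 < A by rewrite ltr_wpDl// fine_ge0.
have OmA : (mu Om <= A%:E)%E.
  by rewrite /A EFinD fineK ?ge0_fin_numE// leeDl.
have [CP CP0 poin] := poincare mw n_gt0 c_gt0 mcube cubeE cubew A0.
exists CS, CP; split => //.
- exact: Htilde_measurable.
- exact: Htilde_lty.
- exact: Htilde_cst0.
- exact: HtildeD.
- exact: HtildeZ.
- by move=> u v; exact: Htilde_ae.
- exact: Htilde_off.
- exact: Htilde_excess.
- exact: Htilde_complete.
- move=> v hv; have mv := Htilde_measurable hv.
  pose v' x := v x * \1_Om x.
  have vv : {ae mu, forall x, v x = v' x}.
    apply: filterS (Htilde_off hv) => x vx; rewrite /v' indicE.
    have [Ox|Ox] := pselect (Om x); first by rewrite mem_set// mulr1.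
    by rewrite vx// mul0r.
  have mv' : mf v' by apply: measurable_funM => //; exact: measurable_indic.
  rewrite (ae_sq2 mv mv' vv) (ae_energy mw mv mv' vv).
  by apply: (poin v' Om) => // x Ox; rewrite /v' indicE memNset// mulr0.
Qed.

End Htilde_space.

(** * From data given almost everywhere on the domain to data regular everywhere *)

Section ae_domain.
Context {dd} {T : measurableType dd} {R : realType}.
Context (mu : {measure set T -> \bar R}) (Om : set T).
Hypotheses (cmu : measure_is_complete mu) (mOm : measurable Om).
Notation mf v := (measurable_fun setT (v : T -> R)).
Implicit Types (f g : T -> R).

Let ae_patch f g : {ae mu, forall x, Om x -> f x = g x} -> (forall x, ~ Om x -> g x =
  0) ->
  {ae mu, forall x, g x = (f \_ Om) x}.
Proof.
move=> fg g0; apply: filterS fg => x fg; rewrite patchE.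
by case: ifPn => [/set_mem/fg//|/negP Ox]; apply: g0 => Ox'; apply: Ox; exact: mem_set.
Qed.

Lemma ae_domain_measurable f g : mf g -> {ae mu, forall x, Om x -> f x = g x} ->
  (forall x, ~ Om x -> g x = 0) -> mf (f \_ Om).
Proof. by move=> mg fg g0; apply: ae_measurable_real cmu (ae_patch fg g0) mg. Qed.

Lemma ae_domain_integral f g : mf g -> {ae mu, forall x, Om x -> f x = g x} ->
  (forall x, ~ Om x -> g x = 0) ->
  (\int[mu]_(x in Om) (f x)%:E = \int[mu]_x (g x)%:E)%E.
Proof.
move=> mg fg g0; have mfO := ae_domain_measurable mg fg g0.
rewrite integral_mkcond.
rewrite (_ : _ \_ _ = EFin \o (f \_ Om)); last first.
  by apply/funext => x /=; rewrite !patchE; case: ifP.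
apply: ae_eq_integral => //; try exact/measurable_EFinP.
by apply: filterS (ae_patch fg g0) => x /= -> _.
Qed.

Lemma ae_domain_Rintegral f g : mf g -> {ae mu, forall x, Om x -> f x = g x} ->
  (forall x, ~ Om x -> g x = 0) ->
  \int[mu]_(x in Om) f x = \int[mu]_x g x.
Proof. by move=> mg fg g0; congr fine; exact: ae_domain_integral. Qed.

Lemma ae_domain_integrable f g : mf g -> {ae mu, forall x, Om x -> f x = g x} ->
  (forall x, ~ Om x -> g x = 0) ->
  mu.-integrable Om (fun x => (f x)%:E) <-> mu.-integrable setT (EFin \o g).
Proof.
move=> mg fg g0; have mfO := ae_domain_measurable mg fg g0.
have gf := ae_patch fg g0.
have e : (fun x => (f x)%:E) \_ Om = EFin \o (f \_ Om).
  by apply/funext => x /=; rewrite !patchE; case: ifP.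
split=> h.
  have := (integrable_mkcond _ mOm).1 h; rewrite e.
  by apply: ae_integrable => //; apply: filterS gf => x ->.
by apply/(integrable_mkcond _ mOm); rewrite e; exact: ae_integrable gf h.
Qed.

(** Replacing [a x] by the zero function off [Om] and on the exceptional null set, which is
    measurable by completeness, makes the property [P] hold at every point. *)
Lemma regular_representative (a : T -> R -> R) (P : T -> (R -> R) -> Prop) :
  (forall t, measurable_fun Om (a ^~ t)) ->
  {ae mu, forall x, Om x -> P x (a x)} -> (forall x, P x (fun _ => 0)) ->
  exists b : T -> R -> R, [/\ forall t, mf (b ^~ t), forall x, P x (b x),
    forall x, ~ Om x -> b x = (fun _ => 0) & {ae mu, forall x, Om x -> a x = b x}].
Proof.
move=> ma aP P0.
pose N := [set x | ~ (Om x -> P x (a x))].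
have mN : measurable N by apply: cmu.
pose S := Om `\` N.
have mS : measurable S by exact: measurableD.
pose b x t := (a ^~ t \_ S) x.
have bS x : S x -> b x = a x.
  by move=> Sx; apply/funext => t; rewrite /b patchE mem_set.
have bN x : ~ S x -> b x = fun _ => 0.
  by move=> Sx; apply/funext => t; rewrite /b patchE memNset.
exists b; split.
- move=> t; apply/(measurable_restrictT _ mS); apply: measurable_funS (ma t) => //.
  by move=> x [].
- move=> x; have [Sx|Sx] := pselect (S x); last by rewrite bN.
  rewrite bS//; have [Ox Nx] := Sx.
  exact: (contrapT Nx) Ox.
- by move=> x Ox; apply: bN => -[].
- by apply: filterS aP => x xP Ox; rewrite bS//; split => // -[].
Qed.

End ae_domain.

Section domain_control.
Context {dd} {T : measurableType dd} {R : realType}.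
Context (mu : {sigma_finite_measure set T -> \bar R}) (w : T * T -> R).
Context (n : nat) (s CS CP : R) (Om : set T) (H : set (T -> R)).
Hypothesis ES : energy_space mu w n s CS CP Om H.
Let p' := 2 * n%:R / (n%:R + 2 * s).
Notation mf v := (measurable_fun setT (v : T -> R)).
Notation eform := (energy_form mu w).
Implicit Types (f q u v : T -> R).
Let H_mf := es_measurable ES.
Let cmu := es_complete_measure ES.
Let mOm := es_measurable_domain ES.
Let Omoo := es_finite_domain ES.
Context (c : R) (h : nat -> R) (K : nat -> nat) (Q : forall N, 'I_(K N) -> set T).
Hypotheses (c_gt0 : 0 < c) (h_gt0 : forall N, 0 < h N).
Hypotheses (h_small : forall e : R, 0 < e -> exists N, h N <= e).
Hypotheses (mQ : forall N i, measurable (@Q N i)).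
Hypotheses (QE : forall N i, mu (@Q N i) = (h N ^+ n)%:E).
Hypotheses (tQ : forall N (i j : 'I_(K N)) x, Q i x -> Q j x -> i = j).
Hypotheses (Qw : forall N (i : 'I_(K N)) x y, Q i x -> Q i y -> x <> y ->
  1 <= c * h N `^ (n%:R + 2 * s) * w (x, y) ^+ 2).
Hypotheses (Qcov : forall N x, Om x -> exists i : 'I_(K N), Q i x).
Context (a L : T -> R -> R) (kap r alpha beta lam nu : R).
Hypotheses (kap0 : 0 < kap) (rn : n%:R / (2 * s) < r).
Hypotheses (ma : forall t, measurable_fun Om (a ^~ t)).
Hypotheses (ca : {ae mu, forall x, Om x -> continuous (a x)}).
Hypotheses (ha : {ae mu, forall x, Om x -> {homo a x : t t' / t <= t'}}).
Hypotheses (ar : (\int[mu]_x (`|(a ^~ 0 \_ Om) x| `^ r)%:E < +oo)%E).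
Hypotheses (ap : forall m : R, 0 < m -> exists phi : T -> R, [/\ mf (phi \_ Om),
  (\int[mu]_x (`|(phi \_ Om) x| `^ p')%:E < +oo)%E &
  {ae mu, forall x, Om x -> forall t, - m <= t <= m -> `|a x t| <= phi x}]).
Hypotheses (mL : forall t, measurable_fun Om (L ^~ t)).
Hypotheses (cL : {ae mu, forall x, Om x -> continuous (L x)}).
Hypotheses (bL : forall m : R, 0 < m -> exists sigma : T -> R, [/\ mf (sigma \_ Om),
  (\int[mu]_x `|(sigma \_ Om) x|%:E < +oo)%E &
  {ae mu, forall x, Om x -> forall t, - m <= t <= m -> `|L x t| <= sigma x}]).
Hypotheses (alpha0 : alpha <= 0) (beta0 : 0 <= beta) (lam0 : 0 <= lam) (nu0 : 0 <= nu).

Definition domain_feasible u q := [/\ H u, mf (q \_ Om),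
  {ae mu, forall x, Om x -> alpha <= q x <= beta} &
  forall v, H v -> mu.-integrable Om (fun x => (a x (u x) * v x)%:E) /\
    2 * kap * eform u v + \int[mu]_(x in Om) (a x (u x) * v x) =
      \int[mu]_(x in Om) (q x * v x)].

Definition domain_cost u q : \bar R :=
  (\int[mu]_(x in Om) (L x (u x))%:E + (lam / 2)%:E * sq2 mu (q \_ Om) +
   nu%:E * \int[mu]_x `|(q \_ Om) x|%:E)%E.

Lemma domain_optimal_control : exists u q, [/\ domain_feasible u q,
  (sq2 mu (q \_ Om) < +oo)%E, exists M : R, {ae mu, forall x, `|u x| <= M} &
  forall u' q', domain_feasible u' q' -> (domain_cost u q <= domain_cost u' q')%E].
Proof.
(* Each growth bound has its own null set and there are uncountably many levels; integer levels
   suffice by monotonicity of the range and leave a countable union of null sets. *)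
pose m k : R := k.+1%:R.
have m0 k : 0 < m k by [].
have m_ub (M : R) : exists k, M <= m k.
  exists (Num.bound `|M|); rewrite /m; apply: le_trans (ler_norm _) _; apply: ltW.
  by apply: lt_le_trans (archi_boundP (normr_ge0 M)) _; rewrite ler_nat.
have [phi Hphi] := choice (fun k => ap (m0 k)).
have [sigma Hsigma] := choice (fun k => bL (m0 k)).
pose phi' k := phi k \_ Om; pose sigma' k := sigma k \_ Om.
pose Pa x (f : R -> R) := [/\ continuous f, {homo f : t t' / t <= t'} &
  forall k t, `|t| <= m k -> `|f t| <= `|phi' k x|].
pose PL x (f : R -> R) := continuous f /\
  forall k t, `|t| <= m k -> `|f t| <= `|sigma' k x|.
have aPa : {ae mu, forall x, Om x -> Pa x (a x)}.
  have ap' : {ae mu, forall x, forall k, Om x -> forall t, - m k <= t <= m k -> `|a x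
    t| <= phi k x}.
    by apply: ae_foralln => k; have [] := Hphi k.
  apply: filterS3 ca ha ap' => x c1 h1 p1 Ox; split; [exact: c1|exact: h1|] => k t tm.
  rewrite /phi' patchE mem_set//; apply: le_trans (ler_norm _).
  by apply: p1 => //; rewrite -ler_norml.
have LPL : {ae mu, forall x, Om x -> PL x (L x)}.
  have bL' : {ae mu, forall x, forall k, Om x -> forall t, - m k <= t <= m k -> `|L x
    t| <= sigma k x}.
    by apply: ae_foralln => k; have [] := Hsigma k.
  apply: filterS2 cL bL' => x c1 p1 Ox; split; [exact: c1|] => k t tm.
  rewrite /sigma' patchE mem_set//; apply: le_trans (ler_norm _).
  by apply: p1 => //; rewrite -ler_norml.
have c00 : continuous (fun _ : R => 0 : R) by move=> t; exact: cvg_cst.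
have Pa0 x : Pa x (fun _ => 0) by split => // k t _; rewrite normr0.
have PL0 x : PL x (fun _ => 0) by split => // k t _; rewrite normr0.
have [b [mb bP b0 ab]] := regular_representative cmu mOm ma aPa Pa0.
have [L' [mL' LP L0 LL]] := regular_representative cmu mOm mL LPL PL0.
have cb x : continuous (b x) by have [] := bP x.
have hb x : {homo b x : t t' / t <= t'} by have [] := bP x.
have cL' x : continuous (L' x) by have [] := LP x.
have br : (\int[mu]_x (`|b x 0| `^ r)%:E < +oo)%E.
  suff -> : (\int[mu]_x (`|b x 0| `^ r)%:E = \int[mu]_x (`|(a ^~ 0 \_ Om) x| `^
    r)%:E)%E.
    exact: ar.
  have mp := @measurable_powR_norm _ T R.
  have ma0 : mf (a ^~ 0 \_ Om) by apply/(measurable_restrictT _ mOm); exact: ma.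
  apply: ae_eq_integral; [exact: measurableT|exact: mp|exact: mp|].
  apply: filterS ab => x xab _; congr (`|_| `^ _)%:E; rewrite patchE.
  by case: ifPn => [/set_mem/xab->//|/negP Ox]; rewrite b0// => Ox'; apply: Ox;
    exact: mem_set.
have bp (M : R) : 0 < M -> exists psi : T -> R, [/\ mf psi,
    (\int[mu]_x (`|psi x| `^ p')%:E < +oo)%E & forall x t, `|t| <= M -> `|b x t| <= psi
      x].
  move=> M0; have [k Mk] := m_ub M; have [mphi phioo _] := Hphi k.
  exists (fun x => `|phi' k x|); split.
  - exact: measurableT_comp (@normr_measurable _ _) mphi.
  - by under eq_integral do rewrite normr_id.
  - by move=> x t tM; have [_ _ h1] := bP x; apply: h1; exact: le_trans tM Mk.
have bL' (M : R) : 0 < M -> exists2 tau : T -> R,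
    mu.-integrable setT (EFin \o tau) & forall x t, `|t| <= M -> `|L' x t| <= tau x.
  move=> M0; have [k Mk] := m_ub M; have [msig sigoo _] := Hsigma k.
  exists (fun x => `|sigma' k x|).
    apply/integrableP; split.
      by apply/measurable_EFinP; exact: measurableT_comp (@normr_measurable _ _) msig.
    rewrite (_ : (\int[mu]_x _)%E = \int[mu]_x `|sigma' k x|%:E)%E//.
    by apply: eq_integral => x _; rewrite /= normr_id.
  by move=> x t tM; have [_ h1] := LP x; apply: h1; exact: le_trans tM Mk.
have := optimal_control ES c_gt0 h_gt0 h_small mQ QE tQ Qw Qcov kap0 rn mb cb hb br bp
  mL' cL' bL' alpha0 beta0 lam0 nu0.
set F := feas _ _ _ _ _ _ _ _; set J := total_cost _ _ _ _.
move=> [LI [u [q [fu uM qmin]]]].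
have mbu v : mf v -> mf (fun x => b x (v x)) by exact: caratheodory_comp.
have auv v z : H v -> H z -> [/\ mf (fun x => b x (v x) * z x),
    {ae mu, forall x, Om x -> a x (v x) * z x = b x (v x) * z x} &
    forall x, ~ Om x -> b x (v x) * z x = 0].
  move=> hv hz; split.
  - by apply: measurable_funM; [exact: mbu (H_mf hv)|exact: H_mf].
  - by apply: filterS ab => x xab Ox; rewrite xab.
  - by move=> x Ox; rewrite b0// mul0r.
have adm_sq2 p : adm Om alpha beta p -> (sq2 mu p < +oo)%E.
  move=> ap1; have [mp _ p0] := ap1.
  have h2 : 0 < 2 :> R by [].
  have OmA : (mu Om <= (fine (mu Om))%:E)%E by rewrite fineK// ge0_fin_numE.
  have := integral_powR_bounded_le h2 mp mOm OmA p0 (fun x => adm_bound x ap1).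
  move=> h1; apply: le_lt_trans (le_trans _ h1) (ltry _).
  rewrite le_eqVlt; apply/orP; left; apply/eqP.
  by apply: eq_integral => x _; rewrite powR_mulrn// real_normK ?num_real.
have qvI p v : adm Om alpha beta p -> H v -> mu.-integrable setT (EFin \o (fun x => p x
  * v x)).
  by move=> ap1 hv; apply: sq2_mul_integrable;
    [exact: adm_mf ap1|exact: H_mf|exact: adm_sq2|exact: H_sq2 ES _ hv].
have adm_patch p : adm Om alpha beta p -> p \_ Om = p.
  move=> [_ _ p0]; apply/funext => x; rewrite patchE; case: ifPn => // /negP Ox.
  by rewrite p0// => Ox'; apply: Ox; exact: mem_set.
have costE v p p1 : F v p -> {ae mu, forall x, (p1 \_ Om) x = p x} -> mf (p1 \_ Om) ->
    domain_cost v p1 = (J v p)%:E.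
  move=> fv pp mp1; have [hv ap1 _] := fv; have mp := adm_mf ap1.
  rewrite /domain_cost (ae_sq2 mp1 mp pp).
  have -> : (\int[mu]_x `|(p1 \_ Om) x|%:E = \int[mu]_x `|p x|%:E)%E.
    apply: ae_eq_integral; [exact: measurableT| | |].
    - by apply/measurable_EFinP; exact: measurableT_comp (@normr_measurable _ _) mp1.
    - by apply/measurable_EFinP; exact: measurableT_comp (@normr_measurable _ _) mp.
    - by apply: filterS pp => x -> _.
  rewrite (@ae_domain_integral _ _ _ mu Om cmu _ (fun x => L' x (v x))); first last.
  - by move=> x Ox; rewrite L0.
  - by apply: filterS LL => x xL Ox; rewrite xL.
  - by apply: caratheodory_comp => //; exact: H_mf.
  have Ip := adm_integrable ES ap1 measurableT.
  have I2 : mu.-integrable setT (EFin \o (fun x => p x ^+ 2)) by apply: sq2_integrable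
    => //; exact: adm_sq2.
  have I1 : mu.-integrable setT (EFin \o (fun x => `|p x|)) := integrable_norm Ip.
  rewrite /J /total_cost /control_cost RintegralD//; first last.
  - by have := integrableZl measurableT nu I1.
  - by have := integrableZl measurableT (lam / 2) I2.
  rewrite RintegralZl// RintegralZl// -fine_sq2 !EFinD !EFinM !fineK ?addeA//.
  - exact: integrable_fin_num I1.
  - by rewrite ge0_fin_numE ?sq2_ge0//; exact: adm_sq2.
  - exact: integrable_fin_num (LI _ _ fv).
have feas_domain v p : F v p -> domain_feasible v p.
  move=> [hv ap1 vs]; have [mp pab p0] := ap1; split=> //.
  - by rewrite adm_patch.
  - by apply: nearW => x Ox; exact: pab.
  move=> z hz; have [h1 h2 h3] := auv _ _ hv hz; have [I1 e1] := vs z hz.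
  have Ipz := qvI _ _ ap1 hz.
  have Ib : mu.-integrable setT (EFin \o (fun x => b x (v x) * z x)).
    rewrite (_ : (fun x => b x (v x) * z x) = (fun x => p x * z x - (p x - b x (v x)) *
      z x)).
      by have := integrableB measurableT Ipz I1.
    by apply/funext => x; ring.
  split; first by apply/(ae_domain_integrable cmu mOm h1 h2 h3).
  rewrite (ae_domain_Rintegral cmu h1 h2 h3) e1.
  rewrite (@ae_domain_Rintegral _ _ _ mu Om cmu _ (fun x => p x * z x)); first last.
  - by move=> x Ox; rewrite p0// mul0r.
  - by apply: nearW.
  - by apply: measurable_funM => //; exact: H_mf.
  rewrite -RintegralD//; apply: eq_Rintegral => x _ /=; ring.
have domain_feas v p : domain_feasible v p -> exists2 p1, F v p1 & {ae mu, forall x, (p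
  \_ Om) x = p1 x}.
  move=> [hv mp pab vs].
  (* Clipping changes the control only on a null set and enforces the bounds at every point, as
     [adm] requires. *)
  pose p1 x := if x \in Om then Num.max alpha (Num.min beta ((p \_ Om) x)) else 0.
  have pp : {ae mu, forall x, (p \_ Om) x = p1 x}.
    apply: filterS pab => x xab; rewrite /p1 patchE;
      case: ifPn => // /set_mem/xab/andP[x1 x2].
    by rewrite (min_r x2) (max_r x1).
  have mp1 : mf p1 by exact: ae_measurable_real cmu pp mp.
  have p10 x : ~ Om x -> p1 x = 0 by move=> Ox; rewrite /p1 memNset.
  have ap1 : adm Om alpha beta p1.
    split=> // x Ox; rewrite /p1 mem_set// le_max lexx/= ge_max ge_min lexx andbT.
    by rewrite (le_trans alpha0 beta0).
  exists p1 => //; split => // z hz; have [h1 h2 h3] := auv _ _ hv hz;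
    have [I1 e1] := vs z hz.
  have Ib := (ae_domain_integrable cmu mOm h1 h2 h3).1 I1.
  have Ipz := qvI _ _ ap1 hz.
  have E x : (p1 x - b x (v x)) * z x = p1 x * z x - b x (v x) * z x by ring.
  split.
    by under eq_fun do rewrite E; have := integrableB measurableT Ipz Ib.
  under eq_Rintegral do rewrite E.
  rewrite RintegralB// -(ae_domain_Rintegral cmu h1 h2 h3).
  rewrite -(@ae_domain_Rintegral _ _ _ mu Om cmu (fun x => p x * z x)) -?e1 ?addrK//.
  - by apply: measurable_funM => //; exact: H_mf.
  - by apply: filterS pp => x + Ox; rewrite patchE mem_set// => ->.
  - by move=> x Ox; rewrite p10// mul0r.
have [hu aq _] := fu.
exists u, q; split => //.
- exact: feas_domain.
- by rewrite adm_patch//; exact: adm_sq2.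
- move=> u' q' /[dup] -[_ mq' _ _] /domain_feas[p1 fp pp].
  have qq : {ae mu, forall x, (q \_ Om) x = q x} by apply: nearW => x;
    rewrite adm_patch.
  have mq : mf (q \_ Om) by rewrite adm_patch//; exact: adm_mf aq.
  rewrite (costE _ _ _ fu qq mq) (costE _ _ _ fp pp mq') lee_fin.
  exact: qmin.
Qed.

End domain_control.

(** * Test functions and the space H^~s(Omega) *)

Section smooth_functions.
Context {R : realType} {d : nat}.
Implicit Types (f g : 'rV[R]_d -> R) (i : 'I_d).
Notation pd i f := ('D_(delta_mx ord0 i) f).

(** Smoothness graded by order: the product and chain rules express a derivative through functions
    of one order less, which calls for induction on [k]. *)
Definition smooth_upto (k : nat) f := forall (l : seq 'I_d), (size l <= k)%N ->
  forall x, differentiable (partials l f) x.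

Lemma smoothP f : smooth f <-> forall k, smooth_upto k f.
Proof.
by split=> [sf k l _ x|sf l x]; [exact: sf|exact: (sf (size l) l (leqnn _))].
Qed.

Lemma smooth_upto0 f : smooth_upto 0 f <-> forall x, differentiable f x.
Proof. by split=> [h x|h [|//] _ x]; [exact: (h [::])|exact: h]. Qed.

(** [partials] differentiates first in the last direction of the list, so the recursion splits lists
    at their end. *)
Lemma smooth_uptoS k f : smooth_upto k.+1 f <->
  (forall x, differentiable f x) /\ forall i, smooth_upto k (pd i f).
Proof.
split=> [h|[h0 h] l].
  split=> [x|i l lk x]; first exact: (h [::]).
  by have := h (rcons l i); rewrite size_rcons /partials foldr_rcons; exact.
case/lastP: l => [|l i] lk x; first exact: h0.
by rewrite /partials foldr_rcons; apply: h; rewrite size_rcons in lk.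
Qed.

Lemma smooth_uptoW k f : smooth_upto k.+1 f -> smooth_upto k f.
Proof. by move=> h l lk; apply: h; exact: leqW. Qed.

Lemma smooth_upto_cst k (c : R) : smooth_upto k (fun _ => c).
Proof.
elim: k c => [|k ih] c; first by apply/smooth_upto0 => x; exact: differentiable_cst.
apply/smooth_uptoS; split=> [x|i]; first exact: differentiable_cst.
rewrite (_ : pd i _ = fun _ => 0)//; apply/funext => x; exact: derive_cst.
Qed.

Lemma smooth_uptoD k f g : smooth_upto k f -> smooth_upto k g ->
  smooth_upto k (fun x => f x + g x).
Proof.
elim: k f g => [|k ih] f g.
  move=> /smooth_upto0 hf /smooth_upto0 hg; apply/smooth_upto0 => x.
  exact: (differentiableD (hf x) (hg x)).
move=> /smooth_uptoS[df hf] /smooth_uptoS[dg hg]; apply/smooth_uptoS; split=> [x|i].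
  exact: (differentiableD (df x) (dg x)).
rewrite (_ : pd i _ = fun x => pd i f x + pd i g x); first exact: ih.
by apply/funext => x; apply: deriveD; exact: diff_derivable.
Qed.

Lemma smooth_uptoM k f g : smooth_upto k f -> smooth_upto k g ->
  smooth_upto k (fun x => f x * g x).
Proof.
elim: k f g => [|k ih] f g.
  move=> /smooth_upto0 hf /smooth_upto0 hg; apply/smooth_upto0 => x.
  exact: (differentiableM (hf x) (hg x)).
move=> sf sg; have [df hf] := (smooth_uptoS k f).1 sf;
  have [dg hg] := (smooth_uptoS k g).1 sg.
apply/smooth_uptoS; split=> [x|i].
  exact: (differentiableM (df x) (dg x)).
rewrite (_ : pd i _ = fun x => f x * pd i g x + g x * pd i f x).
  by apply: smooth_uptoD; apply: ih => //; exact: smooth_uptoW.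
by apply/funext => x; apply: deriveM; exact: diff_derivable.
Qed.

Lemma chain_rule (h : R -> R) f x (l : R) v : is_derive (f x) 1 h l ->
  differentiable f x ->
  differentiable (h \o f) x /\ 'D_v (h \o f) x = l * 'D_v f x.
Proof.
move=> dh df.
have hd : differentiable h (f x) by apply/derivable1_diffP; exact: ex_derive.
have hfd : differentiable (h \o f) x by exact: differentiable_comp.
split => //.
rewrite deriveE// diff_comp//= diff1E//= derive1E derive_val deriveE//.
by rewrite mulrC.
Qed.

(* Its derivative is [- t * jinv t ^+ 3], so the algebra generated by [jinv \o f],
   [f] and the derivatives of a smooth [f] is stable under differentiation. *)
Let jinv (t : R) : R := (1 + t ^+ 2) `^ (- 2^-1).

Let jpos (t : R) : 0 < 1 + t ^+ 2.
Proof. by rewrite ltr_pwDl// sqr_ge0. Qed.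

Let is_derive_jinv (t : R) : is_derive t 1 jinv (- t * jinv t ^+ 3).
Proof.
have d1 : is_derive t 1 (fun z : R => 1 + z ^+ 2) (2 * t).
  have h := is_deriveD (is_derive_cst (1 : R) t 1) (is_deriveX 2 (is_derive_id t (1 :
    R))).
  have -> : (fun z : R => 1 + z ^+ 2) = cst 1 + id ^+ 2 by apply/funext => z;
    rewrite fctE exprfctE.
  by apply: (is_derive_eq h); rewrite /GRing.scale/=; ring.
have := @is_derive1_comp R (fun z => z `^ (- 2^-1)) (fun z => 1 + z ^+ 2) t _ _
    (is_derive1_powR (- 2^-1) (jpos t)) d1.
rewrite -/jinv (_ : _ * _ = - t * jinv t ^+ 3)//.
have -> : jinv t ^+ 3 = (1 + t ^+ 2) `^ (- 2^-1 - 1).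
  rewrite /jinv -powR_mulrn ?powR_ge0// -powRrM; congr (_ `^ _); lra.
by field.
Qed.

Lemma smooth_jinv k f : smooth f -> smooth_upto k (jinv \o f).
Proof.
move=> /smoothP sf.
have df x : differentiable f x by have /smooth_upto0 := sf 0%N; exact.
elim: k => [|k ih].
  by apply/smooth_upto0 => x; have [] := chain_rule 0 (is_derive_jinv (f x)) (df x).
apply/smooth_uptoS; split=> [x|i].
  by have [] := chain_rule 0 (is_derive_jinv (f x)) (df x).
have /smooth_uptoS[_ /(_ i) sdf] := sf k.+1.
rewrite (_ : pd i _ = fun x => ((-1 * f x) * ((jinv \o f) x * ((jinv \o f) x * (jinv \o
  f) x))) * pd i f x).
  do ![apply: smooth_uptoM => //]; exact: smooth_upto_cst.
apply/funext => x; have [_ ->] := chain_rule (delta_mx ord0 i) (is_derive_jinv (f x))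
  (df x).
by rewrite /=; ring.
Qed.

Variable Omega : set 'rV[R]_d.

Lemma test_function_cst0 : test_function Omega (fun _ => 0 : R).
Proof.
have e : [set x : 'rV[R]_d | (0 : R) != 0] = set0.
  by apply/seteqP; split=> x //=; rewrite eqxx.
rewrite /test_function e closure0; split => //.
- by apply/smoothP => k; exact: smooth_upto_cst.
- exact: compact0.
Qed.

Lemma test_functionD f g : test_function Omega f -> test_function Omega g ->
  test_function Omega (f \+ g).
Proof.
move=> [sf cf of'] [sg cg og].
have sub : closure [set x | (f \+ g) x != 0] `<=`
    closure [set x | f x != 0] `|` closure [set x | g x != 0].
  rewrite -closureU; apply: closure_subset => x /= h.
  have [fx|fx] := eqVneq (f x) 0; [right|by left].
  by move: h; rewrite fx add0r.
split.
- by apply/smoothP => k; apply: smooth_uptoD;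
  [exact: (smoothP f).1 sf k|exact: (smoothP g).1 sg k].
- apply: subclosed_compact sub; first exact: closed_closure.
  exact: compactU.
- by apply: subset_trans sub _; rewrite subUset.
Qed.

Lemma test_function_support f g : test_function Omega f -> smooth g ->
  (forall x, f x = 0 -> g x = 0) -> test_function Omega g.
Proof.
move=> [_ cf of'] sg fg.
have sub : closure [set x | g x != 0] `<=` closure [set x | f x != 0].
  by apply: closure_subset => x /=; apply: contra_neq; exact: fg.
split=> //; last exact: subset_trans sub of'.
by apply: subclosed_compact sub => //; exact: closed_closure.
Qed.

Lemma test_functionZ (k : R) f : test_function Omega f ->
  test_function Omega (fun x => k * f x).
Proof.
move=> tf; apply: (test_function_support tf) => [|x ->]; last by rewrite mulr0.
have [/smoothP sf _ _] := tf; apply/smoothP => j.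
by apply: smooth_uptoM => //; exact: smooth_upto_cst.
Qed.

Lemma test_function_off f x : test_function Omega f -> ~ Omega x -> f x = 0.
Proof.
move=> [_ _ of'] Ox; apply/eqP; apply: contrapT => /negP fx; apply: Ox.
by apply: of'; exact: subset_closure.
Qed.

(* The constant makes it vanish at 0, so that composing with it does not enlarge
   supports. *)
Definition smooth_excess (k e t : R) : R :=
  (t - k + Num.sqrt ((t - k) ^+ 2 + e ^+ 2)) / 2 -
  (- k + Num.sqrt (k ^+ 2 + e ^+ 2)) / 2.

Lemma smooth_excess0 k e : smooth_excess k e 0 = 0.
Proof. by rewrite /smooth_excess sub0r sqrrN subrr. Qed.

Lemma sqrt_sqrD_bound (x e : R) : 0 <= e ->
  `|x| <= Num.sqrt (x ^+ 2 + e ^+ 2) <= `|x| + e.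
Proof.
move=> e0; apply/andP; split.
  by rewrite -sqrtr_sqr ler_sqrt ?addr_ge0 ?sqr_ge0// lerDl sqr_ge0.
have xe : 0 <= `|x| + e by rewrite addr_ge0.
rewrite -[leRHS](ger0_norm xe) -sqrtr_sqr ler_sqrt ?sqr_ge0//.
rewrite -(real_normK (num_real x)); have := mulr_ge0 (normr_ge0 x) e0; nra.
Qed.

(** With [x = t - k], the positive part is half of [x + |x|]. Replacing [|x|] by the square root
    costs at most [e / 2], and for [k >= 0] the subtracted constant is also between 0 and
    [e / 2]. *)
Lemma smooth_excess_approx k e t : 0 <= k -> 0 < e ->
  `|smooth_excess k e t - Num.max (t - k) 0| <= e.
Proof.
move=> k0 e0; have /andP[a1 a2] := sqrt_sqrD_bound (t - k) (ltW e0).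
have /andP[b1 b2] := sqrt_sqrD_bound k (ltW e0).
rewrite (ger0_norm k0) in b1 b2.
rewrite /smooth_excess; move: (Num.sqrt _) (Num.sqrt _) a1 a2 b1 b2 => y z a1 a2 b1 b2.
rewrite ler_norml; apply/andP.
have [h|h] := leP (t - k) 0.
  by rewrite (ler0_norm h) in a1 a2; split; lra.
by rewrite (gtr0_norm h) in a1 a2; split; lra.
Qed.

Lemma smooth_excess_lip k e t t' : 0 < e ->
  `|smooth_excess k e t - smooth_excess k e t'| <= `|t - t'|.
Proof.
move=> e0; pose x := t - k; pose y := t' - k.
have pos z : 0 < z ^+ 2 + e ^+ 2 by rewrite ltr_wpDl ?sqr_ge0 ?exprn_gt0.
(* Rationalise: the difference of the roots times their sum is [(x - y) * (x + y)], and the sum of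
   the roots dominates [|x + y|]. *)
have h : `|Num.sqrt (x ^+ 2 + e ^+ 2) - Num.sqrt (y ^+ 2 + e ^+ 2)| <= `|x - y|.
  have /andP[a1 _] := sqrt_sqrD_bound x (ltW e0).
  have /andP[b1 _] := sqrt_sqrD_bound y (ltW e0).
  have xq := sqr_sqrtr (ltW (pos x)); have yq := sqr_sqrtr (ltW (pos y)).
  have p0 : 0 < Num.sqrt (x ^+ 2 + e ^+ 2) by rewrite sqrtr_gt0.
  have q0 : 0 < Num.sqrt (y ^+ 2 + e ^+ 2) by rewrite sqrtr_gt0.
  move: (Num.sqrt (x ^+ 2 + _)) (Num.sqrt (y ^+ 2 + _)) xq yq a1 b1 p0 q0 => p q xq yq
    a1 b1 p0 q0.
  have pq : 0 < p + q by rewrite addr_gt0.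
  rewrite -(ler_pM2r pq) -{1}(gtr0_norm pq) -normrM.
  have -> : (p - q) * (p + q) = (x - y) * (x + y) by rewrite -!subr_sqr; lra.
  rewrite normrM ler_wpM2l//; apply: le_trans (ler_normD _ _) _; lra.
have -> : smooth_excess k e t - smooth_excess k e t' =
  ((x - y) + (Num.sqrt (x ^+ 2 + e ^+ 2) - Num.sqrt (y ^+ 2 + e ^+ 2))) / 2.
  by rewrite /smooth_excess -/x -/y; lra.
have -> : t - t' = x - y by rewrite /x /y; lra.
rewrite normrM [`|2^-1|]ger0_norm// ler_pdivrMr//.
by apply: le_trans (ler_normD _ _) _; lra.
Qed.

Lemma test_function_smooth_excess k e f : 0 < e -> test_function Omega f ->
  test_function Omega (smooth_excess k e \o f).
Proof.
move=> e0 tf; apply: (test_function_support tf) => [|x /= ->];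
  last exact: smooth_excess0.
have [/smoothP sf _ _] := tf.
pose C := (- k + Num.sqrt (k ^+ 2 + e ^+ 2)) / 2.
pose y x := e^-1 * (f x + - k).
have sy j : smooth_upto j y.
  apply: smooth_uptoM; first exact: smooth_upto_cst.
  by apply: smooth_uptoD => //; exact: smooth_upto_cst.
apply/smoothP => j.
(* Since [sqrt (1 + y ^ 2) = (1 + y ^ 2) * jinv y], the composite is a polynomial in [y] and
   [jinv \o y], both known to be smooth. *)
rewrite (_ : _ \o _ = fun x => e / 2 * (y x + (1 + y x * y x) * (jinv \o y) x) + - C).
  apply: smooth_uptoD; last exact: smooth_upto_cst.
  apply: smooth_uptoM; first exact: smooth_upto_cst.
  apply: smooth_uptoD => //; apply: smooth_uptoM; last by apply: smooth_jinv;
    exact/smoothP.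
  by apply: smooth_uptoD; [exact: smooth_upto_cst|exact: smooth_uptoM].
apply/funext => x; rewrite /smooth_excess /= -/C; congr (_ - _).
have -> : (f x - k) ^+ 2 + e ^+ 2 = e ^+ 2 * (1 + y x ^+ 2).
  by rewrite /y; field; rewrite gt_eqF.
rewrite sqrtrM ?sqr_ge0// sqrtr_sqr gtr0_norm//.
have -> : (1 + y x * y x) * jinv (y x) = Num.sqrt (1 + y x ^+ 2).
  rewrite -expr2 /jinv -powR12_sqrt ?ltW//.
  rewrite -{1}[1 + y x ^+ 2]powRr1 ?ltW// -powRD ?(gt_eqF (jpos _))//.
    by congr (_ `^ _); lra.
  by apply/implyP.
have -> : f x - k = e * y x by rewrite /y mulrA mulfV ?mul1r// gt_eqF.
by field.
Qed.

End smooth_functions.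

(** * Cube meshes and lower bounds for the kernel *)

Section cubes.
Context {R : realType} {d : nat}.
Implicit Types (x y : 'rV[R]_d) (Omega : set 'rV[R]_d).
Notation leb := (@lebesgue_rV R d).
Notation lT := (lebesgueType R d).

Lemma coord_le_norm x i : `|x ord0 i| <= `|x|.
Proof.
rewrite [leRHS]/Num.norm/= mx_normrE.
exact: (le_bigmax _ (fun ij : 'I_1 * 'I_d => `|x ij.1 ij.2|) (ord0, i)).
Qed.

Lemma bounded_coord Omega : bounded_set Omega ->
  exists m : nat, (0 < m)%N /\ forall x i, Omega x -> - m%:R <= x ord0 i < m%:R.
Proof.
move=> [B [_ HB]]; exists (Num.bound (`|B| + 1)); split.
  rewrite -(ltr_nat R); apply: (@lt_trans _ _ (`|B| + 1)); first by rewrite ltr_wpDl.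
  by apply: archi_boundP; rewrite addr_ge0.
move=> x i Ox; have B1 : B < `|B| + 1.
  by apply: le_lt_trans (ler_norm _) _; rewrite ltrDl.
have h1 := HB _ B1 _ Ox.
have h2 : `|B| + 1 < (Num.bound (`|B| + 1))%:R by apply: archi_boundP; rewrite addr_ge0.
have := le_lt_trans (le_trans (coord_le_norm x i) h1) h2.
by rewrite ltr_norml => /andP[/ltW -> ->].
Qed.

Let cell_arith (k m t n : R) : 0 < n ->
  (- m + k / n <= t < - m + k / n + n^-1) = (k <= (t + m) * n < k + 1).
Proof.
move=> n0; have e z : (- m + z / n <= t) = (z <= (t + m) * n).
  by rewrite addrC lerBlDr ler_pdivrMr.
have e' z : (t < - m + z / n) = ((t + m) * n < z).
  by rewrite [_ + _ / n]addrC ltrBrDr ltr_pdivlMr.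
by rewrite e -e' [(k + 1) / n]mulrDl mul1r addrA.
Qed.

Lemma cube_mesh Omega : bounded_set Omega ->
  exists (K : nat -> nat) (Q : forall N, 'I_(K N) -> set 'rV[R]_d), [/\
    forall N i, exists x, Q N i = cube x N.+1%:R^-1,
    forall N (i j : 'I_(K N)) x, Q N i x -> Q N j x -> i = j &
    forall N x, Omega x -> exists i : 'I_(K N), Q N i x].
Proof.
move=> /bounded_coord[m [m0 Hm]].
(* Along each axis, the interval from [- m] to [m] splits into this many pieces of length [1/(N+1)];
   a cell is a choice of one piece per axis. *)
pose M N := (2 * m * N.+1)%N.
pose F N := {ffun 'I_d -> 'I_(M N)}.
pose corner N (f : F N) : 'rV[R]_d := \row_i (- m%:R + (f i)%:R / N.+1%:R).
have N0 N : 0 < N.+1%:R :> R by [].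
have inQ N (f : F N) x : cube (corner N f) N.+1%:R^-1 x <->
    forall i, (f i)%:R <= (x ord0 i + m%:R) * N.+1%:R < (f i).+1%:R.
  rewrite /cube /corner /=; split=> h i; have := h i; rewrite mxE in_itv/=.
    by rewrite cell_arith// natr1.
  by rewrite cell_arith// natr1.
exists (fun N => #|F N|), (fun N i => cube (corner N (enum_val i)) N.+1%:R^-1); split.
- by move=> N i; exists (corner N (enum_val i)).
- move=> N i j x /inQ hi /inQ hj; apply: enum_val_inj; apply/ffunP => k;
  apply: val_inj => /=.
  have /andP[i1 i2] := hi k; have /andP[j1 j2] := hj k.
  apply/eqP; rewrite eqn_leq -ltnS -(ltr_nat R) (le_lt_trans i1 j2)/=.
  by rewrite -ltnS -(ltr_nat R) (le_lt_trans j1 i2).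
- move=> N x Ox.
  have pos i : 0 <= (x ord0 i + m%:R) * N.+1%:R.
    by have /andP[h1 _] := Hm x i Ox; apply: mulr_ge0 => //; lra.
  pose t i := Num.truncn ((x ord0 i + m%:R) * N.+1%:R).
  have tb i : (t i)%:R <= (x ord0 i + m%:R) * N.+1%:R < (t i).+1%:R.
    by rewrite /t; exact: truncn_itv.
  have tM i : (t i < M N)%N.
    rewrite -(ltr_nat R); have /andP[h1 _] := tb i; apply: le_lt_trans h1 _.
    rewrite /M natrM ltr_pM2r// mul2n -addnn natrD ltrD2r.
    by have /andP[] := Hm x i Ox.
  pose f : F N := [ffun i => Ordinal (tM i)].
  exists (enum_rank f); rewrite enum_rankK; apply/inQ => i.
  by rewrite ffunE /=.
Qed.

Lemma bounded_lebesgue_lty Omega : bounded_set Omega -> measurable (Omega : set lT) ->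
  (leb Omega < +oo)%E.
Proof.
move=> /bounded_coord[m [m0 Hm]] mO.
have h0 : 0 <= m%:R + m%:R :> R by rewrite addr_ge0.
have sub : Omega `<=` cube (\row_i (- m%:R)) (m%:R + m%:R).
  move=> x Ox i; rewrite /= mxE in_itv/=; have := Hm x i Ox.
  by rewrite addrA addNr add0r.
apply: (@le_lt_trans _ _ (leb (cube (\row_i (- m%:R)) (m%:R + m%:R)))).
  apply: le_measure; [| |exact: sub]; rewrite inE; [exact: mO|exact: measurable_cube].
by rewrite lebesgue_cube// ltry.
Qed.

Variable s : R.

(** For [d + 2 * s > 0] it is 0 on the diagonal, by the convention for the inverse of 0, in
    agreement with the integrands of [gagliardo2] and [frac_form] there. *)
Definition kernel_weight (p : lT * lT) : R := (Num.sqrt (kernel_dist s p.1 p.2))^-1.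

Lemma measurable_kernel_weight : measurable_fun setT kernel_weight.
Proof.
rewrite (_ : kernel_weight = (fun p : lT * lT => (Num.sqrt (kernel_dist s p.1 p.2)) `^
  (-1))).
  apply: (measurableT_comp (measurable_powR _)).
  by apply: measurable_sqrt; exact: measurable_kernel_dist.
by apply/funext => p; rewrite powR_inv1// sqrtr_ge0.
Qed.

(** A cube of side [h] has Euclidean diameter at most [sqrt d * h]. *)
Definition kernel_cst : R := Num.sqrt d%:R `^ (d%:R + 2 * s).

Lemma kernel_weight_ge x y h : 0 < s -> 0 < h -> (forall i, `|x ord0 i - y ord0 i| <=
  h) ->
  x <> y -> 1 <= kernel_cst * h `^ (d%:R + 2 * s) * kernel_weight (x, y) ^+ 2.
Proof.
move=> s0 h0 xyh xy.
have ds : 0 <= d%:R + 2 * s :> R by rewrite addr_ge0// mulr_ge0// ltW.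
have en0 : 0 < enorm (x - y).
  rewrite lt_def enorm_ge0 andbT; apply/eqP => e0; apply: xy; apply/rowP => i.
  apply/eqP; rewrite -subr_eq0 -sqrf_eq0.
  have S0 : \sum_(j < d) (x - y) ord0 j ^+ 2 <= 0.
    by rewrite -sqrtr_eq0; apply/eqP.
  have S1 : (x - y) ord0 i ^+ 2 <= \sum_(j < d) (x - y) ord0 j ^+ 2.
    by rewrite (bigD1 i)//= lerDl sumr_ge0// => j _; rewrite sqr_ge0.
  rewrite eq_le sqr_ge0 andbT; have := le_trans S1 S0; by rewrite !mxE.
have kd0 : 0 < kernel_dist s x y by rewrite powR_gt0.
rewrite /kernel_weight /= exprVn sqr_sqrtr ?kernel_dist_ge0//.
rewrite ler_pdivlMr// mul1r /kernel_cst -powRM ?sqrtr_ge0 ?(ltW h0)//.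
apply: ge0_ler_powR; rewrite ?nnegrE ?enorm_ge0 ?mulr_ge0 ?sqrtr_ge0 ?(ltW h0)//.
by apply: enorm_le; [exact: ltW|move=> i; rewrite !mxE].
Qed.

Lemma cube_dist x y z h : cube z h x -> cube z h y -> forall i, `|x ord0 i - y ord0 i|
  <= h.
Proof.
move=> zx zy i; have := zx i; have := zy i;
  rewrite /= !in_itv/= => /andP[? ?] /andP[? ?].
by rewrite ler_norml; apply/andP; split; lra.
Qed.

Lemma cube_center x y h : 0 < h -> cube x h y -> forall i, `|x ord0 i - y ord0 i| <= h.
Proof.
move=> h0 xy; apply: (@cube_dist _ _ x) => // i.
by rewrite /= in_itv/= lexx ltrDl.
Qed.

End cubes.

Section gagliardo.
Context {R : realType} {d : nat} (s : R).
Notation leb := (@lebesgue_rV R d).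
Notation lT := (lebesgueType R d).
Notation leb2 := (leb \x leb)%E.
Implicit Types u v : 'rV[R]_d -> R.

Notation gdiff := (weighted_diff (@kernel_weight R d s)).

Lemma measurable_gdiff v : measurable_fun [set: lT] (v : lT -> R) ->
  measurable_fun setT (gdiff v).
Proof. by apply: measurable_gd; exact: measurable_kernel_weight. Qed.

Lemma gdiff_mul u v p :
  gdiff u p * gdiff v p = (u p.1 - u p.2) * (v p.1 - v p.2) / kernel_dist s p.1 p.2.
Proof.
rewrite /weighted_diff /kernel_weight mulrACA -invfM -expr2 sqr_sqrtr//
  kernel_dist_ge0//.
Qed.

Lemma gagliardo2E v : measurable_fun [set: lT] (v : lT -> R) ->
  gagliardo2 s v = sq2 leb2 (gdiff v).
Proof.
move=> mv; rewrite /sq2 fubini_tonelli2.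
- apply: eq_integral => y _; apply: eq_integral => x _ /=.
  by rewrite [in RHS]expr2 gdiff_mul -expr2.
- by apply/measurable_EFinP; apply: measurable_funX; exact: measurable_gdiff.
- by move=> p; rewrite lee_fin sqr_ge0.
Qed.

Lemma gdiff_integrable u v : measurable_fun [set: lT] (u : lT -> R) ->
  measurable_fun [set: lT] (v : lT -> R) ->
  (gagliardo2 s u < +oo)%E -> (gagliardo2 s v < +oo)%E ->
  leb2.-integrable setT (EFin \o (fun p => gdiff u p * gdiff v p)).
Proof.
move=> mu mv u2 v2; rewrite gagliardo2E// in u2; rewrite gagliardo2E// in v2.
by apply: sq2_mul_integrable => //; exact: measurable_gdiff.
Qed.

(** Fubini gives extended inner integrals that are finite only for almost every [y], while
    [frac_form] iterates real-valued ones; the two agree off a null set of [y]. *)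
Lemma frac_formE u v : measurable_fun [set: lT] (u : lT -> R) ->
  measurable_fun [set: lT] (v : lT -> R) ->
  (gagliardo2 s u < +oo)%E -> (gagliardo2 s v < +oo)%E ->
  frac_form s u v =
    frac_const (d := d) s / 2 * \int[leb2]_p (gdiff u p * gdiff v p).
Proof.
move=> mu mv u2 v2; have ii := gdiff_integrable mu mv u2 v2.
rewrite /frac_form; congr (_ * _).
rewrite /Rintegral -(integral21_prod_meas1 ii); congr fine.
apply: (@ae_eq_integral _ _ _ leb setT _ _ measurableT).
- apply/measurable_EFinP; apply: (measurableT_comp (@fine_measurable R setT
  measurableT)).
  rewrite (_ : (fun _ => _) = fubini_G leb (EFin \o (fun p => gdiff u p * gdiff v p))).
    exact: measurable_fubini_G ii.
  by apply/funext => y; apply: eq_integral => x _ /=; rewrite gdiff_mul.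
- exact: measurable_fubini_G ii.
apply: filterS (ae_integrable2 ii) => y iy _.
rewrite /fubini_G -[RHS]fineK; last exact: integrable_fin_num.
by congr (EFin (fine _)); apply: eq_integral => x _ /=; rewrite gdiff_mul.
Qed.

End gagliardo.

Section Lp_facts.
Context {R : realType} {d : nat}.
Notation leb := (@lebesgue_rV R d).
Notation lT := (lebesgueType R d).
Implicit Types (Omega : set 'rV[R]_d) (f v : 'rV[R]_d -> R).

Lemma LpP Omega (p : R) f : 0 < p ->
  Lp Omega p%:E f <-> measurable_fun [set: lT] (restr Omega f) /\
    (\int[leb]_x (`|restr Omega f x| `^ p)%:E < +oo)%E.
Proof.
move=> p0; rewrite /Lp.
have E : (\int[leb]_x (`|restr Omega f x| `^ p)%:E =
    'N[leb]_p%:E[EFin \o restr Omega f] `^ p)%E.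
  by rewrite poweR_Lnorm ?gt_eqF//; apply: eq_integral => x _.
split=> [/andP[]|[mf fp]].
  rewrite !inE/= => mf; rewrite /finite_norm => fp; split => //.
  by rewrite E poweR_lty.
apply/andP; rewrite !inE/=; split => //; rewrite /finite_norm.
rewrite unlock/= poweR_lty// (_ : (\int[_]__ _)%E = (\int[leb]_x (`|restr Omega f x| `^
  p)%:E)%E)//.
Qed.

Lemma Lp2P Omega f : Lp Omega 2%:E f <->
  measurable_fun [set: lT] (restr Omega f) /\ (sq2 leb (restr Omega f) < +oo)%E.
Proof.
rewrite (LpP Omega f (ltr0Sn R 1)).
have -> : (\int[leb]_x (`|restr Omega f x| `^ 2)%:E)%E = sq2 leb (restr Omega f);
  last by [].
by apply: eq_integral => x _; rewrite powR_mulrn// real_normK ?num_real.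
Qed.

Lemma Lp_norm2 Omega f : (Lp_norm Omega 2%:E f `^ 2 = sq2 leb (restr Omega f))%E.
Proof.
rewrite /Lp_norm poweR_Lnorm//; apply: eq_integral => x _ /=.
by rewrite powR_mulrn// real_normK ?num_real.
Qed.

Lemma Lp_norm1 Omega f :
  (Lp_norm Omega 1%:E f = \int[leb]_x `|restr Omega f x|%:E)%E.
Proof. by rewrite /Lp_norm Lnorm1. Qed.

Lemma Lp1P Omega f : Lp Omega 1%:E f <-> measurable_fun [set: lT] (restr Omega f) /\
  (\int[leb]_x `|restr Omega f x|%:E < +oo)%E.
Proof.
rewrite (LpP Omega f ltr01).
have -> : (\int[leb]_x (`|restr Omega f x| `^ 1)%:E)%E = (\int[leb]_x `|restr Omega f
  x|%:E)%E;
  last by [].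
by apply: eq_integral => x _; rewrite powRr1.
Qed.

Lemma Lp_ooP Omega f (M : R) : measurable_fun [set: lT] (restr Omega f) ->
  {ae leb, forall x, `|restr Omega f x| <= M} -> Lp Omega +oo%E f.
Proof.
move=> mf fM; rewrite /Lp; apply/andP; rewrite !inE/=; split => //;
  rewrite /finite_norm.
rewrite unlock/=; case: ifP => _; last exact: ltry.
apply: (@le_lt_trans _ _ M%:E); last exact: ltry.
by apply/ess_sup_inf.ess_supP; apply: filterS fM => x h; rewrite /= lee_fin.
Qed.

Lemma ae_lebesgueS (P P' : lT -> Prop) : (forall x, P x -> P' x) ->
  {ae leb, forall x, P x} -> {ae leb, forall x, P' x}.
Proof. by move=> h; exact: filterS. Qed.

Lemma restrT f : restr setT f = f.
Proof. by apply/funext => x; rewrite /restr patchE in_setT. Qed.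

End Lp_facts.

Section fractional_space.
Context {R : realType} {d : nat} (s : R) (Omega : set 'rV[R]_d).
Notation leb := (@lebesgue_rV R d).
Notation lT := (lebesgueType R d).
Notation wt := (@kernel_weight R d s).
Notation mlf v := (measurable_fun [set: lT] (v : lT -> R)).
Notation tf := (@test_function R d Omega : set (lT -> R)).
Notation Ht := (energy_closure leb wt tf).
Notation hs2 := (Hs_sq leb wt).
Implicit Types (u v phi : 'rV[R]_d -> R).

Lemma gagliardo2_energy v : mlf v -> gagliardo2 s v = nonlocal_energy leb wt v.
Proof. exact: gagliardo2E. Qed.

Lemma HsP v : Hs s v <-> mlf v /\ (hs2 v < +oo)%E.
Proof.
rewrite /Hs Lp2P restrT /Hs_sq; split=> [[[mv v2] g2]|[mv v2]].
  by split; [exact: mv|rewrite -(gagliardo2_energy mv); exact: lte_add_pinfty].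
split; first by split; [exact: mv|exact: le_lt_trans (sq2_le_hs2 leb wt v) v2].
by rewrite (gagliardo2_energy mv); exact: le_lt_trans (energy_le_hs2 leb wt v) v2.
Qed.

Lemma Hs_normE v : mlf v -> Hs_norm s v = (hs2 v `^ 2^-1)%E.
Proof. by move=> mv; rewrite /Hs_norm Lp_norm2 restrT (gagliardo2_energy mv). Qed.

Lemma Hs_norm_lt v (e : R) : mlf v -> 0 < e -> (Hs_norm s v < e%:E)%E = (hs2 v < (e ^+
  2)%:E)%E.
Proof.
move=> mv e0; rewrite (Hs_normE mv); have := hs2_ge0 leb wt v.
case: (hs2 v) => [x| |].
- rewrite lee_fin => x0; rewrite poweR_EFin !lte_fin powR12_sqrt//.
  by rewrite -(@ltr_pXn2r _ 2)// ?nnegrE ?sqrtr_ge0 ?ltW// sqr_sqrtr.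
- by rewrite poweRyr ?invr_eq0.
- by [].
Qed.

Lemma test_function_measurable phi : test_function Omega phi -> mlf phi.
Proof.
move=> [sm _ _]; apply: continuous_lebesgue_measurable => x.
exact: differentiable_continuous (sm [::] x).
Qed.

Lemma Hs_tildeP v : Hs_tilde s Omega v <-> Ht v.
Proof.
split=> [[/HsP[mv v2] app]|[mv v2 app]].
  split; [exact: mv|exact: v2|] => e e0.
  have se0 : 0 < Num.sqrt e by rewrite sqrtr_gt0.
  have [phi [tphi lt]] := app _ se0.
  have mm : mlf (v \- phi)%R := measurable_funB mv (test_function_measurable tphi).
  exists phi; first exact: tphi.
  by move: lt; rewrite (Hs_norm_lt mm se0) sqr_sqrtr ?ltW.
split; first by apply/HsP; split; [exact: mv|exact: v2].
move=> e e0; have [phi tphi lt] := app (e ^+ 2) (exprn_gt0 2 e0).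
have mm : mlf (v \- phi)%R := measurable_funB mv (test_function_measurable tphi).
by exists phi; split; [exact: tphi|rewrite (Hs_norm_lt mm e0)].
Qed.

Lemma frac_form_eform u v : Ht u -> Ht v ->
  frac_form s u v = 2 * (frac_const (d := d) s / 4) * energy_form leb wt u v.
Proof.
move=> [mu u2 _] [mv v2 _].
have g2 z : mlf z -> (hs2 z < +oo)%E -> (gagliardo2 s z < +oo)%E.
  move=> mz z2; rewrite (gagliardo2_energy mz).
  exact: le_lt_trans (energy_le_hs2 leb wt z) z2.
rewrite (frac_formE mu mv (g2 _ mu u2) (g2 _ mv v2)).
congr (_ * _); lra.
Qed.

Lemma fractional_energy_space : (2 <= d)%N -> 0 < s < 1 -> bounded_set Omega -> open
  Omega ->
  exists CS CP, energy_space leb wt d s CS CP (Omega : set lT) Ht.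
Proof.
move=> d2 /andP[s0 s1] bO oO.
have mO : measurable (Omega : set lT) by apply: rV_lebesgue_measurable;
  exact: open_measurable_rV.
have d0 : (0 < d)%N by exact: ltnW.
(* [s < 1] and [d >= 2] ensure the range in which the Sobolev exponent [2d / (d - 2s)] is finite. *)
have sd : 2 * s < d%:R by apply: (@lt_le_trans _ _ 2); [lra|rewrite ler_nat].
have c0 : 0 < @kernel_cst R d s by rewrite powR_gt0// sqrtr_gt0 ltr0n.
apply: (@Htilde_energy_space _ lT R leb wt tf Omega lebesgue_rV_complete
  (measurable_kernel_weight s) test_function_measurable (test_function_cst0 Omega)
  (@test_functionD R d Omega) (@test_functionZ R d Omega) (fun phi x =>
    @test_function_off R d Omega phi x)
  _ mO (bounded_lebesgue_lty bO mO) d s (@kernel_cst R d s) cube d0 c0 s0 sd).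
- move=> k e k0 e0; exists (smooth_excess k e); split.
  + apply: measurable_funB; last exact: measurable_cst.
    apply: measurable_funM; last exact: measurable_cst.
    have mk : measurable_fun setT (fun t : R => t - k).
      by apply: measurable_funB; [exact: measurable_id|exact: measurable_cst].
    apply: measurable_funD; first exact: mk.
    apply: measurable_sqrt; apply: measurable_funD; last exact: measurable_cst.
    exact: measurable_funX.
  + exact: smooth_excess0.
  + by move=> t t'; exact: smooth_excess_lip.
  + by move=> t; exact: smooth_excess_approx.
  + by move=> phi; exact: test_function_smooth_excess.
- exact: measurable_cube.
- by move=> x h h0; exact: lebesgue_cube.
- move=> x y h h0 cxy xy; apply: kernel_weight_ge => //; exact: cube_center cxy.
Qed.

End fractional_space.

Theorem theorem4p1 (R : realType) (d : nat) (Omega : set 'rV[R]_d)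
    (s r lambda mu alpha beta : R) (a L : 'rV[R]_d -> R -> R) :
  (2 <= d)%N ->
  is_domain Omega -> bounded_set Omega -> lipschitz_boundary Omega ->
  0 < lambda -> 0 < mu -> alpha < 0 -> 0 < beta ->
  0 < s < 1 -> d%:R / (2 * s) < r ->
  Caratheodory Omega a ->
  {ae @lebesgue_rV R d, forall x, Omega x -> {homo a x : t t' / t <= t'}} ->
  Lp Omega r%:E (a ^~ 0) ->
  Caratheodory Omega L ->
  (forall m : R, 0 < m -> exists phi sigma : 'rV[R]_d -> R,
    [/\ Lp Omega r%:E phi, Lp Omega 1%:E sigma &
      {ae @lebesgue_rV R d, forall x, Omega x -> forall t, - m <= t <= m ->
        `|a x t| <= phi x /\ `|L x t| <= sigma x}]) ->
  (forall m : R, 0 < m -> exists2 phi : 'rV[R]_d -> R,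
    Lp Omega (2 * d%:R / (d%:R + 2 * s))%:E phi &
    {ae @lebesgue_rV R d, forall x, Omega x -> forall t, - m <= t <= m ->
      `|a x t| <= phi x}) ->
  exists ubar qbar : 'rV[R]_d -> R,
    [/\ feasible s Omega a alpha beta ubar qbar,
        Lp Omega +oo%E ubar &
        forall u q, feasible s Omega a alpha beta u q ->
          (cost Omega L lambda mu ubar qbar <= cost Omega L lambda mu u q)%E].
Proof.
move=> d2 [_ oO _] bO _ lam0 mu0 al0 be0 s01 rn [ma ca] ha ar [mL cL] bL ap.
have [CS [CP ES]] := fractional_energy_space d2 s01 bO oO.
have /andP[s0 s1] := s01.
have d0 : 0 < d%:R :> R by rewrite ltr0n; exact: ltnW.
have r0 : 0 < r by apply: lt_trans rn; rewrite divr_gt0// mulr_gt0.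
have p0 : 0 < 2 * d%:R / (d%:R + 2 * s) :> R.
  by rewrite divr_gt0 ?mulr_gt0// addr_gt0// mulr_gt0.
have [K [Q [Qcube Qdisj Qcov]]] := cube_mesh bO.
have c0 : 0 < @kernel_cst R d s by rewrite powR_gt0// sqrtr_gt0.
have h0 (N : nat) : 0 < N.+1%:R^-1 :> R by rewrite invr_gt0.
have hsmall (e : R) : 0 < e -> exists N : nat, N.+1%:R^-1 <= e.
  by move=> e0; have [N HN] := harmonic_small e0; exists N; exact: HN.
have mQ N i : measurable (Q N i : set (lebesgueType R d)).
  by have [x ->] := Qcube N i; exact: measurable_cube.
have QE N i : (@lebesgue_rV R d) (Q N i) = (N.+1%:R^-1 ^+ d)%:E.
  by have [x ->] := Qcube N i; apply: lebesgue_cube; exact: ltW.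
have Qw N i (x y : 'rV[R]_d) : Q N i x -> Q N i y -> x <> y ->
    1 <= @kernel_cst R d s * N.+1%:R^-1 `^ (d%:R + 2 * s) * kernel_weight s (x, y) ^+ 2.
  have [z ->] := Qcube N i => zx zy xy.
  by apply: kernel_weight_ge => //; exact: cube_dist zx zy.
(* [kap] is a quarter of the constant: the form carries one half of it, and the quadratic functional
   another factor one half. *)
have kap0 : 0 < @frac_const R d s / 4 by rewrite divr_gt0// frac_const_gt0.
have /(LpP Omega _ r0)[_ ar'] := ar.
have ap' (m : R) : 0 < m -> exists phi : lebesgueType R d -> R,
    [/\ measurable_fun setT (restr Omega phi),
      (\int[lebesgue_rV]_x (`|restr Omega phi x| `^ (2 * d%:R / (d%:R + 2 * s)))%:E <
        +oo)%E &
      {ae @lebesgue_rV R d, forall x, Omega x -> forall t, - m <= t <= m -> `|a x t| <=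
        phi x}].
  by move=> /ap[phi /(LpP Omega _ p0)[mphi phioo] aphi]; exists phi; split;
    [exact: mphi|exact: phioo|exact: aphi].
have bL' (m : R) : 0 < m -> exists sigma : lebesgueType R d -> R,
    [/\ measurable_fun setT (restr Omega sigma),
      (\int[lebesgue_rV]_x `|restr Omega sigma x|%:E < +oo)%E &
      {ae @lebesgue_rV R d, forall x, Omega x -> forall t, - m <= t <= m -> `|L x t| <=
        sigma x}].
  move=> /bL[phi [sigma [_ /Lp1P[msig sigoo] h]]]; exists sigma; split;
    [exact: msig|exact: sigoo|].
  by apply: ae_lebesgueS h => x hx Ox t tm; have [] := hx Ox t tm.
have [u [q [fu q2 [M uM] qmin]]] := @domain_optimal_control _ _ _ _ _ _ _ _ _ _ _ ES _
  _ K Q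
  c0 h0 hsmall mQ QE Qdisj Qw Qcov a L _ r alpha beta lambda mu kap0 rn ma ca ha ar' ap'
  mL cL bL' (ltW al0) (ltW be0) (ltW lam0) (ltW mu0).
have costE v p : cost Omega L lambda mu v p =
    domain_cost (@lebesgue_rV R d) Omega L lambda mu v p.
  by rewrite /cost Lp_norm2 Lp_norm1.
exists u, q; split.
- have [hu mq qab ueq] := fu; split.
  + exact/Hs_tildeP.
  + by split; [apply/Lp2P; split; [exact: mq|exact: q2]|exact: qab].
  + move=> v /Hs_tildeP hv; have [I e] := ueq v hv; split; first exact: I.
    by rewrite (frac_form_eform hu hv).
- have [hu _ _ _] := fu.
  have mO : measurable (Omega : set (lebesgueType R d)) := es_measurable_domain ES.
  (* The maximum with 0 covers the points off [Omega], where the extension is 0, without a sign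
     condition on [M]. *)
  apply: (@Lp_ooP _ _ _ _ (Num.max M 0)).
    by apply/(measurable_restrictT _ mO); apply: measurable_funTS;
      exact: (es_measurable ES hu).
  apply: ae_lebesgueS uM => x uM; rewrite /restr patchE le_max.
  by case: ifP => _; [rewrite uM|rewrite normr0 lexx orbT].
- move=> u' q' [/Hs_tildeP hu' [/Lp2P[mq' _] qab'] ueq']; rewrite !costE; apply: qmin.
  split; [exact: hu'|exact: mq'|exact: qab'|] => v hv.
  have [I e] := ueq' v ((Hs_tildeP s Omega v).2 hv); split; first exact: I.
  by rewrite -(frac_form_eform hu' hv).
Qed.
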